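(* Let $H\ge 0$ and $\mathcal S_H=\{z=x+iy\in\mathbb C:\ |y|\le H\}$. Let $A=\{a_n\}\subset\mathcal S_H$ be an almost periodic set, let $\mu_A=\sum_n\delta_{a_n}$, and suppose that the c-Fourier transform $\hat\mu_A^c$ is a pure point measure $$\hat\mu_A^c=\sum_{\gamma\in\Gamma}b_\gamma\delta_\gamma,\qquad \Gamma=\{\gamma\in\mathbb R:\ b_\gamma\ne0\}\subset\mathbb R\ \text{countable},$$ with coefficients $b_\gamma\in\mathbb C$ satisfying $$\log\sum_{|\gamma|<r}|b_\gamma|=O(r)\quad (r\to\infty)\qquad\text{and}\qquad \sum_{0<|\gamma|<1}|b_\gamma/\gamma|<\infty .$$ Then there exists a Dirichlet series $$Q(z)=\sum_{\omega\in\Omega} q_\omega e^{2\pi i\omega z},\qquad q_\omega\in\mathbb C,\quad \sum_{\omega\in\Omega}|q_\omega|<\infty,\quad \Omega\subset\mathbb R\ \text{bounded (and countable)},\quad z\in\mathbb C,$$ with zero set $A$ (zeros counted with multiplicity). If, in addition, $\Gamma$ is locally finite, then the Dirichlet series is an exponential polynomial $\sum_{1\le j\le N}q_je^{2\pi i\omega_jz}$ with $q_j\in\mathbb C$, $\omega_j\in\mathbb R$.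
   Context: Multisets: $A=\{a_n\}$ is a multiset in which each point occurs a finite number of times; ''zero set'' means the set of all zeros in $\mathbb C$ counted with multiplicity. A set is locally finite if its intersection with every compact set is finite (for multisets, counted with multiplicity). $\delta_a$ is the unit mass at $a$. Asymptotics: $\log S(r)=O(r)$ is an upper growth bound, i.e. $S(r)\le Ce^{Cr}$ for some $C<\infty$ and all large $r$. c-Fourier transform: let $\mathcal D$ be the space of all $C^\infty$ functions on $\mathbb R$ with compact support. For $\varphi\in\mathcal D$ put $\hat\varphi^c(z)=\int_{\mathbb R}\varphi(t)e^{-2\pi izt}\,dt$, $z\in\mathbb C$. For a measure $\mu$ supported in $\mathcal S_H$ such that $M_\mu(r):=|\mu|(\{z\in\mathcal S_H:|z|\le r\})$ satisfies $\log M_\mu(r)=O(\log r)$ as $r\to\infty$ ($|\mu|$ is the variation of $\mu$), the c-Fourier transform $\hat\mu^c$ is the distribution on $\mathbb R$ defined by $(\hat\mu^c,\varphi)=(\mu,\hat\varphi^c)=\int\hat\varphi^c(z)\,\mu(dz)$, $\varphi\in\mathcal D$ (the integral converges absolutely). Almost periodicity: a continuous function $g$ on $\mathbb C$ is almost periodic if for all real $\alpha'<\beta'$ and $\varepsilon>0$ the set $\{\tau\in\mathbb R:\ \sup_{x\in\mathbb R,\ \alpha'\le y\le\beta'}|g(x+\tau+iy)-g(x+iy)|<\varepsilon\}$ is relatively dense, i.e. meets every interval $(t,t+L)$, $t\in\mathbb R$, for some $L$ depending on $\alpha',\beta',\varepsilon$. A measure $\mu$ supported in a closed horizontal strip of finite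 width is almost periodic if for every continuous function $\varphi$ on $\mathbb C$ with compact support the convolution $\varphi\star\mu(z)=\int\varphi(z-w)\,\mu(dw)$ is an almost periodic function on $\mathbb C$. A locally finite multiset $A=\{a_n\}$ in such a strip is almost periodic if the measure $\mu_A=\sum_n\delta_{a_n}$ is almost periodic. *)

(* Defs.v *)
(* The real line is an arbitrary [R : realType], the complex plane is [R[i]]. *)
From HB Require Import structures.
From mathcomp Require Import all_boot all_order all_algebra.
From mathcomp Require Import all_classical all_reals all_analysis.
From mathcomp Require Import complex finmap.
From mathcomp Require analysis.showcase.summability.

Set Implicit Arguments.
Unset Strict Implicit.
Unset Printing Implicit Defensive.

Import Order.TTheory GRing.Theory Num.Theory.
Import numFieldNormedType.Exports.

Local Open Scope classical_set_scope.
Local Open Scope ring_scope.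
Local Open Scope complex_scope.

(* The topology of [R[i]] and its structure of normed space over itself are
   those given by the modulus; [derivable] on [R[i]] is complex
   differentiability. *)
HB.instance Definition _ (R : realType) := NormedModule.copy R[i] R[i]^o.

(* The modulus as a real number; [`|z|] has type [R[i]]. *)
Notation normc := ComplexField.Normc.normc.

Definition borelC (R : realType) := g_sigma_algebraType (@open R[i]).

Definition cexp (R : realType) (z : R[i]) : R[i] :=
  (expR (complex.Re z))%:C * (cos (complex.Im z) +i* sin (complex.Im z)).

(* [character w z] is e^{2 pi i w z}. *)
Definition character (R : realType) (w : R) (z : R[i]) : R[i] :=
  cexp ((0 +i* (2 * pi * w)) * z).

(* Integrals are total: the value is meaningful when [f] is integrable. *)
Definition cintegral d (T : measurableType d) (R : realType)
    (mu : {measure set T -> \bar R}) (f : T -> R[i]) : R[i] :=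
  (\int[mu]_x complex.Re (f x)) +i* (\int[mu]_x complex.Im (f x)).

(* [f] has unconditional, hence absolutely convergent, sum [s] over [D]. *)
Definition has_csum (R : realType) (I : choiceType) (D : set I)
    (f : I -> R[i]) (s : R[i]) : Prop :=
  summability.partial_sum (fun i => if i \in D then f i else 0)
    @ summability.totally --> s.

Definition locally_finite (T : topologicalType) (S : set T) : Prop :=
  forall K : set T, compact K -> finite_set (S `&` K).

Definition compactly_supported (R : realType) (T : topologicalType)
    (f : T -> R[i]) : Prop :=
  compact (closure [set x | f x != 0]).

(* A multiset of points of the plane is given by its multiplicity function;
   multiplicities being finite, it is locally finite with multiplicity counted
   as soon as its set of points is. *)
Definition msupp (R : realType) (A : R[i] -> nat) : set R[i] :=
  [set a | A a != 0%N].

Definition strip (R : realType) (H : R) : set R[i] := [set z | `|complex.Im z| <= H].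

Section multiset_measure.
Context (R : realType) (A : R[i] -> nat).

Definition multiset_measure (B : set (borelC R)) : \bar R :=
  (\esum_(a in B) (A a)%:R%:E)%E.

Let multiset_measure0 : multiset_measure set0 = 0%E.
Proof. exact: esum_set0. Qed.

Let multiset_measure_ge0 B : (0 <= multiset_measure B)%E.
Proof. by apply: esum_ge0 => a _; rewrite lee_fin. Qed.

Let multiset_measure_sigma_additive : semi_sigma_additive multiset_measure.
Proof.
move=> F _ tF _; rewrite /multiset_measure nneseries_sum_bigcup//.
apply: is_cvg_nneseries => n _ _.
by apply: esum_ge0 => a _; rewrite lee_fin.
Qed.

HB.instance Definition _ := isMeasure.Build _ _ _ multiset_measure
  multiset_measure0 multiset_measure_ge0 multiset_measure_sigma_additive.

End multiset_measure.

Definition test_function (R : realType) (phi : R -> R[i]) : Prop :=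
  [/\ compactly_supported phi,
      forall n x, derivable (derive1n n (fun t => complex.Re (phi t))) x 1 &
      forall n x, derivable (derive1n n (fun t => complex.Im (phi t))) x 1].

Definition fourier_c (R : realType) (phi : R -> R[i]) (z : R[i]) : R[i] :=
  cintegral lebesgue_measure (fun t : R => phi t * character (- t) z).

Definition fourier_c_measure (R : realType)
    (mu : {measure set (borelC R) -> \bar R}) (phi : R -> R[i]) : R[i] :=
  cintegral mu (fourier_c phi).

Definition spectrum (R : realType) (b : R -> R[i]) : set R :=
  [set g | b g != 0].

(* The distribution [T] is the complex measure sum_gamma b_gamma delta_gamma;
   locally finite variation is part of being a measure on the line. *)
Definition is_pure_point (R : realType) (T : (R -> R[i]) -> R[i])
    (b : R -> R[i]) : Prop :=
  [/\ countable (spectrum b),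
      forall r : R,
        (\esum_(g in spectrum b `&` [set g | `|g| < r]%R)
           (normc (b g))%:E < +oo)%E &
      forall phi : R -> R[i], test_function phi ->
        has_csum (spectrum b) (fun g => b g * phi g) (T phi)].

Definition relatively_dense (R : realType) (E : set R) : Prop :=
  exists L : R, forall t : R, exists2 tau, E tau & t < tau < t + L.

Definition almost_periodic_fun (R : realType) (g : R[i] -> R[i]) : Prop :=
  continuous g /\
  forall alpha beta eps : R, alpha < beta -> 0 < eps ->
    relatively_dense [set tau : R |
      (ereal_sup [set (normc (g ((p.1 + tau) +i* p.2) - g (p.1 +i* p.2)))%:E
                 | p in [set p : R * R | alpha <= p.2 <= beta]%R]
       < eps%:E)%E].

Definition convolution (R : realType) (phi : R[i] -> R[i])
    (mu : {measure set (borelC R) -> \bar R}) (z : R[i]) : R[i] :=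
  cintegral mu (fun w => phi (z - w)).

(* Only meant for measures carried by a horizontal strip of finite width. *)
Definition almost_periodic_measure (R : realType)
    (mu : {measure set (borelC R) -> \bar R}) : Prop :=
  forall phi : R[i] -> R[i], continuous phi -> compactly_supported phi ->
    almost_periodic_fun (convolution phi mu).

Definition almost_periodic_multiset (R : realType) (A : R[i] -> nat) : Prop :=
  locally_finite (msupp A) /\ almost_periodic_measure (multiset_measure A).

(* [f] vanishes at [a] to order exactly [m]; [m = 0] means that [a] is not a
   zero of [f]. *)
Definition zero_order (R : realType) (f : R[i] -> R[i]) (a : R[i]) (m : nat) :
    Prop :=
  exists g : R[i] -> R[i],
    [/\ \forall z \near a, derivable g z 1,
        g a != 0 &
        \forall z \near a, f z = (z - a) ^+ m * g z].

Definition has_zero_set (R : realType) (f : R[i] -> R[i]) (A : R[i] -> nat) :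
    Prop :=
  forall a : R[i], zero_order f a (A a).

Definition is_dirichlet_series (R : realType) (Q : R[i] -> R[i])
    (Omega : set R) (q : R -> R[i]) : Prop :=
  [/\ countable Omega,
      bounded_set Omega,
      (\esum_(w in Omega) (normc (q w))%:E < +oo)%E &
      forall z : R[i], has_csum Omega (fun w => q w * character w z) (Q z)].

Definition is_exponential_polynomial (R : realType) (Q : R[i] -> R[i]) : Prop :=
  exists (N : nat) (q : 'I_N -> R[i]) (w : 'I_N -> R),
    forall z : R[i], Q z = \sum_(j < N) q j * character (w j) z.

(* log S(r) = O(r) as r -> +oo, exponentiated so that S may vanish. *)
Definition log_bigO_id (R : realType) (S : R -> \bar R) : Prop :=
  exists C : R, \forall r \near +oo, (S r <= (C * expR (C * r))%:E)%E.

(* Main.v *)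
(* Proof idea. Let Q be the genus one canonical product over A, normalized at a point
   p = i P above the strip; almost periodicity bounds the number of points of A in
   unit boxes, so the product converges and has order at most 2. Testing the
   hypothesis on the Fourier transform against smooth cut-offs of
   e^{2 pi i t z} 1_{t > 0}, and of - e^{2 pi i t z} 1_{t <= 0} below the strip, gives
   Q'/Q up to a constant as - 2 pi i sum_{g > 0} b_g e^{2 pi i g z} high above A and
   as 2 pi i sum_{g <= 0} b_g e^{2 pi i g z} far below. Hence, up to factors e^{l z},
   Q is C exp (- sum_{g > 0} (b_g / g) e^{2 pi i g z}) on a line above, and
   C' e^{2 pi i b_0 z} exp (sum_{g < 0} (b_g / g) e^{2 pi i g z}) on a line below, b_0
   being real as the mean density of A. Expanding the exponentials gives absolutely
   convergent Dirichlet series on both lines, with frequencies in [0, +oo[ and in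
   ]-oo, b_0] respectively. The coefficients are means of Q against a
   rapidly decaying kernel, which do not depend on the line by a contour shift; so
   both series have the same coefficients, the frequencies lie in [0, b_0], and the
   series represents Q everywhere. If the spectrum is locally finite, only finitely
   many elements of the monoid generated by its positive part lie in [0, b_0].
   Holomorphy is replaced throughout by quantitative second order Taylor estimates
   (jets), which are stable under products and sums. *)
Require Import Defs.
From HB Require Import structures.
From mathcomp Require Import all_boot all_order all_algebra.
From mathcomp Require Import all_classical all_reals all_analysis.
From mathcomp Require Import complex finmap.
From mathcomp Require Import ring lra zify measurable_realfun.
Import Order.TTheory GRing.Theory Num.Theory.
Import numFieldNormedType.Exports.
Local Open Scope classical_set_scope.
Local Open Scope ring_scope.
Local Open Scope complex_scope.
Set Implicit Arguments.
Unset Strict Implicit.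
Unset Printing Implicit Defensive.

(** * Modulus and exponential *)

(** The sums of the moduli of b_g over growing intervals may grow exponentially, so the spectral
    series for Q'/Q are controlled only far from the real axis: nothing is expanded near A, and two
    distant lines are compared instead. Integrating Q'/Q divides b_g by g: harmless for |g| >= 1,
    paid for near 0 by the last hypothesis, and impossible at g = 0, which yields the factor e^{2 pi
    i b_0 z}. That b_0 is real has its own proof: A looks almost symmetric from i y and - i y for
    large y. The sum of 1/(z - a) over A need not converge absolutely, whereas 1/(z - a) - 1/(p - a)
    is O(1/|a|^2); every test function therefore carries a subtracted copy at p, and bounds uniform
    in the cut-off are proved for the difference. No Cauchy theory is used. Contour shifts come from
    translation invariance of the integral. A function of order 2 that vanishes on a line is 0
    because its kernel averages over small dilates about any point can be moved to that line. The
    kernel must beat e^{c|z|^2} for every c, which rules out a Gaussian and leads to the fourth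
    power. *)

Section complex_modulus.
Context (R : realType).
Implicit Types (x y z : R[i]) (r : R).

Lemma normc_ge0 z : 0 <= normc z.
Proof. by case: z => a b; rewrite sqrtr_ge0. Qed.

Lemma normcE z : `|z| = (normc z)%:C.
Proof. by case: z. Qed.

Lemma normcD z y : normc (z + y) <= normc z + normc y.
Proof. exact: le_normcD. Qed.

Lemma normcN z : normc (- z) = normc z.
Proof. by case: z => a b /=; rewrite !sqrrN. Qed.

Lemma normcBC z y : normc (z - y) = normc (y - z).
Proof. by rewrite -normcN opprB. Qed.

Lemma normcB z y : normc (z - y) <= normc z + normc y.
Proof. by rewrite -(normcN y); exact: normcD. Qed.

Lemma normcM z y : normc (z * y) = normc z * normc y.
Proof. exact: ComplexField.Normc.normcM. Qed.

Lemma normc0 : normc (0 : R[i]) = 0.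
Proof. exact: ComplexField.Normc.normc0. Qed.

Lemma normc1 : normc (1 : R[i]) = 1.
Proof. exact: ComplexField.Normc.normc1. Qed.

Lemma normcX z n : normc (z ^+ n) = normc z ^+ n.
Proof. by elim: n => [|n IH]; rewrite ?expr0 ?normc1// !exprS normcM IH. Qed.

Lemma normcV z : normc (z^-1) = (normc z)^-1.
Proof. exact: ComplexField.Normc.normcV. Qed.

Lemma normc_eq0 z : (normc z == 0) = (z == 0).
Proof.
by apply/eqP/eqP => [/ComplexField.Normc.eq0_normc//|->]; exact: normc0.
Qed.

Lemma normc_gt0 z : (0 < normc z) = (z != 0).
Proof. by rewrite lt0r normc_eq0 normc_ge0 andbT. Qed.

Lemma normcR r : normc r%:C = `|r|.
Proof. by rewrite /= expr0n /= addr0 sqrtr_sqr. Qed.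

Lemma normc_i r : normc (0 +i* r) = `|r|.
Proof. by rewrite /= expr0n /= add0r sqrtr_sqr. Qed.

Lemma normc_nat n : normc (n%:R : R[i]) = n%:R.
Proof. by rewrite -[n%:R]/(n%:R) -(rmorph_nat (real_complex R)) normcR ger0_norm. Qed.

Lemma normc_sqr z : normc z ^+ 2 = complex.Re z ^+ 2 + complex.Im z ^+ 2.
Proof. by case: z => a b /=; rewrite sqr_sqrtr ?addr_ge0 ?sqr_ge0. Qed.

Lemma Re_le_normc z : `|complex.Re z| <= normc z.
Proof.
case: z => a b /=; rewrite -sqrtr_sqr; apply: ler_wsqrtr.
by rewrite lerDl sqr_ge0.
Qed.

Lemma Im_le_normc z : `|complex.Im z| <= normc z.
Proof.
case: z => a b /=; rewrite -sqrtr_sqr; apply: ler_wsqrtr.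
by rewrite lerDr sqr_ge0.
Qed.

Lemma normc_le_ReIm z : normc z <= `|complex.Re z| + `|complex.Im z|.
Proof.
have {1}-> : z = (complex.Re z)%:C + (0 +i* complex.Im z).
  by case: z => a b; apply/eqP; rewrite eq_complex /= add0r addr0 !eqxx.
by apply: (le_trans (normcD _ _)); rewrite normcR normc_i.
Qed.

Lemma normc_lerB z y : normc z - normc y <= normc (z - y).
Proof. by rewrite lerBlDr; have := normcD (z - y) y; rewrite subrK. Qed.

Lemma normc_sum (I : Type) (s : seq I) (P : pred I) (F : I -> R[i]) :
  normc (\sum_(i <- s | P i) F i) <= \sum_(i <- s | P i) normc (F i).
Proof.
elim/big_rec2: _ => [|i y z _ h]; first by rewrite normc0.
by apply: le_trans (normcD _ _) _; rewrite lerD2l.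
Qed.

Lemma Re_D z y : complex.Re (z + y) = complex.Re z + complex.Re y.
Proof. by case: z y => [a b] [c d]. Qed.
Lemma Im_D z y : complex.Im (z + y) = complex.Im z + complex.Im y.
Proof. by case: z y => [a b] [c d]. Qed.
Lemma Re_N z : complex.Re (- z) = - complex.Re z.
Proof. by case: z. Qed.
Lemma Im_N z : complex.Im (- z) = - complex.Im z.
Proof. by case: z. Qed.
Lemma Re_B z y : complex.Re (z - y) = complex.Re z - complex.Re y.
Proof. by rewrite Re_D Re_N. Qed.
Lemma Im_B z y : complex.Im (z - y) = complex.Im z - complex.Im y.
Proof. by rewrite Im_D Im_N. Qed.
Lemma Re_M z y : complex.Re (z * y) =
  complex.Re z * complex.Re y - complex.Im z * complex.Im y.
Proof. by case: z y => [a b] [c d]. Qed.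
Lemma Im_M z y : complex.Im (z * y) =
  complex.Re z * complex.Im y + complex.Im z * complex.Re y.
Proof. by case: z y => [a b] [c d]. Qed.
Lemma Re_sum (I : Type) (s : seq I) (P : pred I) (F : I -> R[i]) :
  complex.Re (\sum_(i <- s | P i) F i) = \sum_(i <- s | P i) complex.Re (F i).
Proof. by elim/big_rec2: _ => [//|i y z _ <-]; rewrite Re_D. Qed.
Lemma Im_sum (I : Type) (s : seq I) (P : pred I) (F : I -> R[i]) :
  complex.Im (\sum_(i <- s | P i) F i) = \sum_(i <- s | P i) complex.Im (F i).
Proof. by elim/big_rec2: _ => [//|i y z _ <-]; rewrite Im_D. Qed.

Lemma complex_eqP z y :
  complex.Re z = complex.Re y -> complex.Im z = complex.Im y -> z = y.
Proof. by case: z y => [a b] [c d] /= -> ->. Qed.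

(* Multiplying by the conjugate turns a bound on real parts into a bound on
   the modulus. *)
Lemma normc_le_rot z r :
  complex.Re (z^*%C * z) <= normc z * r -> 0 <= r -> normc z <= r.
Proof.
move=> h r0; have [->|z0] := eqVneq z 0; first by rewrite normc0.
have n0 : 0 < normc z by rewrite normc_gt0.
rewrite -(ler_pM2l n0) -expr2 normc_sqr.
by case: z h {z0 n0} => a b /= h; lra.
Qed.

Lemma normc_conj z : normc z^*%C = normc z.
Proof. by case: z => a b /=; rewrite sqrrN. Qed.

End complex_modulus.

Section exponential.
Context (R : realType).
Implicit Types (x y z : R[i]) (a b r : R).

Lemma cexp0 : cexp (0 : R[i]) = 1.
Proof. by rewrite /cexp /= expR0 cos0 sin0 mul1r. Qed.

Lemma cexpD z y : cexp (z + y) = cexp z * cexp y.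
Proof.
case: z y => [a b] [c d]; rewrite /cexp /=.
by apply/eqP; rewrite eq_complex /= expRD cosD sinD; apply/andP; split; apply/eqP; ring.
Qed.

Lemma normc_cexp z : normc (cexp z) = expR (complex.Re z).
Proof.
rewrite /cexp normcM normcR ger0_norm ?expR_ge0//.
by rewrite /= cos2Dsin2 sqrtr1 mulr1.
Qed.

Lemma cexp_neq0 z : cexp z != 0.
Proof. by rewrite -normc_eq0 normc_cexp gt_eqF ?expR_gt0. Qed.

Lemma cexpN z : cexp (- z) = (cexp z)^-1.
Proof.
apply: (mulIf (cexp_neq0 z)); rewrite -cexpD addNr cexp0 mulVf//.
exact: cexp_neq0.
Qed.

Lemma normc_cexp_le z : normc (cexp z) <= expR (normc z).
Proof.
by rewrite normc_cexp ler_expR; apply: (le_trans (ler_norm _)); exact: Re_le_normc.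
Qed.

Lemma expR_sub1_le a : `|expR a - 1| <= `|a| * expR `|a|.
Proof.
have [a0|a0] := leP 0 a.
  rewrite ger0_norm ?subr_ge0 -?expR0 ?ler_expR// expR0.
  have := @expR_ge1Dx R (- a); rewrite expRN => h.
  have e0 := expR_gt0 a.
  have : (1 - a) * expR a <= 1 by rewrite -ler_pdivlMr// mul1r.
  by rewrite ger0_norm//; lra.
rewrite ltr0_norm ?subr_lt0 -?expR0 ?ltr_expR// expR0 opprB ltr0_norm//.
have := @expR_ge1Dx R a; have : 1 <= expR (- a).
  by rewrite -expR0 ler_expR; lra.
move=> h1 h2.
have : - a * 1 <= - a * expR (- a) by apply: ler_wpM2l => //; lra.
lra.
Qed.

Lemma expR_rem2_le a : `|expR a - 1 - a| <= a ^+ 2 * expR `|a|.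
Proof.
have h0 : 0 <= expR a - 1 - a by have := @expR_ge1Dx R a; lra.
rewrite ger0_norm//.
have := @expR_ge1Dx R (- a); rewrite expRN => h.
have e0 := expR_gt0 a.
have h1 : (1 - a) * expR a <= 1 by rewrite -ler_pdivlMr// mul1r.
have [a0|a0] := leP 0 a.
  rewrite ger0_norm//.
  have h2 : a * ((1 - a) * expR a) <= a * 1 by apply: ler_wpM2l.
  rewrite expr2; nra.
rewrite ltr0_norm//.
have h3 : 1 <= expR (- a) by rewrite -expR0 ler_expR; lra.
have h4 : expR a <= 1 by rewrite -expR0 ler_expR; lra.
have h5 : expR a - 1 - a <= a ^+ 2.
  rewrite expr2; nra.
have : a ^+ 2 * 1 <= a ^+ 2 * expR (- a) by apply: ler_wpM2l => //; exact: sqr_ge0.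
lra.
Qed.

Lemma normr_sin_le b : `|sin b| <= `|b|.
Proof.
wlog b0 : b / 0 <= b.
  move=> h; have [/h//|b0] := leP 0 b.
  by rewrite -normrN -sinN -(normrN b); apply: h; lra.
have [c _] := @MVT_segment R (@sin R) (@cos R) 0 b b0
  (fun u _ => is_derive_sin u) (continuous_subspaceT (@continuous_sin R)).
rewrite sin0 !subr0 => ->; rewrite normrM ler_piMl//; exact: cos_max.
Qed.

Lemma cos_sub1_le b : `|cos b - 1| <= b ^+ 2.
Proof.
have := @cosD R (b / 2) (b / 2); rewrite -splitr => ->.
have := cos2Dsin2 (b / 2) => h.
have -> : cos (b / 2) * cos (b / 2) - sin (b / 2) * sin (b / 2) - 1
   = - (2 * sin (b / 2) ^+ 2) by nra.
rewrite normrN ger0_norm; last by apply: mulr_ge0 => //; exact: sqr_ge0.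
have h2 : `|sin (b / 2)| ^+ 2 <= `|b / 2| ^+ 2.
  by rewrite lerXn2r ?nnegrE// normr_sin_le.
rewrite !real_normK ?num_real// in h2.
have e1 : (b / 2) ^+ 2 = b ^+ 2 / 4 by field.
rewrite e1 in h2; have := sqr_ge0 b; lra.
Qed.

Lemma sin_rem2_le b : `|sin b - b| <= 2 * b ^+ 2.
Proof.
wlog b0 : b / 0 <= b.
  move=> h; have [/h//|b0] := leP 0 b.
  have /h : 0 <= - b by lra.
  by rewrite sinN sqrrN -opprD normrN.
have dD (u : R) : is_derive u 1 (fun u => sin u - u) (cos u - 1).
  by apply: is_deriveB; exact: is_derive_id.
have [|c] := @MVT_segment R (fun u => sin u - u) (fun u => cos u - 1) 0 b b0
  (fun u _ => dD u).
  apply: continuous_subspaceT => u.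
  by apply: cvgB; [exact: continuous_sin|exact: cvg_id].
rewrite in_itv/= => /andP[c0 cb]; rewrite sin0 !subr0 => ->.
rewrite normrM (ger0_norm b0).
(* For [b <= 1] the quadratic bound at [c] gives this, for larger [b] the trivial bound 2 does. *)
suff : `|cos c - 1| <= 2 * b by move=> h; rewrite expr2; nra.
have h1 := cos_sub1_le c.
have h2 : `|cos c - 1| <= 2.
  apply: (le_trans (ler_normB _ _)); rewrite normr1; have := cos_max c; lra.
have [b1|b1] := leP b 1; last lra.
by rewrite expr2 in h1; nra.
Qed.

(** The four real remainders [expR a - 1 - a], [expR a * (cos b - 1)], [(expR a - 1) * sin b] and
    [sin b - b] are each of second order. The estimate is global, with an exponential factor, so
    that it applies later to increments of any size. *)
Lemma cexp_rem2_le z :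
  normc (cexp z - 1 - z) <= 4 * normc z ^+ 2 * expR (normc z).
Proof.
case: (z) => a b.
have -> : cexp (a +i* b) - 1 - (a +i* b) =
   (expR a - 1 - a)%:C + (expR a * (cos b - 1))%:C
   + ((0 +i* ((expR a - 1) * sin b)) + (0 +i* (sin b - b))).
  by rewrite /cexp /=; apply/eqP; rewrite eq_complex /=; apply/andP; split; apply/eqP; ring.
apply: (le_trans (normcD _ _)).
apply: (le_trans (lerD (normcD _ _) (normcD _ _))).
rewrite !normcR !normc_i !normrM normc_sqr /=.
have := expR_rem2_le a; have := expR_sub1_le a; have := cos_sub1_le b.
have := sin_rem2_le b; have := normr_sin_le b.
have ha : `|a| <= normc (a +i* b) := Re_le_normc (a +i* b).
have hb : `|b| <= normc (a +i* b) := Im_le_normc (a +i* b).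
set n := Num.sqrt _ in ha hb *; rewrite -[normc _]/n in ha hb *.
have e1 : expR `|a| <= expR n by rewrite ler_expR.
have e2 : `|expR a| <= expR n.
  by rewrite ger0_norm ?expR_ge0// ler_expR (le_trans (ler_norm a)).
have e3 : 1 <= expR n by rewrite -expR0 ler_expR (le_trans _ ha).
have na : `|a| ^+ 2 = a ^+ 2 by rewrite real_normK ?num_real.
have nb : `|b| ^+ 2 = b ^+ 2 by rewrite real_normK ?num_real.
rewrite -na -nb.
have := normr_ge0 a; have := normr_ge0 b.
move: (`|a|) (`|b|) (expR `|a|) (expR n) e1 e2 e3 => u v E1 E e1 e2 e3 v0 u0 h1 h2 h3 h4 h5.
have t1 : `|expR a - 1 - a| <= u ^+ 2 * E.
  by apply: (le_trans h5); apply: ler_wpM2l => //; exact: sqr_ge0.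
have t2 : `|expR a| * `|cos b - 1| <= E * v ^+ 2 by apply: ler_pM.
have t3 : `|expR a - 1| * `|sin b| <= (u * E) * v.
  apply: ler_pM => //; apply: (le_trans h4); exact: ler_wpM2l.
have t4 : `|sin b - b| <= 2 * v ^+ 2 * E.
  apply: (le_trans h2); rewrite ler_peMr//; apply: mulr_ge0 => //; exact: sqr_ge0.
apply: (le_trans (lerD (lerD t1 t2) (lerD t3 t4))).
have E0 : 0 <= E by lra.
rewrite -subr_ge0.
have -> : 4 * (u ^+ 2 + v ^+ 2) * E - (u ^+ 2 * E + E * v ^+ 2 + (u * E * v + 2 * v ^+ 2 * E))
  = E * (u ^+ 2 * 2 + (u ^+ 2 - u * v + v ^+ 2)) by ring.
apply: mulr_ge0 => //; nra.
Qed.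

Lemma le_mul_expR r : r <= expR r.
Proof. have := @expR_ge1Dx R r; lra. Qed.

Lemma le1_expR r : 0 <= r -> 1 <= expR r.
Proof. by move=> r0; rewrite -(expR0 R) ler_expR. Qed.

Lemma cexp_sub1_le z : normc (cexp z - 1) <= 5 * normc z * expR (2 * normc z).
Proof.
have -> : cexp z - 1 = (cexp z - 1 - z) + z by ring.
apply: (le_trans (normcD _ _)).
apply: (le_trans (lerD (cexp_rem2_le z) (lexx _))).
have n0 := normc_ge0 z.
have := le_mul_expR (normc z); have -> : 2 * normc z = normc z + normc z by ring.
rewrite expRD => h.
have e1 : 1 <= expR (normc z) by rewrite -expR0 ler_expR.
move: (normc z) (expR _) n0 h e1 => n E n0 h e1; rewrite expr2.
have : n * (n * E) <= n * (E * E) by apply: ler_wpM2l => //; apply: ler_wpM2r => //; lra.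
have : n * 1 <= n * (E * E) by apply: ler_wpM2l => //; nra.
lra.
Qed.

Lemma character0 z : character (0 : R) z = 1.
Proof. by rewrite /character mulr0 -[0 +i* 0]/(0 : R[i]) mul0r cexp0. Qed.

Lemma characterD a b z : character (a + b) z = character a z * character b z.
Proof.
rewrite /character; have -> : 0 +i* (2 * pi * (a + b)) =
    (0 +i* (2 * pi * a)) + (0 +i* (2 * pi * b)) :> R[i].
  by apply: complex_eqP; rewrite /= ?addr0// mulrDr.
by rewrite mulrDl cexpD.
Qed.

Lemma character_Dr a z y : character a (z + y) = character a z * character a y.
Proof. by rewrite /character mulrDr cexpD. Qed.

Lemma characterN a z : character (- a) z = (character a z)^-1.
Proof.
rewrite /character; have -> : 0 +i* (2 * pi * (- a)) =
    - (0 +i* (2 * pi * a)) :> R[i].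
  by apply: complex_eqP; rewrite /= ?oppr0// mulrN.
by rewrite mulNr cexpN.
Qed.

Lemma normc_character a z :
  normc (character a z) = expR (- (2 * pi * a * complex.Im z)).
Proof. by rewrite normc_cexp Re_M /= mul0r sub0r. Qed.

Lemma character_neq0 a z : character a z != 0.
Proof. exact: cexp_neq0. Qed.

End exponential.

Section complex_derivable.
Context (R : realType).

(** Radii of balls in [R[i]] have type [R[i]], where positive means real and positive; this lemma
    and the next exchange them for radii in [R]. *)
Lemma near_normc (a : R[i]) (r : R) (P : R[i] -> Prop) : 0 < r ->
  (forall z, normc (z - a) < r -> P z) -> \forall z \near a, P z.
Proof.
move=> r0 h.
have : \forall z \near a, `|a - z| < r%:C.
  by apply: nbhsx_ballx; rewrite ltcR.
by apply: filterS => z; rewrite normcE ltcR normcBC; exact: h.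
Qed.

Lemma nearP_normc (a : R[i]) (P : R[i] -> Prop) :
  (\forall z \near a, P z) -> exists2 r : R, 0 < r & forall z, normc (z - a) < r -> P z.
Proof.
move=> /nbhs_ballP[e /= e0 h].
have er : e = (complex.Re e)%:C.
  by move: e0; case: (e) => u v; rewrite ltcE /= => /andP[/eqP -> _].
exists (complex.Re e); first by move: e0; rewrite {1}er ltcR.
by move=> z hz; apply: h; rewrite /ball /= normcE er ltcR normcBC.
Qed.

Lemma derivable_of_rem2 (f : R[i] -> R[i]) (a l : R[i]) (r K : R) : 0 < r ->
  (forall z, normc (z - a) < r ->
     normc (f z - f a - l * (z - a)) <= K * normc (z - a) ^+ 2) ->
  derivable f a 1.
Proof.
move=> r0 h; rewrite /derivable; apply/cvg_ex; exists l.
apply/cvgrPdist_lt => e e0.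
have er : e = (complex.Re e)%:C.
  by move: e0; case: (e) => u v; rewrite ltcE /= => /andP[/eqP -> _].
have {}e0 : 0 < complex.Re e by move: e0; rewrite {1}er ltcR.
rewrite er; move: (complex.Re e) e0 => {er}e0 e0p.
have K1 : 0 < `|K| + 1 by have := normr_ge0 K; lra.
(* The difference quotient is off by at most [K * normc t]; the absolute value and the summand 1
   keep the denominator positive whatever the sign of [K]. *)
apply/nbhs_ballP; exists (Num.min r (e0 / (`|K| + 1)))%:C => /=.
  by rewrite ltcR lt_min r0 divr_gt0.
move=> t; rewrite /ball /= sub0r normrN normcE ltcR => ht tn0.
rewrite normcE ltcR.
rewrite [t%:A]mulr1 /shift.
have [tr te] : normc t < r /\ normc t < e0 / (`|K| + 1).
  by move: ht; rewrite lt_min => /andP.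
have := h (t + a); rewrite addrK => /(_ tr) h2.
have t0 : 0 < normc t by rewrite normc_gt0.
have -> : l - t^-1 *: (f (t + a) - f a) = - (t^-1 * (f (t + a) - f a - l * t)).
  by rewrite -[_ *: _]/(_ * _); field.
rewrite normcN normcM normcV mulrC ltr_pdivrMr//.
apply: (le_lt_trans h2).
rewrite expr2 mulrA ltr_pM2r//.
apply: (@le_lt_trans _ _ ((`|K| + 1) * normc t)).
  by apply: ler_wpM2r; [exact: ltW|have := ler_norm K; lra].
by rewrite mulrC -ltr_pdivlMr.
Qed.

(* Cutting the segment into n pieces makes the total variation at most K/n. *)
Lemma rem2_const (g : R -> R[i]) (d K : R) : 0 < d ->
  (forall s t, 0 <= s <= 1 -> 0 <= t <= 1 -> `|s - t| <= d ->
     normc (g s - g t) <= K * (s - t) ^+ 2) ->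
  g 1 = g 0.
Proof.
move=> d0 h.
(* The sign of [K] is not assumed: one instance with two distinct points forces it. *)
have K0 : 0 <= K.
  have := h (Num.min d 1) 0; rewrite subr0 lexx ler01 ge_min lexx orbT le_min.
  rewrite ltW//= ler01/= ger0_norm ?le_min ?(ltW d0) ?ler01//.
  rewrite ge_min lexx => /(_ isT isT isT) h1.
  have : 0 <= K * Num.min d 1 ^+ 2 := le_trans (normc_ge0 _) h1.
  by rewrite pmulr_lge0// exprn_gt0// lt_min d0 ltr01.
have bnd n : (n.+1%:R)^-1 <= d -> normc (g 1 - g 0) <= K / n.+1%:R.
  move=> nd; pose t (k : nat) : R := k%:R / n.+1%:R.
  have n0 : 0 < n.+1%:R :> R by rewrite ltr0n.
  have -> : g 1 - g 0 = \sum_(0 <= k < n.+1) (g (t k.+1) - g (t k)).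
    rewrite (telescope_sumr (fun k => g (t k)))//.
    by rewrite /t mul0r divff// gt_eqF.
  apply: (le_trans (normc_sum _ _ _)).
  apply: (@le_trans _ _ (\sum_(0 <= k < n.+1) K * (n.+1%:R^-1) ^+ 2)).
    rewrite big_nat_cond [leRHS]big_nat_cond; apply: ler_sum => k.
    rewrite andbT => /andP[_ kn].
    have tk : t k.+1 - t k = n.+1%:R^-1.
      by rewrite /t -mulrBl -natrB// subSnn mul1r.
    rewrite -tk; apply: h; rewrite ?tk.
    - by rewrite /t divr_ge0//= ler_pdivrMr// mul1r ler_nat.
    - by rewrite /t divr_ge0//= ler_pdivrMr// mul1r ler_nat ltnW.
    - by rewrite ger0_norm// invr_ge0 ltW.
  rewrite sumr_const_nat subn0 -[leLHS]mulr_natr -mulrA ler_wpM2l//.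
  by rewrite expr2 -mulrA mulVf ?mulr1// gt_eqF.
apply/eqP; rewrite -subr_eq0 -normc_eq0 eq_le normc_ge0 andbT.
rewrite leNgt; apply/negP => p0.
(* So many pieces that the mesh is at most [d] and [K / n] falls below the supposed positive
   distance. *)
have [n hn] : exists n : nat, K / normc (g 1 - g 0) + d^-1 < n%:R.
  by exists (Num.truncn (K / normc (g 1 - g 0) + d^-1)).+1; exact: truncnS_gt.
have n0 : 0 < n%:R :> R.
  by apply: le_lt_trans hn; rewrite addr_ge0 ?divr_ge0 ?normc_ge0 ?invr_ge0 ?(ltW d0).
case: n n0 hn => [|n] n0 hn; first by rewrite ltxx in n0.
have Kd : 0 <= K / normc (g 1 - g 0) by rewrite divr_ge0 ?normc_ge0.
have di : 0 < d^-1 by rewrite invr_gt0.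
have nd : n.+1%:R^-1 <= d.
  by rewrite -(invrK d) lef_pV2 ?posrE ?invr_gt0//; lra.
have := bnd n nd; rewrite leNgt => /negP; apply.
by rewrite ltr_pdivrMr// mulrC -ltr_pdivrMr//; lra.
Qed.

End complex_derivable.

(** * Complex integrals and absolutely convergent sums *)

Section complex_sequences.
Context (R : realType).
Implicit Types (u v : nat -> R[i]) (l k c : R[i]).

(** Convergence is stated through a real sequence, so that squeezing and limits of real sequences
    apply directly. *)
Definition ccvg u l := (fun n => normc (u n - l)) @ \oo --> (0 : R).

Lemma ccvg_squeeze u l (e : nat -> R) :
  (forall n, normc (u n - l) <= e n) -> e @ \oo --> (0 : R) -> ccvg u l.
Proof.
move=> ue e0; apply: (squeeze_cvgr _ (cvg_cst 0) e0).
by apply: nearW => n /=; rewrite normc_ge0 ue.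
Qed.

Lemma ccvg_near u v l : (\forall n \near \oo, u n = v n) -> ccvg u l -> ccvg v l.
Proof.
move=> uv; apply: cvg_trans; apply: near_eq_cvg.
by apply: filterS uv => n /= ->.
Qed.

Lemma eq_ccvg u v l : u =1 v -> ccvg u l -> ccvg v l.
Proof. by move=> uv; apply: ccvg_near; exact: nearW. Qed.

Lemma ccvg_cst l : ccvg (fun=> l) l.
Proof. by apply: (ccvg_squeeze (e := fun=> 0)) (cvg_cst _) => n; rewrite subrr normc0. Qed.

Lemma ccvgD u v l k : ccvg u l -> ccvg v k -> ccvg (fun n => u n + v n) (l + k).
Proof.
move=> ul vk; apply: ccvg_squeeze; last first.
  have := cvgD ul vk; rewrite addr0; exact.
by move=> n /=; rewrite opprD addrACA normcD.
Qed.

Lemma ccvgZ c u l : ccvg u l -> ccvg (fun n => c * u n) (c * l).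
Proof.
move=> ul; apply: (ccvg_squeeze (e := fun n => normc c * normc (u n - l))).
  by move=> n; rewrite -mulrBr normcM.
by rewrite -[X in _ --> X](mulr0 (normc c)); exact: cvgMr.
Qed.

Lemma ccvgN u l : ccvg u l -> ccvg (fun n => - u n) (- l).
Proof.
move=> ul; rewrite -mulN1r; apply: eq_ccvg (ccvgZ (-1) ul) => n.
by rewrite mulN1r.
Qed.

Lemma ccvgB u v l k : ccvg u l -> ccvg v k -> ccvg (fun n => u n - v n) (l - k).
Proof. by move=> ul vk; apply: ccvgD => //; exact: ccvgN. Qed.

Lemma ccvg_Re u l : ccvg u l -> (fun n => complex.Re (u n)) @ \oo --> complex.Re l.
Proof.
move=> ul; apply/subr_cvg0; apply: norm_cvg0.
apply: (squeeze_cvgr _ (cvg_cst 0) ul).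
by apply: nearW => n; rewrite /= normr_ge0/= -Re_B Re_le_normc.
Qed.

Lemma ccvg_Im u l : ccvg u l -> (fun n => complex.Im (u n)) @ \oo --> complex.Im l.
Proof.
move=> ul; apply/subr_cvg0; apply: norm_cvg0.
apply: (squeeze_cvgr _ (cvg_cst 0) ul).
by apply: nearW => n; rewrite /= normr_ge0/= -Im_B Im_le_normc.
Qed.

Lemma ccvg_ReIm u l : (fun n => complex.Re (u n)) @ \oo --> complex.Re l ->
  (fun n => complex.Im (u n)) @ \oo --> complex.Im l -> ccvg u l.
Proof.
move=> /subr_cvg0/cvg_norm h1 /subr_cvg0/cvg_norm h2.
rewrite normr0 in h1 h2.
apply: ccvg_squeeze; last by have := cvgD h1 h2; rewrite addr0; exact.
by move=> n; apply: (le_trans (normc_le_ReIm _)); rewrite Re_B Im_B.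
Qed.

Lemma ccvg_unique u l k : ccvg u l -> ccvg u k -> l = k.
Proof.
move=> ul uk; apply: complex_eqP.
  by apply: (cvg_unique _ (ccvg_Re ul) (ccvg_Re uk)).
by apply: (cvg_unique _ (ccvg_Im ul) (ccvg_Im uk)).
Qed.

Lemma ccvg_normc u l : ccvg u l -> (fun n => normc (u n)) @ \oo --> normc l.
Proof.
move=> ul; apply/subr_cvg0; apply: norm_cvg0.
apply: (squeeze_cvgr _ (cvg_cst 0) ul).
apply: nearW => n; rewrite /= normr_ge0/= ler_norml.
have := normc_lerB (u n) l; have := normc_lerB l (u n).
by rewrite normcBC; lra.
Qed.

Lemma ccvg_le u l (M : R) : ccvg u l -> (forall n, normc (u n) <= M) -> normc l <= M.
Proof.
move=> /ccvg_normc ul uM; rewrite -(cvg_lim _ ul)//.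
apply: limr_le; first by apply/cvg_ex; eexists; exact: ul.
exact: nearW.
Qed.

Lemma ccvgM u v l k : ccvg u l -> ccvg v k -> ccvg (fun n => u n * v n) (l * k).
Proof.
move=> ul vk.
apply: (ccvg_squeeze (e := fun n => normc (u n - l) * normc (v n) + normc l * normc (v n - k))).
  move=> n; rewrite -!normcM; apply: le_trans (normcD _ _).
  by rewrite le_eqVlt; apply/orP; left; apply/eqP; congr normc; ring.
rewrite -[X in _ --> X](addr0 0); apply: cvgD.
  by rewrite -[X in _ --> X](mul0r (normc k)); apply: cvgM => //; exact: ccvg_normc.
by rewrite -[X in _ --> X](mulr0 (normc l)); apply: cvgMr.
Qed.

Lemma ccvgP u l : ccvg u l <->
  (forall e : R, 0 < e -> exists N, forall n, (N <= n)%N -> normc (u n - l) < e).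
Proof.
split=> [/cvgr0Pnorm_lt h e /h[N _ hN]|h].
  exists N => n /hN /=; rewrite ger0_norm//; exact: normc_ge0.
apply/cvgr0Pnorm_lt => e /h[N hN]; exists N => // n /= /hN.
by rewrite ger0_norm// normc_ge0.
Qed.

End complex_sequences.

Section complex_integral.
Context d (T : measurableType d) (R : realType) (mu : {measure set T -> \bar R}).
Implicit Types (f : T -> R[i]) (g : T -> R).
Local Notation integrable g := (mu.-integrable setT (EFin \o g)).

Definition cintegrable f :=
  integrable (fun x => complex.Re (f x)) /\ integrable (fun x => complex.Im (f x)).

Definition cmeasurable f :=
  measurable_fun setT (fun x => complex.Re (f x)) /\
  measurable_fun setT (fun x => complex.Im (f x)).

Lemma le_Rintegrable g g' : measurable_fun setT g -> integrable g' ->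
  (forall x, `|g x| <= g' x) -> integrable g.
Proof.
move=> mg ig' h; apply: (le_integrable measurableT _ _ ig').
  exact/measurable_EFinP.
move=> x _ /=; rewrite lee_fin; apply: (le_trans (h x)).
exact: ler_norm.
Qed.

Lemma cintegrable_dom f g : cmeasurable f -> integrable g ->
  (forall x, normc (f x) <= g x) -> cintegrable f.
Proof.
move=> [mr mi] ig fg; split; apply: le_Rintegrable ig _ => // x.
  exact: le_trans (Re_le_normc _) (fg x).
exact: le_trans (Im_le_normc _) (fg x).
Qed.

Lemma cintegrable_measurable f : cintegrable f -> cmeasurable f.
Proof.
by move=> [/integrableP[/measurable_EFinP ? _] /integrableP[/measurable_EFinP ? _]].
Qed.

Lemma eq_cintegral f f' : f =1 f' -> cintegral mu f = cintegral mu f'.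
Proof. by move=> /funext ->. Qed.

Lemma cintegrableD f f' : cintegrable f -> cintegrable f' ->
  cintegrable (fun x => f x + f' x).
Proof.
move=> [r i] [r' i']; split.
  have := integrableD measurableT r r'; apply: eq_integrable => // x _ /=.
  by rewrite Re_D.
have := integrableD measurableT i i'; apply: eq_integrable => // x _ /=.
by rewrite Im_D.
Qed.

Lemma cintegralD f f' : cintegrable f -> cintegrable f' ->
  cintegral mu (fun x => f x + f' x) = cintegral mu f + cintegral mu f'.
Proof.
move=> [r i] [r' i']; apply: complex_eqP; rewrite /= -RintegralD//.
  by apply: eq_Rintegral => x _; rewrite Re_D.
by apply: eq_Rintegral => x _; rewrite Im_D.
Qed.

Lemma Rintegrable_lin (a b : R) g g' : integrable g -> integrable g' ->
  integrable (fun x => a * g x + b * g' x).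
Proof.
move=> ig ig'; have := integrableD measurableT (integrableZl measurableT a ig)
  (integrableZl measurableT b ig').
by apply: eq_integrable.
Qed.

Lemma Rintegral_lin (a b : R) g g' : integrable g -> integrable g' ->
  \int[mu]_x (a * g x + b * g' x) = a * \int[mu]_x g x + b * \int[mu]_x g' x.
Proof.
move=> ig ig'; rewrite RintegralD//; last 2 first.
  by apply: eq_integrable (integrableZl measurableT a ig).
  by apply: eq_integrable (integrableZl measurableT b ig').
by rewrite !RintegralZl.
Qed.

Lemma cintegrableZ (c : R[i]) f : cintegrable f -> cintegrable (fun x => c * f x).
Proof.
move=> [r i]; split.
  have := Rintegrable_lin (complex.Re c) (- complex.Im c) r i.
  by apply: eq_integrable => // x _ /=; rewrite Re_M mulNr.
have := Rintegrable_lin (complex.Re c) (complex.Im c) i r.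
by apply: eq_integrable => // x _ /=; rewrite Im_M.
Qed.

Lemma cintegralZ (c : R[i]) f : cintegrable f ->
  cintegral mu (fun x => c * f x) = c * cintegral mu f.
Proof.
move=> [r i]; apply: complex_eqP.
  rewrite Re_M /= -mulNr -Rintegral_lin//.
  by apply: eq_Rintegral => x _; rewrite Re_M mulNr.
rewrite Im_M /= -Rintegral_lin//.
by apply: eq_Rintegral => x _; rewrite Im_M.
Qed.

Lemma cintegrableB f f' : cintegrable f -> cintegrable f' ->
  cintegrable (fun x => f x - f' x).
Proof.
move=> h h'; have := cintegrableD h (cintegrableZ (-1) h').
by under eq_fun do rewrite mulN1r.
Qed.

Lemma cintegralB f f' : cintegrable f -> cintegrable f' ->
  cintegral mu (fun x => f x - f' x) = cintegral mu f - cintegral mu f'.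
Proof.
move=> h h'; have := cintegralD h (cintegrableZ (-1) h').
by rewrite cintegralZ// mulN1r => <-; apply: eq_cintegral => x; rewrite mulN1r.
Qed.

Lemma cintegrable0 : cintegrable (fun=> 0).
Proof.
by split => /=; have := @integrable0 _ _ _ mu setT;
  apply: eq_integrable.
Qed.

Lemma cintegrable_sum (I : Type) (s : seq I) (F : I -> T -> R[i]) :
  (forall i, cintegrable (F i)) -> cintegrable (fun x => \sum_(i <- s) F i x).
Proof.
move=> h; elim: s => [|i s IH].
  by under eq_fun do rewrite big_nil; exact: cintegrable0.
by under eq_fun do rewrite big_cons; exact: cintegrableD.
Qed.

Lemma cintegral_sum (I : Type) (s : seq I) (F : I -> T -> R[i]) :
  (forall i, cintegrable (F i)) ->
  cintegral mu (fun x => \sum_(i <- s) F i x) = \sum_(i <- s) cintegral mu (F i).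
Proof.
move=> h; elim: s => [|i s IH].
  under eq_fun do rewrite big_nil.
  by rewrite big_nil; apply: complex_eqP;
    rewrite /= /Rintegral integral0.
rewrite big_cons -IH -cintegralD//; last exact: cintegrable_sum.
by apply: eq_cintegral => x; rewrite big_cons.
Qed.

(** After multiplication by the conjugate of the integral ([normc_le_rot]) only real parts have to
    be compared; treating the two parts separately would cost a constant factor. *)
Lemma normc_cintegral_le f g : cintegrable f -> integrable g ->
  (forall x, normc (f x) <= g x) -> normc (cintegral mu f) <= \int[mu]_x g x.
Proof.
move=> cf ig fg; apply: normc_le_rot; last first.
  by apply: Rintegral_ge0 => x _; apply: le_trans (normc_ge0 _) (fg x).
rewrite -cintegralZ//.
have := normc_conj (cintegral mu f).
move: (_^*%C) (normc (cintegral mu f)) => c N cN.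
rewrite /= -RintegralZl//; apply: le_Rintegral => //.
- by have [] := cintegrableZ c cf.
- by apply: eq_integrable (integrableZl measurableT _ ig).
- move=> x _; apply: (le_trans (ler_norm _)).
  apply: (le_trans (Re_le_normc _)); rewrite normcM cN.
  by apply: ler_wpM2l => //; rewrite -cN normc_ge0.
Qed.

Lemma Rdominated_cvg (h : nat -> T -> R) (k g : T -> R) :
  (forall n, measurable_fun setT (h n)) -> measurable_fun setT k -> integrable g ->
  (forall n x, `|h n x| <= g x) -> (forall x, h ^~ x @ \oo --> k x) ->
  (fun n => \int[mu]_x h n x) @ \oo --> \int[mu]_x k x.
Proof.
move=> mh mk ig hg hk.
have [|||||ik _ cv] := @dominated_convergence _ _ _ mu setT measurableT
  (fun n => EFin \o h n) (EFin \o k) (EFin \o g).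
- by move=> n; exact/measurable_EFinP.
- exact/measurable_EFinP.
- by apply: aeW => x _; apply: cvg_EFin; [exact: nearW|exact: hk].
- exact: ig.
- by apply: aeW => x n _; rewrite lee_fin; exact: hg.
apply: fine_cvg; rewrite fineK; first exact: cv.
exact: integrable_fin_num ik.
Qed.

Lemma cdominated_cvg (h : nat -> T -> R[i]) (k : T -> R[i]) (g : T -> R) :
  (forall n, cmeasurable (h n)) -> cmeasurable k -> integrable g ->
  (forall n x, normc (h n x) <= g x) -> (forall x, ccvg (h ^~ x) (k x)) ->
  ccvg (fun n => cintegral mu (h n)) (cintegral mu k).
Proof.
move=> mh [mk mk'] ig hg hk; apply: ccvg_ReIm => /=.
  apply: (Rdominated_cvg _ mk ig) => [n|n x|x]; first by have [] := mh n.
    exact: le_trans (Re_le_normc _) (hg n x).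
  exact: ccvg_Re.
apply: (Rdominated_cvg _ mk' ig) => [n|n x|x]; first by have [] := mh n.
  exact: le_trans (Im_le_normc _) (hg n x).
exact: ccvg_Im.
Qed.

End complex_integral.

Section complex_sums.
Context (R : realType).
Implicit Types (f : nat -> R[i]) (g : nat -> R) (B : R).
Local Notation count := (@counting nat R).

(** Sums are integrals for the counting measure: linearity, domination and dominated convergence
    ([csum_tannery]) are instances of the previous section. The value is meaningful for [csummable]
    families. *)
Definition csum f : R[i] := cintegral count f.

Definition sum_le g B := forall N, \sum_(n < N) g n <= B.

Definition csummable f := exists B, sum_le (fun n => normc (f n)) B.

Lemma sum_le_nneseries g B : (forall n, 0 <= g n) -> sum_le g B ->
  (\sum_(k <oo) (g k)%:E <= B%:E)%E.
Proof.
move=> g0 gB; apply: lime_le.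
  by apply: is_cvg_nneseries => n _ _; rewrite lee_fin.
by apply: nearW => N; rewrite /= big_mkord sumEFin lee_fin.
Qed.

Lemma measurable_nat d (T : measurableType d) (h : nat -> T) : measurable_fun setT h.
Proof. by []. Qed.

Lemma sum_le_integrable g B : (forall n, 0 <= g n) -> sum_le g B ->
  count.-integrable setT (EFin \o g).
Proof.
move=> g0 gB; apply/integrableP; split; first exact: measurable_nat.
under eq_integral do rewrite /= ger0_norm//.
rewrite ge0_integral_count; last by move=> n; rewrite lee_fin.
by apply: le_lt_trans (sum_le_nneseries g0 gB) _; rewrite ltry.
Qed.

Lemma sum_le_Rintegral g B : (forall n, 0 <= g n) -> sum_le g B ->
  \int[count]_n g n <= B.
Proof.
move=> g0 gB; rewrite /Rintegral ge0_integral_count; last first.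
  by move=> n; rewrite lee_fin.
have h := sum_le_nneseries g0 gB.
have h0 : (0 <= \sum_(k <oo) (g k)%:E)%E.
  by apply: nneseries_ge0 => n _ _; rewrite lee_fin.
by rewrite -lee_fin fineK// ge0_fin_numE// (le_lt_trans h)// ltry.
Qed.

Lemma csummable_cintegrable f : csummable f -> cintegrable count f.
Proof.
move=> [B fB]; apply: (@cintegrable_dom _ _ _ _ _ (fun n => normc (f n))) => //.
apply: sum_le_integrable fB => n; exact: normc_ge0.
Qed.

Lemma sum_leW g g' B : (forall n, g n <= g' n) -> sum_le g' B -> sum_le g B.
Proof. by move=> h gB N; apply: le_trans (gB N); apply: ler_sum. Qed.

Lemma csummable_dom f g B : (forall n, normc (f n) <= g n) -> sum_le g B -> csummable f.
Proof. by move=> fg gB; exists B; exact: sum_leW gB. Qed.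

Lemma csummableD f f' : csummable f -> csummable f' -> csummable (fun n => f n + f' n).
Proof.
move=> [B h] [B' h']; exists (B + B') => N.
apply: le_trans (lerD (h N) (h' N)); rewrite -big_split /=.
by apply: ler_sum => i _; exact: normcD.
Qed.

Lemma csummableZ (c : R[i]) f : csummable f -> csummable (fun n => c * f n).
Proof.
move=> [B h]; exists (normc c * B) => N.
under eq_bigr do rewrite normcM.
by rewrite -mulr_sumr ler_wpM2l// normc_ge0.
Qed.

Lemma csummableN f : csummable f -> csummable (fun n => - f n).
Proof. by move=> /(csummableZ (-1)); under eq_fun do rewrite mulN1r. Qed.

Lemma csummableB f f' : csummable f -> csummable f' -> csummable (fun n => f n - f' n).
Proof. by move=> h h'; apply: csummableD => //; exact: csummableN. Qed.

Lemma eq_csum f f' : f =1 f' -> csum f = csum f'.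
Proof. by move=> /funext ->. Qed.

Lemma csumD f f' : csummable f -> csummable f' ->
  csum (fun n => f n + f' n) = csum f + csum f'.
Proof. by move=> h h'; apply: cintegralD; exact: csummable_cintegrable. Qed.

Lemma csumB f f' : csummable f -> csummable f' ->
  csum (fun n => f n - f' n) = csum f - csum f'.
Proof. by move=> h h'; apply: cintegralB; exact: csummable_cintegrable. Qed.

Lemma csumZ (c : R[i]) f : csummable f -> csum (fun n => c * f n) = c * csum f.
Proof. by move=> h; apply: cintegralZ; exact: csummable_cintegrable. Qed.

Lemma csumN f : csummable f -> csum (fun n => - f n) = - csum f.
Proof.
by move=> h; rewrite -mulN1r -csumZ//; apply: eq_csum => n; rewrite mulN1r.
Qed.

Lemma csum_big (I : Type) (s : seq I) (F : I -> nat -> R[i]) :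
  (forall i, csummable (F i)) ->
  csum (fun x => \sum_(i <- s) F i x) = \sum_(i <- s) csum (F i).
Proof. by move=> h; apply: cintegral_sum => i; exact: csummable_cintegrable. Qed.

Lemma csum_le f B : sum_le (fun n => normc (f n)) B -> normc (csum f) <= B.
Proof.
move=> fB; apply: le_trans (sum_le_Rintegral _ fB); last by move=> n; exact: normc_ge0.
apply: normc_cintegral_le => //; first by apply: csummable_cintegrable; exists B.
by apply: sum_le_integrable fB => n; exact: normc_ge0.
Qed.

Lemma csum_dom f g B : (forall n, normc (f n) <= g n) -> sum_le g B -> normc (csum f) <= B.
Proof. by move=> fg gB; apply: csum_le; exact: sum_leW gB. Qed.

Lemma csum_tannery (F : nat -> nat -> R[i]) f g B :
  (forall k n, normc (F k n) <= g n) -> sum_le g B ->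
  (forall n, ccvg (F ^~ n) (f n)) -> ccvg (fun k => csum (F k)) (csum f).
Proof.
move=> Fg gB Ff; apply: (@cdominated_cvg _ _ _ _ F f g) => //.
by apply: sum_le_integrable gB => n; apply: le_trans (Fg 0%N n); exact: normc_ge0.
Qed.

Lemma csummable_finite f N : (forall n, (N <= n)%N -> f n = 0) -> csummable f.
Proof.
move=> h; exists (\sum_(n < N) normc (f n)) => M.
rewrite -!(big_mkord xpredT (fun n => normc (f n))).
have [MN|NM] := leqP M N.
  by rewrite (big_cat_nat (leq0n M) MN) /= lerDl sumr_ge0// => i _; exact: normc_ge0.
rewrite (big_cat_nat (leq0n N) (ltnW NM)) /= big_nat_cond.
rewrite [X in _ + X]big1_seq ?addr0 -?big_nat_cond//.
by move=> i /andP[_]; rewrite mem_index_iota => /andP[/h -> _]; exact: normc0.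
Qed.

Lemma csum_delta m (c : R[i]) : csum (fun n => if n == m then c else 0) = c.
Proof.
have E (a : R) : \int[count]_n (if n == m then a else 0) = a.
  transitivity (\int[count]_n ((cst a) \_ [set m]) n).
    apply: eq_Rintegral => n _; rewrite patchE.
    by case: eqVneq => [->|/eqP nm]; [rewrite mem_set|rewrite memNset].
  have cm : counting [set m] = 1%E :> \bar R.
    by rewrite /counting asboolT ?fset_set1 ?cardfs1//; exact: finite_set1.
  by rewrite -Rintegral_mkcond Rintegral_cst//= [counting _]cm mulr1.
apply: complex_eqP => /=.
  by rewrite -[RHS]E; apply: eq_Rintegral => n _; case: ifP.
by rewrite -[RHS]E; apply: eq_Rintegral => n _; case: ifP.
Qed.

Lemma csum_finite f N : (forall n, (N <= n)%N -> f n = 0) ->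
  csum f = \sum_(n < N) f n.
Proof.
move=> h; transitivity (csum (fun n => \sum_(i < N) (if n == i then f i else 0))).
  apply: eq_csum => n; have [nN|Nn] := ltnP n N.
    rewrite (bigD1 (Ordinal nN))//= eqxx big1 ?addr0// => i.
    by case: (eqVneq n i) => // e /eqP; case; exact: val_inj.
  rewrite h// big1// => i _; case: eqVneq => // e.
  by move: (ltn_ord i); rewrite -e ltnNge Nn.
rewrite csum_big; last first.
  move=> i; apply: (@csummable_finite _ i.+1) => n.
  by case: eqVneq => // ->; rewrite ltnn.
by apply: eq_bigr => i _; exact: csum_delta.
Qed.

Lemma csum0 : csum (fun=> 0) = 0.
Proof. by rewrite (@csum_finite _ 0%N)// big_ord0. Qed.

Lemma csum_ccvg f : csummable f -> ccvg (fun N => \sum_(n < N) f n) (csum f).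
Proof.
move=> [B fB].
apply: (@eq_ccvg _ (fun N => csum (fun n => if (n < N)%N then f n else 0))).
  move=> N; rewrite (@csum_finite _ N).
    by apply: eq_bigr => i _; rewrite ltn_ord.
  by move=> n; rewrite ltnNge => ->.
apply: csum_tannery fB _ => [k n|n].
  by case: ifP => // _; rewrite normc0 normc_ge0.
apply: ccvg_near (ccvg_cst (f n)).
by exists n.+1 => // k /= ->.
Qed.

Lemma normc_csum_Re f : csummable f ->
  normc (csum f) <= complex.Re (csum (fun n => (normc (f n))%:C)).
Proof.
move=> sf; apply: normc_cintegral_le => //; first exact: csummable_cintegrable.
by have [B /sum_le_integrable] := sf; apply => n; exact: normc_ge0.
Qed.

Definition fiber (p : nat -> nat) f k : nat -> R[i] :=
  fun n => if p n == k then f n else 0.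

Lemma sum_le_fiber p f B k : sum_le (fun n => normc (f n)) B ->
  sum_le (fun n => normc (fiber p f k n)) B.
Proof.
by apply: sum_leW => n; rewrite /fiber; case: ifP => // _; rewrite normc0 normc_ge0.
Qed.

Lemma csum_fiber_lt p f K : csummable f ->
  csum (fun n => if (p n < K)%N then f n else 0) = \sum_(k < K) csum (fiber p f k).
Proof.
move=> [B fB]; rewrite -csum_big; last by move=> k; exists B; exact: sum_le_fiber.
apply: eq_csum => n; rewrite /fiber; have [nK|Kn] := ltnP (p n) K.
  rewrite (bigD1 (Ordinal nK))//= eqxx big1 ?addr0// => i.
  by case: (eqVneq (p n) i) => // e /eqP; case; exact: val_inj.
rewrite big1// => i _; case: eqVneq => // e.
by move: (ltn_ord i); rewrite -e ltnNge Kn.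
Qed.

Lemma sum_le_csum_fiber p f B : sum_le (fun n => normc (f n)) B ->
  sum_le (fun k => normc (csum (fiber p f k))) B.
Proof.
move=> fB K; pose g n := (normc (f n))%:C.
have gB : sum_le (fun n => normc (g n)) B.
  by apply: sum_leW fB => n; rewrite normcR ger0_norm ?normc_ge0.
apply: (@le_trans _ _ (\sum_(k < K) complex.Re (csum (fiber p g k)))).
  apply: ler_sum => k _; apply: le_trans (normc_csum_Re _) _.
    by exists B; exact: sum_le_fiber.
  rewrite le_eqVlt; apply/orP; left; apply/eqP; congr (complex.Re _).
  by apply: eq_csum => n; rewrite /fiber; case: ifP => // _; rewrite normc0.
rewrite -Re_sum -csum_fiber_lt; last by exists B.
apply: le_trans (ler_norm _) _; apply: le_trans (Re_le_normc _) _.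
by apply: csum_dom gB => n; case: ifP => // _; rewrite normc0 normc_ge0.
Qed.

(** Partial sums of the right-hand side collect the indices with [p n < K]; as [K] grows they tend
    to the whole sum by dominated convergence. *)
Lemma csum_fiber (p : nat -> nat) f : csummable f ->
  csum f = csum (fun k => csum (fiber p f k)).
Proof.
move=> [B fB].
have s2 : csummable (fun k => csum (fiber p f k)) by exists B; exact: sum_le_csum_fiber.
apply: ccvg_unique (csum_ccvg s2).
apply: (@eq_ccvg _ (fun K => csum (fun n => if (p n < K)%N then f n else 0))).
  by move=> K; rewrite csum_fiber_lt//; exists B.
apply: csum_tannery fB _ => [k n|n].
  by case: ifP => // _; rewrite normc0 normc_ge0.
apply: ccvg_near (ccvg_cst (f n)).
by exists (p n).+1 => // k /= ->.
Qed.

(** The packets of an injective [e] have at most one element, so [csum_fiber] becomes a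
    reindexing. *)
Lemma csum_inj (e : nat -> nat) (F : nat -> R[i]) : injective e ->
  (forall n, (forall m, e m != n) -> F n = 0) -> csummable (fun m => F (e m)) ->
  csum F = csum (fun m => F (e m)).
Proof.
move=> ei F0 sF; rewrite [RHS](csum_fiber e)//; apply: eq_csum => n.
have [[m /eqP <-]|h] := pselect (exists m, e m == n).
  rewrite -[LHS](@csum_delta m); apply: eq_csum => k; rewrite /fiber.
  rewrite (inj_eq ei); case: eqVneq => // -> //.
rewrite F0; last by move=> m; apply/negP => em; apply: h; exists m.
rewrite -[LHS]csum0; apply: eq_csum => k; rewrite /fiber; case: ifP => // ek.
by exfalso; apply: h; exists k.
Qed.

Definition pairing : nat * nat -> nat := fun p => CodeSeq.code [:: p.1; p.2].

(** [pairing] is not onto: codes of lists whose length is not 2 receive the value 0. *)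
Definition csum2 (F : nat -> nat -> R[i]) : nat -> R[i] :=
  fun n => if CodeSeq.decode n is [:: i; j] then F i j else 0.

Lemma pairingK F i j : csum2 F (pairing (i, j)) = F i j.
Proof. by rewrite /csum2 /pairing CodeSeq.codeK. Qed.

(** Decoding sends the pairs among the first [N] codes injectively into a finite square of indices,
    over which the sum is estimated row by row. *)
Lemma sum_le_csum2 F (b : nat -> R) B : sum_le b B ->
  (forall i, sum_le (fun j => normc (F i j)) (b i)) ->
  sum_le (fun n => normc (csum2 F n)) B.
Proof.
move=> bB FB N.
pose P (n : nat) : nat * nat :=
  if CodeSeq.decode n is [:: i; j] then (i, j) else (0%N, 0%N).
pose isP (n : nat) := if CodeSeq.decode n is [:: i; j] then true else false.
pose K := (\max_(n < N) maxn (P n).1 (P n).2).+1.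
have PK (n : 'I_N) : ((P n).1 < K)%N && ((P n).2 < K)%N.
  have h : (maxn (P n).1 (P n).2 <= \max_(n < N) maxn (P n).1 (P n).2)%N.
    exact: (@leq_bigmax _ (fun n : 'I_N => maxn (P n).1 (P n).2)).
  by move: h; rewrite geq_max !ltnS.
pose h (n : 'I_N) : 'I_K * 'I_K := (inord (P n).1, inord (P n).2).
apply: (@le_trans _ _ (\sum_(p : 'I_K * 'I_K) normc (F p.1 p.2))); last first.
  rewrite -(pair_bigA _ (fun i j : 'I_K => normc (F i j)))/=.
  by apply: le_trans (bB K); apply: ler_sum => i _; exact: FB.
rewrite (bigID (fun n : 'I_N => isP n))/= [X in _ + X]big1 ?addr0; last first.
  move=> n; rewrite /isP /csum2.
  by case: (CodeSeq.decode n) => [|i [|j [|? ?]]] // _; rewrite normc0.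
have hinj : {in [pred n : 'I_N | isP n] &, injective h}.
  move=> n m; rewrite !inE => Pn Pm [] /(congr1 val) /= e1 /(congr1 val) /= e2.
  move: e1 e2; have /andP[n1 n2] := PK n; have /andP[m1 m2] := PK m.
  rewrite !inordK// /P; move: Pn Pm; rewrite /isP => Pn Pm e1 e2.
  apply: val_inj => /=; rewrite -(CodeSeq.decodeK n) -(CodeSeq.decodeK m).
  case: (CodeSeq.decode n) Pn e1 e2 => [|i [|j [|? ?]]]//= _.
  by case: (CodeSeq.decode m) Pm => [|i' [|j' [|? ?]]]//= _ -> ->.
have -> : \sum_(n < N | isP n) normc (csum2 F n) =
    \sum_(p in [set h n | n in [pred n : 'I_N | isP n]]%SET) normc (F p.1 p.2).
  rewrite big_imset//=; apply: eq_bigr => n Pn.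
  have /andP[n1 n2] := PK n; rewrite /h /= !inordK//.
  move: Pn; rewrite /csum2 /P /isP.
  by case: (CodeSeq.decode n) => [|i [|j [|? ?]]].
rewrite [leRHS](bigID (mem [set h n | n in [pred n : 'I_N | isP n]]%SET))/= lerDl.
by apply: sumr_ge0 => p _; exact: normc_ge0.
Qed.

Lemma csum_csum2 F (b : nat -> R) B : sum_le b B ->
  (forall i, sum_le (fun j => normc (F i j)) (b i)) ->
  csum (csum2 F) = csum (fun i => csum (F i)).
Proof.
move=> bB FB; have s2 : csummable (csum2 F) by exists B; exact: sum_le_csum2 bB FB.
pose p n := if CodeSeq.decode n is [:: i; j] then i else 0%N.
rewrite (csum_fiber p)//; apply: eq_csum => i.
rewrite (@csum_inj (fun j => pairing (i, j))).
- apply: eq_csum => j; rewrite /fiber pairingK.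
  by rewrite /p /pairing CodeSeq.codeK eqxx.
- by move=> j j' /(can_inj CodeSeq.codeK) [].
- move=> n h; rewrite /fiber; case: eqVneq => // pn; rewrite /csum2.
  case E : (CodeSeq.decode n) => [|i' [|j' [|? ?]]]//.
  have := h j'; rewrite /pairing /= -(CodeSeq.decodeK n) E.
  by move: pn; rewrite /p E => ->; rewrite eqxx.
- exists (b i); apply: sum_leW (FB i) => j; rewrite /fiber pairingK.
  by rewrite /p /pairing CodeSeq.codeK eqxx.
Qed.

End complex_sums.

(** * Jets *)

Section jets.
Context (R : realType).
Implicit Types (D : set R[i]) (f g : R[i] -> R[i]) (M N : R) (z w : R[i]).

(* First-order Taylor control on D at scale at most 1; the sum of the three
   constants is a submultiplicative norm. *)
Definition jet D f f' M := exists M0 M1 M2 : R,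
  [/\ [/\ 0 <= M0, 0 <= M1, 0 <= M2 & M0 + M1 + M2 <= M],
      forall w, D w -> normc (f w) <= M0,
      forall w, D w -> normc (f' w) <= M1 &
      forall z w, D z -> D w -> normc (z - w) <= 1 ->
        normc (f z - f w) <= M1 * normc (z - w) /\
        normc (f z - f w - f' w * (z - w)) <= M2 * normc (z - w) ^+ 2].

Lemma jetW D f f' M N : M <= N -> jet D f f' M -> jet D f f' N.
Proof.
move=> MN [M0 [M1 [M2 [[? ? ? h] ? ? ?]]]]; exists M0, M1, M2; split => //.
by split => //; lra.
Qed.

Lemma jet_subset D D' f f' M : D' `<=` D -> jet D f f' M -> jet D' f f' M.
Proof.
move=> s [M0 [M1 [M2 [? h0 h1 h2]]]]; exists M0, M1, M2; split => //.
- by move=> w /s; exact: h0.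
- by move=> w /s; exact: h1.
- by move=> z w /s Dz /s; exact: h2.
Qed.

Lemma eq_jet D f f' g g' M : {in D, f =1 g} -> {in D, f' =1 g'} ->
  jet D f f' M -> jet D g g' M.
Proof.
move=> fg fg' [M0 [M1 [M2 [? h0 h1 h2]]]]; exists M0, M1, M2; split => //.
- by move=> w Dw; rewrite -(fg w (mem_set Dw)); exact: h0.
- by move=> w Dw; rewrite -(fg' w (mem_set Dw)); exact: h1.
- move=> z w Dz Dw; rewrite -(fg w (mem_set Dw)) -(fg z (mem_set Dz)).
  by rewrite -(fg' w (mem_set Dw)); exact: h2.
Qed.

Lemma jet_ge0 D f f' M : jet D f f' M -> 0 <= M.
Proof. by move=> [M0 [M1 [M2 [[? ? ? ?] _ _ _]]]]; lra. Qed.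

Lemma jet_bound D f f' M w : jet D f f' M -> D w -> normc (f w) <= M.
Proof.
move=> [M0 [M1 [M2 [[? ? ? h] h0 _ _]]]] Dw; apply: (le_trans (h0 _ Dw)); lra.
Qed.

Lemma jet_bound' D f f' M w : jet D f f' M -> D w -> normc (f' w) <= M.
Proof.
move=> [M0 [M1 [M2 [[? ? ? h] _ h0 _]]]] Dw; apply: (le_trans (h0 _ Dw)); lra.
Qed.

Lemma jet_lip D f f' M z w : jet D f f' M -> D z -> D w -> normc (z - w) <= 1 ->
  normc (f z - f w) <= M * normc (z - w).
Proof.
move=> [M0 [M1 [M2 [[? ? ? h] _ _ h0]]]] Dz Dw zw.
apply: (le_trans (h0 _ _ Dz Dw zw).1); apply: ler_wpM2r; first exact: normc_ge0.
lra.
Qed.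

Lemma jet_rem D f f' M z w : jet D f f' M -> D z -> D w -> normc (z - w) <= 1 ->
  normc (f z - f w - f' w * (z - w)) <= M * normc (z - w) ^+ 2.
Proof.
move=> [M0 [M1 [M2 [[? ? ? h] _ _ h0]]]] Dz Dw zw.
apply: (le_trans (h0 _ _ Dz Dw zw).2); apply: ler_wpM2r; first exact: sqr_ge0.
lra.
Qed.

Lemma jet_cst D c : jet D (fun=> c) (fun=> 0) (normc c).
Proof.
exists (normc c), 0, 0; split => //.
- by split=> //; rewrite ?normc_ge0// !addr0.
- by rewrite normc0.
- by move=> z w _ _ _; rewrite subrr !mul0r subr0 normc0.
Qed.

Lemma jetD D f f' g g' M N : jet D f f' M -> jet D g g' N ->
  jet D (fun z => f z + g z) (fun z => f' z + g' z) (M + N).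
Proof.
move=> [M0 [M1 [M2 [[? ? ? ?] h0 h1 h2]]]] [N0 [N1 [N2 [[? ? ? ?] k0 k1 k2]]]].
exists (M0 + N0), (M1 + N1), (M2 + N2); split.
- by split; lra.
- by move=> w Dw; apply: (le_trans (normcD _ _)); apply: lerD; [exact: h0|exact: k0].
- by move=> w Dw; apply: (le_trans (normcD _ _)); apply: lerD; [exact: h1|exact: k1].
- move=> z w Dz Dw zw; have [a1 a2] := h2 z w Dz Dw zw.
  have [b1 b2] := k2 z w Dz Dw zw; split; rewrite [leRHS]mulrDl.
    have -> : f z + g z - (f w + g w) = (f z - f w) + (g z - g w) by ring.
    by apply: (le_trans (normcD _ _)); exact: lerD.
  have -> : f z + g z - (f w + g w) - (f' w + g' w) * (z - w) =
    (f z - f w - f' w * (z - w)) + (g z - g w - g' w * (z - w)) by ring.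
  by apply: (le_trans (normcD _ _)); exact: lerD.
Qed.

(** The remainder of a product contains [f' w * (z - w) * (g z - g w)], whence the term [M1 * N1].
    The constants of the product use six of the nine terms of [(M0 + M1 + M2) * (N0 + N1 + N2)];
    this is why their sum is submultiplicative. *)
Lemma jetM D f f' g g' M N : jet D f f' M -> jet D g g' N ->
  jet D (fun z => f z * g z) (fun z => f' z * g z + f z * g' z) (M * N).
Proof.
move=> [M0 [M1 [M2 [[? ? ? hM] h0 h1 h2]]]] [N0 [N1 [N2 [[? ? ? hN] k0 k1 k2]]]].
exists (M0 * N0), (M1 * N0 + M0 * N1), (M2 * N0 + M0 * N2 + M1 * N1); split.
- split; rewrite ?addr_ge0 ?mulr_ge0//.
  apply: (@le_trans _ _ ((M0 + M1 + M2) * (N0 + N1 + N2))); last first.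
    by apply: ler_pM => //; rewrite !addr_ge0.
  rewrite -subr_ge0.
  have -> : (M0 + M1 + M2) * (N0 + N1 + N2) - (M0 * N0 + (M1 * N0 + M0 * N1) +
    (M2 * N0 + M0 * N2 + M1 * N1)) = M1 * N2 + M2 * N1 + M2 * N2 by ring.
  by rewrite !addr_ge0 ?mulr_ge0.
- move=> w Dw; rewrite normcM; apply: ler_pM (h0 w Dw) (k0 w Dw); exact: normc_ge0.
- move=> w Dw; apply: (le_trans (normcD _ _)); rewrite !normcM; apply: lerD.
    apply: ler_pM (h1 w Dw) (k0 w Dw); exact: normc_ge0.
  apply: ler_pM (h0 w Dw) (k1 w Dw); exact: normc_ge0.
- move=> z w Dz Dw zw; have [a1 a2] := h2 z w Dz Dw zw.
  have [b1 b2] := k2 z w Dz Dw zw.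
  have n0 := normc_ge0 (z - w).
  split.
    have -> : f z * g z - f w * g w = (f z - f w) * g z + f w * (g z - g w) by ring.
    apply: (le_trans (normcD _ _)); rewrite !normcM [leRHS]mulrDl; apply: lerD.
      rewrite mulrAC; apply: ler_pM a1 (k0 z Dz); exact: normc_ge0.
    rewrite -mulrA; apply: ler_pM (h0 w Dw) b1; exact: normc_ge0.
  have -> : f z * g z - f w * g w - (f' w * g w + f w * g' w) * (z - w) =
    (f z - f w - f' w * (z - w)) * g z + f w * (g z - g w - g' w * (z - w))
    + f' w * (z - w) * (g z - g w) by ring.
  apply: (le_trans (normcD _ _)); rewrite [leRHS]mulrDl; apply: lerD.
    apply: (le_trans (normcD _ _)); rewrite [leRHS]mulrDl; apply: lerD; rewrite normcM.
      rewrite mulrAC; apply: ler_pM a2 (k0 z Dz); exact: normc_ge0.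
    rewrite -mulrA; apply: ler_pM (h0 w Dw) b2; exact: normc_ge0.
  rewrite !normcM.
  have -> : M1 * N1 * normc (z - w) ^+ 2 =
     (M1 * normc (z - w)) * (N1 * normc (z - w)) by ring.
  apply: ler_pM b1; rewrite ?mulr_ge0 ?normc_ge0//.
  by apply: ler_wpM2r => //; exact: h1.
Qed.

Lemma jetZ D f f' M c : jet D f f' M ->
  jet D (fun z => c * f z) (fun z => c * f' z) (normc c * M).
Proof.
move=> h; have := jetM (jet_cst D c) h; apply: eq_jet => // z _.
by rewrite mul0r add0r.
Qed.

Lemma jetN D f f' M : jet D f f' M -> jet D (fun z => - f z) (fun z => - f' z) M.
Proof.
move=> /(jetZ (-1)); rewrite normcN normc1 mul1r.
by apply: eq_jet => z _; rewrite mulN1r.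
Qed.

Lemma sum_le_cst_ge0 (g : nat -> R) B : sum_le g B -> 0 <= B.
Proof. by move=> /(_ 0%N); rewrite big_ord0. Qed.

(** Constants are chosen term by term and the three families are summed separately, so that the
    norms add up to at most [B]. *)
Lemma jet_csum D (f f' : nat -> R[i] -> R[i]) (M : nat -> R) B :
  (forall n, jet D (f n) (f' n) (M n)) -> sum_le M B ->
  jet D (fun z => csum (f ^~ z)) (fun z => csum (f' ^~ z)) B.
Proof.
move=> /choice[M0 /choice[M1 /choice[M2 h]]] MB.
have p0 n : 0 <= M0 n by have [[]] := h n.
have p1 n : 0 <= M1 n by have [[]] := h n.
have p2 n : 0 <= M2 n by have [[]] := h n.
have ps n : M0 n + M1 n + M2 n <= M n by have [[]] := h n.
have l0 : sum_le M0 B.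
  by apply: sum_leW MB => n; have := p1 n; have := p2 n; have := ps n; lra.
have l1 : sum_le M1 B.
  by apply: sum_leW MB => n; have := p0 n; have := p2 n; have := ps n; lra.
have l2 : sum_le M2 B.
  by apply: sum_leW MB => n; have := p1 n; have := p0 n; have := ps n; lra.
have ls : sum_le (fun n => M0 n + M1 n + M2 n) B by exact: sum_leW MB.
have i0 := sum_le_integrable p0 l0; have i1 := sum_le_integrable p1 l1.
have i2 := sum_le_integrable p2 l2.
have s0 w : D w -> csummable (f ^~ w).
  by move=> Dw; apply: csummable_dom l0 => n; have [_ + _ _] := h n; exact.
have s1 w : D w -> csummable (f' ^~ w).
  by move=> Dw; apply: csummable_dom l1 => n; have [_ _ + _] := h n; exact.
pose I (g : nat -> R) := \int[@counting nat R]_n g n.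
have IZ (g : nat -> R) (c : R) : (@counting nat R).-integrable setT (EFin \o g) ->
  I (fun n => g n * c) = I g * c by move=> ig; rewrite /I RintegralZr.
exists (I M0), (I M1), (I M2); split.
- split; try by apply: Rintegral_ge0 => n _.
  rewrite /I -!RintegralD//; last first.
    by have := integrableD measurableT i0 i1; apply: eq_integrable.
  by apply: sum_le_Rintegral ls => n; rewrite !addr_ge0.
- move=> w Dw; apply: normc_cintegral_le => //; first exact/csummable_cintegrable/s0.
  by move=> n; have [_ + _ _] := h n; exact.
- move=> w Dw; apply: normc_cintegral_le => //; first exact/csummable_cintegrable/s1.
  by move=> n; have [_ _ + _] := h n; exact.
- move=> z w Dz Dw zw; split.
    rewrite -csumB; [|exact: s0|exact: s0]; rewrite -IZ//.
    apply: normc_cintegral_le.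
    + by apply/csummable_cintegrable/csummableB; exact: s0.
    + have := integrableZl measurableT (normc (z - w)) i1.
      by apply: eq_integrable => // n _; rewrite /= -EFinM mulrC.
    + by move=> n; have [_ _ _ /(_ z w Dz Dw zw)[]] := h n.
  have -> : csum (f ^~ z) - csum (f ^~ w) - csum (f' ^~ w) * (z - w) =
    csum (fun n => f n z - f n w - (z - w) * f' n w).
    rewrite csumB; [|apply: csummableB; exact: s0|apply: csummableZ; exact: s1].
    rewrite csumB; [|exact: s0|exact: s0].
    by rewrite csumZ; [rewrite mulrC|exact: s1].
  rewrite -IZ//; apply: normc_cintegral_le.
  + apply/csummable_cintegrable/csummableB; first by apply: csummableB; exact: s0.
    by apply: csummableZ; exact: s1.
  + have := integrableZl measurableT (normc (z - w) ^+ 2) i2.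
    by apply: eq_integrable => // n _; rewrite /= -EFinM mulrC.
  + by move=> n; rewrite mulrC; have [_ _ _ /(_ z w Dz Dw zw)[]] := h n.
Qed.

(** With [x = g z - g w] and [normc x <= M], everything reduces to the estimates of [cexp x - 1] and
    [cexp x - 1 - x]. The constant 11 is [1 + 5 + (1 + 4)], one summand for each order. *)
Lemma jet_cexp D g g' M (E : R) : jet D g g' M -> 0 <= E ->
  (forall w, D w -> normc (cexp (g w)) <= E) ->
  jet D (fun z => cexp (g z)) (fun z => g' z * cexp (g z)) (E * (11 * expR (4 * M))).
Proof.
move=> jg E0 hE; have M0 := jet_ge0 jg.
have eM : M <= expR M by exact: le_mul_expR.
have e1 : 1 <= expR M by rewrite -expR0 ler_expR.
have e4 : expR (4 * M) = expR M * expR M * (expR M * expR M).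
  by rewrite -!expRD; congr expR; ring.
exists E, (E * (5 * M * expR (2 * M))), (E * (M + 4 * M ^+ 2 * expR M)).
have e2 : expR (2 * M) = expR M * expR M by rewrite -!expRD; congr expR; ring.
have X0 : 0 <= expR M by exact: expR_ge0.
have XX : expR M <= expR M * expR M by rewrite ler_peMr.
have X1 : 1 <= expR M * expR M := le_trans e1 XX.
have m2 : M ^+ 2 * expR M <= expR M * expR M * (expR M * expR M).
  by rewrite expr2; apply: ler_pM => //; [exact: mulr_ge0|exact: ler_pM].
have m1 : M * expR (2 * M) <= expR M * expR M * (expR M * expR M).
  by rewrite e2; apply: ler_wpM2r; [exact: mulr_ge0|exact: le_trans XX].
have e22 : expR M * 1 <= expR M * expR M * (expR M * expR M).
  exact: ler_pM.
split.
- split; rewrite ?mulr_ge0 ?expR_ge0 ?addr_ge0 ?mulr_ge0 ?expR_ge0 ?sqr_ge0//.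
  rewrite -[X in X + _ + _]mulr1 -!mulrDr; apply: ler_wpM2l => //.
  rewrite e4 -!mulrA.
  move: m1 m2 e22; rewrite -!mulrA mulr1.
  move: (M * expR (2 * M)) (M * (M * expR M)) (expR M * (expR M * _)) => a b c.
  by move: (expR M) eM e1 => X *; lra.
- exact: hE.
- move=> w Dw; rewrite normcM mulrC; apply: ler_pM; rewrite ?normc_ge0 ?hE//.
  apply: (le_trans (jet_bound' jg Dw)).
  have h1 : M * 1 <= M * expR (2 * M).
    by apply: ler_wpM2l => //; apply: le1_expR; rewrite mulr_ge0.
  have h2 : 0 <= M * expR (2 * M) by rewrite mulr_ge0// expR_ge0.
  by rewrite -mulrA; lra.
- move=> z w Dz Dw zw.
  have lip := jet_lip jg Dz Dw zw; have rem := jet_rem jg Dz Dw zw.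
  have n0 := normc_ge0 (z - w).
  pose x := g z - g w; have gz : g z = g w + x by rewrite /x; ring.
  have xM : normc x <= M by apply: (le_trans lip); rewrite ler_piMr.
  split.
    rewrite gz cexpD.
    have -> : cexp (g w) * cexp x - cexp (g w) = cexp (g w) * (cexp x - 1) by ring.
    rewrite normcM -mulrA; apply: ler_pM; rewrite ?normc_ge0 ?hE//.
    apply: (le_trans (cexp_sub1_le x)).
    rewrite [leRHS]mulrAC; apply: ler_pM; rewrite ?expR_ge0 ?mulr_ge0 ?normc_ge0//.
      by rewrite -mulrA ler_pM2l.
    by rewrite ler_expR ler_pM2l.
  rewrite gz cexpD.
  have -> : cexp (g w) * cexp x - cexp (g w) - g' w * cexp (g w) * (z - w) =
    cexp (g w) * ((x - g' w * (z - w)) + (cexp x - 1 - x)) by ring.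
  rewrite normcM -mulrA; apply: ler_pM; rewrite ?normc_ge0 ?hE//.
  apply: (le_trans (normcD _ _)); rewrite mulrDl; apply: lerD => //.
  apply: (le_trans (cexp_rem2_le x)).
  have -> : 4 * M ^+ 2 * expR M * normc (z - w) ^+ 2 =
    4 * (M * normc (z - w)) ^+ 2 * expR M by ring.
  apply: ler_pM; last by rewrite ler_expR.
  - by apply: mulr_ge0 => //; exact: sqr_ge0.
  - exact: expR_ge0.
  - by rewrite ler_pM2l// lerXn2r ?nnegrE ?normc_ge0// mulr_ge0.
Qed.

Lemma jet_derivable D f f' M a (r : R) : jet D f f' M -> 0 < r ->
  (forall z, normc (z - a) < r -> D z) -> derivable f a 1.
Proof.
move=> jf r0 aD; have Da : D a by apply: aD; rewrite subrr normc0.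
apply: (@derivable_of_rem2 _ f a (f' a) (Num.min r 1) M).
  by rewrite lt_min r0 ltr01.
move=> z; rewrite lt_min => /andP[zr z1].
by apply: (jet_rem jf) => //; [exact: aD|exact: ltW].
Qed.

Lemma jet_id D B : (forall z, D z -> normc z <= B) -> 0 <= B ->
  jet D id (fun=> 1) (B + 1).
Proof.
move=> h B0; exists B, 1, 0; split => //.
- by split => //; rewrite addr0.
- by move=> w _; rewrite normc1.
- move=> z w _ _ _; rewrite mul1r lexx; split => //.
  by rewrite mul1r subrr normc0 mul0r.
Qed.

End jets.

(** * Canonical products *)

Section infinite_products.
Context (R : realType).
Implicit Types (e : nat -> R[i] -> R[i]) (s : nat -> R) (D : set R[i]).

Definition pprod e N z := \prod_(n < N) e n z.

(** Derivative of a partial product by the product rule rather than through logarithmic derivatives,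
    because the factors may vanish. *)
Fixpoint pder e (e' : nat -> R[i] -> R[i]) N z : R[i] :=
  if N is N'.+1 then pder e e' N' z * e N' z + pprod e N' z * e' N' z else 0.

(** Limit of the partial products in telescoped form, to which [jet_csum] applies. *)
Definition iprod e z := 1 + csum (fun n => pprod e n.+1 z - pprod e n z).

Definition iprod' e (e' : nat -> R[i] -> R[i]) z := csum (fun n => pder e e' n.+1 z - pder e e' n z).

Lemma pprodS e N z : pprod e N.+1 z = pprod e N z * e N z.
Proof. by rewrite /pprod big_ord_recr. Qed.

(** Explains the shape [expR (s n) - 1] of the bounds on the factors: increments of the partial
    products are then dominated by increments of the exponential of a partial sum, which
    telescope. *)
Lemma telescope_expR_le s S : (forall n, 0 <= s n) -> sum_le s S ->
  sum_le (fun n => expR (\sum_(k < n) s k) * (expR (s n) - 1)) (expR S - 1).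
Proof.
move=> s0 sS N.
have -> : \sum_(n < N) expR (\sum_(k < n) s k) * (expR (s n) - 1) =
   expR (\sum_(k < N) s k) - 1.
  elim: N => [|N IH]; first by rewrite !big_ord0 expR0 subrr.
  by rewrite big_ord_recr /= IH [in RHS]big_ord_recr /= expRD; ring.
by rewrite lerD2r ler_expR.
Qed.

Section convergence.
Context e (e' : nat -> R[i] -> R[i]) s (S : R) D.
Hypothesis s0 : forall n, 0 <= s n.
Hypothesis sS : sum_le s S.
Hypothesis je : forall n, jet D (fun z => e n z - 1) (e' n) (expR (s n) - 1).

Lemma jet_factor n : jet D (e n) (e' n) (expR (s n)).
Proof.
have := jetD (je n) (jet_cst D 1); rewrite normc1 subrK.
by apply: eq_jet => z _; rewrite ?subrK ?addr0.
Qed.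

Lemma jet_pprod N : jet D (pprod e N) (pder e e' N) (expR (\sum_(n < N) s n)).
Proof.
elim: N => [|N IH].
  rewrite big_ord0 expR0 -normc1; apply: eq_jet (jet_cst D 1) => // z _.
  by rewrite /pprod big_ord0.
rewrite big_ord_recr expRD; apply: eq_jet (jetM IH (jet_factor N)) => z _ //.
by rewrite pprodS.
Qed.

Lemma jet_pprod_diff n :
  jet D (fun z => pprod e n.+1 z - pprod e n z)
    (fun z => pder e e' n.+1 z - pder e e' n z)
    (expR (\sum_(k < n) s k) * (expR (s n) - 1)).
Proof.
apply: eq_jet (jetM (jet_pprod n) (je n)) => z _; rewrite ?pprodS /=; ring.
Qed.

Let diff_le := telescope_expR_le s0 sS.

Lemma jet_iprod : jet D (iprod e) (iprod' e e') (expR S).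
Proof.
have := jetD (jet_cst D 1) (jet_csum jet_pprod_diff diff_le).
by rewrite normc1 addrC subrK; apply: eq_jet => z _; rewrite ?add0r.
Qed.

Lemma csummable_pprod z : D z -> csummable (fun n => pprod e n.+1 z - pprod e n z).
Proof.
by move=> Dz; apply: csummable_dom diff_le => n; exact: jet_bound (jet_pprod_diff n) Dz.
Qed.

Lemma csummable_pder z : D z -> csummable (fun n => pder e e' n.+1 z - pder e e' n z).
Proof.
by move=> Dz; apply: csummable_dom diff_le => n; exact: jet_bound' (jet_pprod_diff n) Dz.
Qed.

Lemma iprod_cvg z : D z -> ccvg (fun N => pprod e N z) (iprod e z).
Proof.
move=> /csummable_pprod /csum_ccvg /(ccvgD (ccvg_cst 1)); apply: eq_ccvg => N.
elim: N => [|N IH]; first by rewrite /pprod !big_ord0 addr0.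
by rewrite big_ord_recr /= addrA IH; ring.
Qed.

Lemma iprod'_cvg z : D z -> ccvg (fun N => pder e e' N z) (iprod' e e' z).
Proof.
move=> /csummable_pder /csum_ccvg; apply: eq_ccvg => N.
elim: N => [|N IH]; first by rewrite big_ord0.
by rewrite big_ord_recr /= IH /=; ring.
Qed.

Lemma pder_logder N z : (forall n, e n z != 0) ->
  pder e e' N z = pprod e N z * \sum_(n < N) e' n z / e n z.
Proof.
move=> h; elim: N => [|N IH]; first by rewrite big_ord0 mulr0.
by rewrite /= IH pprodS big_ord_recr /=; field; exact: h.
Qed.

Lemma iprod'_logder z : D z -> (forall n, e n z != 0) ->
  csummable (fun n => e' n z / e n z) ->
  iprod' e e' z = iprod e z * csum (fun n => e' n z / e n z).
Proof.
move=> Dz h /csum_ccvg c; apply: ccvg_unique (iprod'_cvg Dz) _.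
apply: eq_ccvg (ccvgM (iprod_cvg Dz) c) => N.
by rewrite pder_logder.
Qed.

Lemma pprod_tail_le N M z : D z ->
  normc (pprod e (N + M) z - pprod e N z) <=
  normc (pprod e N z) * (expR (\sum_(N <= n < N + M) s n) - 1).
Proof.
move=> Dz; elim: M => [|M IH].
  by rewrite addn0 subrr normc0 big_geq// expR0 subrr mulr0.
rewrite addnS pprodS big_nat_recr ?leq_addr//= expRD.
have h : normc (pprod e (N + M) z) <= normc (pprod e N z) * expR (\sum_(N <= n < N + M) s n).
  have -> : pprod e (N + M) z = (pprod e (N + M) z - pprod e N z) + pprod e N z.
    by rewrite subrK.
  apply: (le_trans (normcD _ _)); apply: (le_trans (lerD IH (lexx _))).
  by rewrite mulrBr mulr1 subrK.
have -> : pprod e (N + M) z * e (N + M)%N z - pprod e N z =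
  (pprod e (N + M) z - pprod e N z) + pprod e (N + M) z * (e (N + M)%N z - 1) by ring.
apply: (le_trans (normcD _ _)); rewrite normcM.
have k : normc (e (N + M)%N z - 1) <= expR (s (N + M)%N) - 1 := jet_bound (je _) Dz.
have t := ler_pM (normc_ge0 _) (normc_ge0 _) h k.
apply: (le_trans (lerD IH t)); rewrite le_eqVlt; apply/orP; left; apply/eqP; ring.
Qed.

Lemma sum_le_tail (t : R) : 0 < t ->
  exists N, forall M, \sum_(N <= n < N + M) s n <= t.
Proof.
move=> t0; pose E := range (fun N => \sum_(n < N) s n).
have hE : has_sup E.
  split; first by exists (\sum_(n < 0) s n), 0%N.
  by exists S => _ [N _ <-].
have [_ [N _ <-] hN] := sup_adherent t0 hE.
exists N => M; have : \sum_(n < N + M) s n <= sup E.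
  by apply: ub_le_sup; [case: hE|exists (N + M)%N].
rewrite -[X in X <= _](big_mkord xpredT s) (big_cat_nat (leq0n N) (leq_addr M N)) /=.
rewrite big_mkord; lra.
Qed.

(** Once the tail of [s] beyond [N] is below [ln (3 / 2)], all later partial products differ from
    the [N]-th by at most half of its modulus, and so does the limit. *)
Lemma iprod_neq0 z : D z -> (forall n, e n z != 0) -> iprod e z != 0.
Proof.
move=> Dz h; have l2 : 0 < ln (3 / 2 : R) by rewrite ln_gt0//; lra.
have [N hN] := sum_le_tail l2.
have p0 n : 0 < normc (pprod e n z).
  by rewrite normc_gt0; apply/prodf_neq0 => i _; exact: h.
have lb M : normc (pprod e N z - pprod e (N + M) z) <= normc (pprod e N z) / 2.
  rewrite normcBC; apply: (le_trans (pprod_tail_le _ _ Dz)).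
  apply: ler_wpM2l; first exact: normc_ge0.
  have : expR (\sum_(N <= n < N + M) s n) <= 3 / 2.
    have <- : expR (ln (3 / 2)) = 3 / 2 :> R by rewrite lnK// posrE; lra.
    by rewrite ler_expR.
  lra.
have : normc (pprod e N z - iprod e z) <= normc (pprod e N z) / 2.
  apply: (ccvg_le (u := fun M => pprod e N z - pprod e (N + M) z)) lb.
  apply: ccvgB; first exact: ccvg_cst.
  apply/ccvgP => x /(proj1 (ccvgP _ _) (iprod_cvg Dz))[K hK].
  by exists K => n Kn; apply: hK; rewrite (leq_trans Kn)// leq_addl.
move=> hl; apply/eqP => P0; move: hl; rewrite P0 subr0.
by have := p0 N; lra.
Qed.

End convergence.

Lemma pprod_split e N m z : (m < N)%N ->
  pprod e N z = e m z * pprod (fun n => if n == m then fun=> 1 else e n) N z.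
Proof.
move=> mN; rewrite /pprod (bigD1 (Ordinal mN))//= [in RHS](bigD1 (Ordinal mN))//= eqxx mul1r.
congr (_ * _); apply: eq_bigr => i im.
by case: eqVneq => // iE; move: im; rewrite -val_eqE /= iE eqxx.
Qed.

End infinite_products.

Section elementary_factor.
Context (R : realType).
Implicit Types (a p z u v h : R[i]) (r d : R).

(** The Weierstrass factor of genus one E(w) = (1 - w) e^w at w = (z - p)/(a - p). It equals 1 at
    [p], has a simple zero at [a], and its logarithmic derivative is 1/(z - a) - 1/(p - a). *)
Definition efactor p a z : R[i] :=
  (1 + (z - p) / (p - a)) * cexp (- ((z - p) / (p - a))).

Definition efactor' p a z : R[i] :=
  - ((z - p) / (p - a)) * cexp (- ((z - p) / (p - a))) / (p - a).

Definition eV u : R[i] := (1 + u) * cexp (- u) - 1.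

(** The derivative of [eV] at [v] is [- v * cexp (- v)]. It vanishes at 0, so the case [v = 0] also
    shows that [eV] itself is quadratically small. *)
Lemma eV_rem u v : normc (eV u - eV v - (- v * cexp (- v)) * (u - v)) <=
  9 * (1 + normc v) * expR (normc v) * expR (2 * normc (u - v)) * normc (u - v) ^+ 2.
Proof.
pose h := u - v; have uE : u = v + h by rewrite /h; ring.
rewrite -/h /eV uE opprD cexpD.
have -> : (1 + (v + h)) * (cexp (- v) * cexp (- h)) - 1 - ((1 + v) * cexp (- v) - 1)
    - - v * cexp (- v) * h =
  cexp (- v) * ((1 + v) * (cexp (- h) - 1 - - h) + h * (cexp (- h) - 1)) by ring.
have n0 := normc_ge0 h; have v0 := normc_ge0 v.
rewrite normcM.
have -> : 9 * (1 + normc v) * expR (normc v) * expR (2 * normc h) * normc h ^+ 2 =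
  expR (normc v) * ((1 + normc v) * (4 * normc h ^+ 2 * expR (2 * normc h)) +
    (1 + normc v) * (normc h * (5 * normc h * expR (2 * normc h)))) by ring.
apply: ler_pM; rewrite ?normc_ge0//.
  by apply: (le_trans (normc_cexp_le _)); rewrite normcN.
apply: (le_trans (normcD _ _)); rewrite !normcM; apply: lerD.
  apply: ler_pM; rewrite ?normc_ge0//.
    by apply: (le_trans (normcD _ _)); rewrite normc1.
  apply: (le_trans (cexp_rem2_le _)); rewrite normcN.
  apply: ler_wpM2l; first by apply: mulr_ge0 => //; exact: sqr_ge0.
  by rewrite ler_expR; lra.
have k : normc h * normc (cexp (- h) - 1) <= normc h * (5 * normc h * expR (2 * normc h)).
  by apply: ler_wpM2l => //; have := cexp_sub1_le (- h); rewrite normcN.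
apply: (le_trans k); rewrite ler_peMl//; last lra.
by rewrite !mulr_ge0// expR_ge0.
Qed.

(** Genus one makes the exponent quadratic in [rho = r / normc (p - a)]: this is the source both of
    the order 2 of the product and of the condition on inverse squares. By [1 <= normc (p - a)],
    steps of length at most 1 in [z] remain such after division by [p - a]. *)
Lemma efactor_const : exists2 C : R, 0 <= C & forall p a r,
  1 <= normc (p - a) -> 1 <= r ->
  jet [set z | normc (z - p) <= r] (fun z => efactor p a z - 1) (efactor' p a)
    (expR (C * (r / normc (p - a)) ^+ 2) - 1).
Proof.
pose K0 : R := 9 * expR 2; pose K1 : R := 10 + 3 * K0.
have K00 : 0 <= K0 by rewrite mulr_ge0// expR_ge0.
have K10 : 0 <= K1 by rewrite addr_ge0// mulr_ge0.
exists (K1 * expR 4 + 4); first by rewrite addr_ge0// mulr_ge0// expR_ge0.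
move=> p a r d1 r1; set d := normc (p - a); pose rho := r / d.
have d0 : 0 < d by rewrite (lt_le_trans _ d1).
have r0 : 0 < rho by rewrite divr_gt0// (lt_le_trans _ r1).
(* Here [1 <= r] enters: differentiation costs a factor [d^-1], which is then no worse than
   [rho]. *)
have dr : d^-1 <= rho by rewrite /rho ler_peMl// invr_ge0 ltW.
rewrite -/d -/rho.
pose E := expR (4 * rho).
have E1 : 1 <= E by apply: le1_expR; rewrite mulr_ge0// ltW.
have e2E : expR (2 * rho) <= E by rewrite ler_expR; lra.
have e1E : expR rho <= E by rewrite ler_expR; lra.
have rE : 0 <= E * rho ^+ 2 by rewrite mulr_ge0 ?expR_ge0 ?sqr_ge0.
have un z : normc (z - p) <= r -> normc ((z - p) / (p - a)) <= rho.
  by move=> zr; rewrite normcM normcV ler_pM2r// invr_gt0.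
exists (9 * (E * rho ^+ 2)), ((1 + 2 * K0) * (E * rho ^+ 2)), (K0 * (E * rho ^+ 2)).
split.
- have k1 : 0 <= 1 + 2 * K0 by lra.
  split; [exact: mulr_ge0|exact: mulr_ge0|exact: mulr_ge0|].
  have -> : 9 * (E * rho ^+ 2) + (1 + 2 * K0) * (E * rho ^+ 2) + K0 * (E * rho ^+ 2) =
     (K1 * rho ^+ 2) * E by rewrite /K1; ring.
  have k0 : 0 <= K1 * rho ^+ 2 by rewrite mulr_ge0 ?sqr_ge0.
  (* For [rho <= 1] the factor [E] is at most [expR 4] and [x <= expR x - 1] concludes; for
     [rho > 1], [4 * rho <= 4 * rho ^+ 2] moves [E] into the exponent. *)
  have [rho1|rho1] := leP rho 1.
    apply: (@le_trans _ _ (K1 * expR 4 * rho ^+ 2)).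
      rewrite [leRHS]mulrAC; apply: ler_wpM2l => //.
      by rewrite /E ler_expR; lra.
    have := le_mul_expR (K1 * expR 4 * rho ^+ 2) => h.
    have := @expR_ge1Dx R (K1 * expR 4 * rho ^+ 2).
    have : expR (K1 * expR 4 * rho ^+ 2) <= expR ((K1 * expR 4 + 4) * rho ^+ 2).
      by rewrite ler_expR; apply: ler_wpM2r; [exact: sqr_ge0|rewrite lerDl].
    lra.
  apply: (@le_trans _ _ ((expR (K1 * rho ^+ 2) - 1) * expR (4 * rho ^+ 2))).
    apply: ler_pM => //; first exact: expR_ge0.
      by have := @expR_ge1Dx R (K1 * rho ^+ 2); lra.
    by rewrite ler_expR ler_pM2l// expr2 ler_peMl// ltW.
  rewrite mulrBl mul1r -expRD -mulrDl; apply: lerB.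
    rewrite ler_expR ler_wpM2r ?sqr_ge0// lerD2r ler_peMr//; exact: le1_expR.
  by apply: le1_expR; rewrite mulr_ge0// sqr_ge0.
- move=> z zr; have ur := un z zr; have := eV_rem ((z - p) / (p - a)) 0.
  have -> : eV 0 = 0 by rewrite /eV oppr0 cexp0 addr0 mul1r subrr.
  rewrite oppr0 !mul0r normc0 oppr0 !addr0 expR0 !mulr1 => h.
  apply: (le_trans h); rewrite -mulrA ler_pM2l//.
  apply: ler_pM; rewrite ?expR_ge0 ?sqr_ge0//.
    by rewrite (le_trans _ e2E)// ler_expR ler_pM2l.
  by rewrite lerXn2r ?nnegrE ?normc_ge0// ltW.
- move=> w wr; have ur := un w wr.
  rewrite /efactor' !normcM normcN -normcM normcV -/d.
  apply: (@le_trans _ _ (rho * E * rho)).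
    apply: ler_pM; rewrite ?invr_ge0 ?(ltW d0) ?mulr_ge0 ?normc_ge0//.
    apply: ler_pM; rewrite ?normc_ge0//.
    by apply: (le_trans (normc_cexp_le _)); rewrite normcN (le_trans _ e1E)// ler_expR.
  have -> : rho * E * rho = 1 * (E * rho ^+ 2) by ring.
  by apply: ler_wpM2r => //; rewrite lerDl mulr_ge0.
- move=> z w zr wr zw; have uz := un z zr; have uw := un w wr.
  set u := _ / _ in uz; set v := _ / _ in uw.
  have hE : u - v = (z - w) / (p - a) by rewrite /u /v; ring.
  have hn : normc (u - v) = normc (z - w) / d by rewrite hE normcM normcV.
  have n0 := normc_ge0 (z - w).
  have h1 : normc (u - v) <= 1.
    by rewrite hn ler_pdivrMr// mul1r (le_trans zw).
  have hr : normc (u - v) <= rho * normc (z - w).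
    by rewrite hn mulrC ler_wpM2r.
  have h0 := normc_ge0 (u - v).
  have rem : normc (eV u - eV v - - v * cexp (- v) * (u - v)) <= K0 * E * normc (u - v) ^+ 2.
    apply: (le_trans (eV_rem u v)); apply: ler_wpM2r; first exact: sqr_ge0.
    have -> : K0 * E = 9 * E * expR 2 by rewrite /K0; ring.
    apply: ler_pM; rewrite ?expR_ge0 ?mulr_ge0 ?addr_ge0 ?normc_ge0 ?expR_ge0//.
      rewrite -mulrA ler_pM2l//; apply: (le_trans _ e2E).
      have -> : 2 * rho = rho + rho by ring.
      rewrite expRD; apply: ler_pM; rewrite ?expR_ge0 ?addr_ge0 ?normc_ge0//.
        by apply: (le_trans (expR_ge1Dx _)); rewrite ler_expR.
      by rewrite ler_expR.
    by rewrite ler_expR; lra.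
  have ev x : efactor p a x - 1 = eV ((x - p) / (p - a)) by [].
  rewrite !ev -/u -/v; split.
    have V'v : normc (- v * cexp (- v)) <= rho * E.
      rewrite normcM normcN; apply: ler_pM; rewrite ?normc_ge0//.
      by apply: (le_trans (normc_cexp_le _)); rewrite normcN (le_trans _ e1E)// ler_expR.
    have h2 : normc (u - v) <= 2 * rho by apply: (le_trans (normcB _ _)); lra.
    have -> : eV u - eV v = (eV u - eV v - - v * cexp (- v) * (u - v))
      + - v * cexp (- v) * (u - v) by ring.
    apply: (le_trans (normcD _ _)).
    have t1 : K0 * E * normc (u - v) ^+ 2 <= 2 * K0 * (E * rho ^+ 2) * normc (z - w).
      have -> : 2 * K0 * (E * rho ^+ 2) * normc (z - w) =
        K0 * E * ((2 * rho) * (rho * normc (z - w))) by ring.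
      apply: ler_wpM2l; first by rewrite mulr_ge0// expR_ge0.
      by rewrite expr2; apply: ler_pM.
    have t2 : normc (- v * cexp (- v) * (u - v)) <= E * rho ^+ 2 * normc (z - w).
      rewrite normcM; have -> : E * rho ^+ 2 * normc (z - w) =
        (rho * E) * (rho * normc (z - w)) by ring.
      by apply: ler_pM => //; exact: normc_ge0.
    have -> : (1 + 2 * K0) * (E * rho ^+ 2) * normc (z - w) =
      2 * K0 * (E * rho ^+ 2) * normc (z - w) + E * rho ^+ 2 * normc (z - w) by ring.
    by apply: lerD => //; exact: le_trans t1.
  have -> : efactor' p a w * (z - w) = - v * cexp (- v) * (u - v).
    by rewrite hE /efactor' -/v; ring.
  apply: (le_trans rem).
  have -> : K0 * (E * rho ^+ 2) * normc (z - w) ^+ 2 =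
    K0 * E * (rho * normc (z - w)) ^+ 2 by ring.
  apply: ler_wpM2l; first by rewrite mulr_ge0// expR_ge0.
  by rewrite lerXn2r ?nnegrE// mulr_ge0// ltW.
Qed.

Lemma jet_expr (D : set R[i]) (f f' : R[i] -> R[i]) s m : 0 <= s ->
  jet D (fun z => f z - 1) f' (expR s - 1) ->
  jet D (fun z => f z ^+ m - 1) (fun z => m%:R * f z ^+ m.-1 * f' z) (expR (m%:R * s) - 1).
Proof.
move=> s0 jf; elim: m => [|m IH].
  rewrite mul0r expR0 subrr -(normc0 R); apply: eq_jet (jet_cst D 0) => z _.
    by rewrite expr0 subrr.
  by rewrite !mul0r.
have jfm : jet D (fun z => f z ^+ m) (fun z => m%:R * f z ^+ m.-1 * f' z) (expR (m%:R * s)).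
  have := jetD IH (jet_cst D 1); rewrite normc1 subrK.
  by apply: eq_jet => z _; rewrite ?subrK ?addr0.
have := jetD (jetM jfm jf) IH.
have -> : expR (m%:R * s) * (expR s - 1) + (expR (m%:R * s) - 1) =
   expR (m.+1%:R * s) - 1.
  by rewrite -natr1 mulrDl mul1r expRD; ring.
apply: eq_jet => z _; first by rewrite exprSr; ring.
case: m {IH jfm} => [|m]; first by rewrite !mul0r !expr0; ring.
by rewrite /= -[m.+2%:R]natr1 exprSr; ring.
Qed.

Lemma efactorE p a z : p != a -> efactor p a z =
  (z - a) * ((p - a)^-1 * cexp (- ((z - p) / (p - a)))).
Proof.
move=> pa; have pa0 : p - a != 0 by rewrite subr_eq0.
by rewrite mulrA /efactor; congr (_ * _); field.
Qed.

Lemma efactor_neq0 p a z : p != a -> z != a -> efactor p a z != 0.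
Proof.
move=> pa za; rewrite efactorE//; apply: mulf_neq0; first by rewrite subr_eq0.
by apply: mulf_neq0; [rewrite invr_eq0 subr_eq0|exact: cexp_neq0].
Qed.

Lemma efactor_logder p a z : p != a -> z != a ->
  efactor' p a z / efactor p a z = (z - a)^-1 - (p - a)^-1.
Proof.
move=> pa za; have pa0 : p - a != 0 by rewrite subr_eq0.
have za0 : z - a != 0 by rewrite subr_eq0.
rewrite efactorE// /efactor'; field.
by rewrite pa0 za0 cexp_neq0.
Qed.

End elementary_factor.

Section holomorphic.
Context (R : realType).
Implicit Types (D : set R[i]) (f g : R[i] -> R[i]).

(** For the places where only differentiability is at stake and the constants are irrelevant. *)
Definition has_jet D f := exists f' M, jet D f f' M.

Lemma has_jetM D f g : has_jet D f -> has_jet D g -> has_jet D (fun z => f z * g z).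
Proof. by move=> [f' [M jf]] [g' [N jg]]; do 2 eexists; exact: jetM jf jg. Qed.

Lemma has_jetD D f g : has_jet D f -> has_jet D g -> has_jet D (fun z => f z + g z).
Proof. by move=> [f' [M jf]] [g' [N jg]]; do 2 eexists; exact: jetD jf jg. Qed.

Lemma has_jet_cst D c : has_jet D (fun=> c).
Proof. by do 2 eexists; exact: jet_cst. Qed.

Lemma has_jetX D f m : has_jet D f -> has_jet D (fun z => f z ^+ m).
Proof.
move=> jf; elim: m => [|m IH].
  by under eq_fun do rewrite expr0; exact: has_jet_cst.
by under eq_fun do rewrite exprS; exact: has_jetM.
Qed.

Lemma has_jet_id a r : has_jet [set z : R[i] | normc (z - a) <= r] id.
Proof.
have [r0|r0] := leP 0 r.
  do 2 eexists; apply: (@jet_id _ _ (r + normc a)); last first.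
    by rewrite addr_ge0// normc_ge0.
  move=> z /= zr; have -> : z = (z - a) + a by rewrite subrK.
  by apply: (le_trans (normcD _ _)); rewrite lerD2r.
exists (fun=> 0), 0, 0, 0, 0; split.
- by split; rewrite ?addr0.
- by move=> w /= wr; have := le_lt_trans wr r0; rewrite ltNge normc_ge0.
- by move=> w /= wr; have := le_lt_trans wr r0; rewrite ltNge normc_ge0.
- by move=> w z /= wr; have := le_lt_trans wr r0; rewrite ltNge normc_ge0.
Qed.

Lemma has_jet_cexp D f : has_jet D f -> has_jet D (fun z => cexp (f z)).
Proof.
move=> [f' [M jf]]; do 2 eexists.
apply: (jet_cexp jf (expR_ge0 M)) => w Dw.
by apply: (le_trans (normc_cexp_le _)); rewrite ler_expR; exact: jet_bound jf Dw.
Qed.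

Lemma has_jet_derivable a r f : 0 < r -> has_jet [set z | normc (z - a) <= r] f ->
  \forall z \near a, derivable f z 1.
Proof.
move=> r0 [f' [M jf]]; apply: (@near_normc _ a (r / 2)); first by rewrite divr_gt0.
move=> z zr; apply: (jet_derivable jf (r := r / 2)); first by rewrite divr_gt0.
move=> w wz /=; have -> : w - a = (w - z) + (z - a) by rewrite addrA subrK.
apply: (le_trans (normcD _ _)); lra.
Qed.

End holomorphic.

Section canonical_product.
Context (R : realType) (p : R[i]) (pt : nat -> R[i]) (S : R).
Hypothesis pt1 : forall n, 1 <= normc (p - pt n).
Implicit Types (mult : nat -> nat) (z a : R[i]).

(** An index of multiplicity 0 gives the factor 1, so that gaps of a partial enumeration and the
    removal of a zero ([cprod_split]) are handled alike. *)
Definition cprod_e mult n z : R[i] := efactor p (pt n) z ^+ mult n.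
Definition cprod_e' mult n z : R[i] :=
  (mult n)%:R * efactor p (pt n) z ^+ (mult n).-1 * efactor' p (pt n) z.
Definition cprod mult := iprod (cprod_e mult).
Definition cprod' mult := iprod' (cprod_e mult) (cprod_e' mult).

Definition inv_sq mult n : R := (mult n)%:R / normc (p - pt n) ^+ 2.

Let pp n : p != pt n.
Proof.
apply/eqP => e; have := pt1 n; rewrite -e subrr normc0.
by rewrite leNgt ltr01.
Qed.

Lemma inv_sq_ge0 mult n : 0 <= inv_sq mult n.
Proof. by rewrite divr_ge0 ?sqr_ge0. Qed.

Lemma cprod_e_jets : exists2 C : R, 0 <= C & forall mult r n, 1 <= r ->
  jet [set z | normc (z - p) <= r] (fun z => cprod_e mult n z - 1) (cprod_e' mult n)
   (expR (C * r ^+ 2 * inv_sq mult n) - 1).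
Proof.
have [C C0 h] := efactor_const R; exists C => // mult r n r1.
have s0 : 0 <= C * (r / normc (p - pt n)) ^+ 2 by rewrite mulr_ge0 ?sqr_ge0.
have := jet_expr (mult n) s0 (h p (pt n) r (pt1 n) r1).
suff -> : (mult n)%:R * (C * (r / normc (p - pt n)) ^+ 2) =
  C * r ^+ 2 * inv_sq mult n by [].
by rewrite /inv_sq expr_div_n; ring.
Qed.

Let scaled_ge0 mult (C r : R) n : 0 <= C -> 0 <= C * r ^+ 2 * inv_sq mult n.
Proof. by move=> C0; rewrite mulr_ge0 ?inv_sq_ge0// mulr_ge0// sqr_ge0. Qed.

Let scaled_le mult (C r : R) : sum_le (inv_sq mult) S -> 0 <= C ->
  sum_le (fun n => C * r ^+ 2 * inv_sq mult n) (C * r ^+ 2 * S).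
Proof.
move=> h C0 N; rewrite -mulr_sumr; apply: ler_wpM2l (h N).
by rewrite mulr_ge0// sqr_ge0.
Qed.

Lemma cprod_jet : exists2 C : R, 0 <= C & forall mult r, sum_le (inv_sq mult) S ->
  1 <= r -> jet [set z | normc (z - p) <= r] (cprod mult) (cprod' mult) (expR (C * r ^+ 2)).
Proof.
have [C C0 h] := cprod_e_jets; exists (C * `|S|); first by rewrite mulr_ge0.
move=> mult r mS r1; have S0 : 0 <= S := sum_le_cst_ge0 mS.
rewrite ger0_norm//.
rewrite (mulrAC C).
exact: (jet_iprod (fun n => scaled_ge0 mult r n C0) (scaled_le r mS C0)
  (fun n => h mult r n r1)).
Qed.

Let ball_mem z : [set w | normc (w - p) <= normc (z - p) + 1] z.
Proof. by rewrite /= lerDl. Qed.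

Let r1 z : 1 <= normc (z - p) + 1.
Proof. by rewrite lerDr normc_ge0. Qed.

Lemma cprod_cvg mult z : sum_le (inv_sq mult) S ->
  ccvg (fun N => pprod (cprod_e mult) N z) (cprod mult z).
Proof.
move=> mS; have [C C0 h] := cprod_e_jets.
exact: (iprod_cvg (fun n => scaled_ge0 mult _ n C0)
  (scaled_le (normc (z - p) + 1) mS C0) (fun n => h mult _ n (r1 z)) (ball_mem z)).
Qed.

Lemma cprod_neq0 mult z : sum_le (inv_sq mult) S ->
  (forall n, mult n != 0%N -> z != pt n) -> cprod mult z != 0.
Proof.
move=> mS hz; have [C C0 h] := cprod_e_jets.
apply: (iprod_neq0 (fun n => scaled_ge0 mult _ n C0)
  (scaled_le (normc (z - p) + 1) mS C0) (fun n => h mult _ n (r1 z)) (ball_mem z)) => n.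
rewrite /cprod_e; have [->|m0] := eqVneq (mult n) 0%N; first by rewrite expr0 oner_neq0.
by rewrite expf_neq0// efactor_neq0// hz.
Qed.

Lemma cprod_split mult m z : sum_le (inv_sq mult) S ->
  cprod mult z = efactor p (pt m) z ^+ mult m *
    cprod (fun n => if n == m then 0%N else mult n) z.
Proof.
move=> mS; set mult' := fun n => _.
have mS' : sum_le (inv_sq mult') S.
  apply: sum_leW mS => n; rewrite /inv_sq /mult'; apply: ler_wpM2r.
    by rewrite invr_ge0 sqr_ge0.
  by rewrite ler_nat; case: ifP.
apply: ccvg_unique (cprod_cvg z mS) _.
apply: ccvg_near (ccvgZ _ (cprod_cvg z mS')).
exists m.+1 => // N /= mN; rewrite (pprod_split (cprod_e mult) _ mN) /cprod_e.
congr (_ * _); apply: eq_bigr => i _; rewrite /mult'.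
by case: eqVneq => // ->; rewrite expr0.
Qed.

Lemma zero_order_cprod0 mult a : sum_le (inv_sq mult) S ->
  (forall n, mult n != 0%N -> a != pt n) -> zero_order (cprod mult) a 0.
Proof.
move=> mS ha; exists (cprod mult); split; last first.
- by apply: (@near_normc _ a 1) => // z _; rewrite expr0 mul1r.
- exact: cprod_neq0.
have [C C0 h] := cprod_jet.
apply: (@has_jet_derivable _ a 1) => //.
do 2 eexists; apply: jet_subset (h mult (normc (a - p) + 1) mS (r1 a)) => z /= za.
have -> : z - p = (z - a) + (a - p) by rewrite addrA subrK.
by apply: (le_trans (normcD _ _)); rewrite addrC lerD2l.
Qed.

Lemma zero_order_cprod mult m : sum_le (inv_sq mult) S ->
  (forall n, mult n != 0%N -> n != m -> pt m != pt n) ->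
  zero_order (cprod mult) (pt m) (mult m).
Proof.
move=> mS hm; pose a := pt m; pose mult' n := if n == m then 0%N else mult n.
have mS' : sum_le (inv_sq mult') S.
  apply: sum_leW mS => n; rewrite /inv_sq /mult'; apply: ler_wpM2r.
    by rewrite invr_ge0 sqr_ge0.
  by rewrite ler_nat; case: ifP.
(* What is left of the [m]-th factor once [(z - a) ^+ mult m] is removed, times the product over the
   other zeros. *)
exists (fun z => ((p - a)^-1 * cexp (- ((z - p) / (p - a)))) ^+ mult m * cprod mult' z).
split.
- apply: (@has_jet_derivable _ a 1) => //; apply: has_jetM.
    apply/has_jetX/has_jetM; first exact: has_jet_cst.
    apply: has_jet_cexp.
    have -> : (fun z => - ((z - p) / (p - a))) =
        (fun z => - (p - a)^-1 * z + p / (p - a)).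
      by apply/funext => z; ring.
    apply: has_jetD; last exact: has_jet_cst.
    by apply: has_jetM; [exact: has_jet_cst|exact: has_jet_id].
  have [C C0 h] := cprod_jet.
  do 2 eexists; apply: jet_subset (h mult' (normc (a - p) + 1) mS' (r1 a)) => z /= za.
  have -> : z - p = (z - a) + (a - p) by rewrite addrA subrK.
  by apply: (le_trans (normcD _ _)); rewrite addrC lerD2l.
- rewrite mulf_neq0//.
    by rewrite expf_neq0// mulf_neq0 ?cexp_neq0// invr_eq0 subr_eq0 pp.
  apply: cprod_neq0 => // n; rewrite /mult'; case: (eqVneq n m) => // nm m0.
  exact: hm.
- apply: (@near_normc _ a 1) => // z _; rewrite (cprod_split m)// efactorE ?pp// exprMn.
  by rewrite -/a -mulrA.
Qed.

Definition logder_sum mult z : R[i] :=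
  csum (fun n => (mult n)%:R * ((z - pt n)^-1 - (p - pt n)^-1)).

(** With [a = pt n], the difference of inverses is (p - z)/((z - a)(p - a)). Since [normc (p - a)]
    is at most [normc (p - z) / d + 1] times [normc (z - a)], the inverse of the latter can be
    traded for a second inverse of the former. *)
Lemma logder_term_le mult z (d : R) n : 0 < d -> d <= normc (z - pt n) ->
  normc ((mult n)%:R * ((z - pt n)^-1 - (p - pt n)^-1)) <=
    normc (p - z) * (normc (p - z) / d + 1) * inv_sq mult n.
Proof.
move=> d0 dz; have z0 : 0 < normc (z - pt n) := lt_le_trans d0 dz.
have p0 : 0 < normc (p - pt n) := lt_le_trans ltr01 (pt1 n).
have -> : (z - pt n)^-1 - (p - pt n)^-1 = (p - z) * ((z - pt n)^-1 * (p - pt n)^-1).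
  by field; rewrite -!normc_gt0 p0 z0.
rewrite !normcM !normcV normc_nat /inv_sq.
have -> : normc (p - z) * (normc (p - z) / d + 1) * ((mult n)%:R / normc (p - pt n) ^+ 2) =
  (mult n)%:R * (normc (p - z) * ((normc (p - z) / d + 1) / normc (p - pt n) ^+ 2)) by ring.
apply: ler_wpM2l => //; apply: ler_wpM2l; first exact: normc_ge0.
rewrite expr2 invfM mulrA; apply: ler_wpM2r; first by rewrite invr_ge0 ltW.
rewrite ler_pdivlMr// mulrC -[leRHS]mul1r ler_pdivrMr//.
rewrite mul1r -[leLHS]mulr1 ; have -> : p - pt n = (p - z) + (z - pt n) by rewrite addrA subrK.
rewrite mulr1; apply: (le_trans (normcD _ _)); rewrite mulrDl mul1r lerD2r.
rewrite -mulrA ler_peMr ?normc_ge0//.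
by rewrite mulrC ler_pdivlMr// mul1r.
Qed.

Lemma csummable_logder mult z (d : R) : sum_le (inv_sq mult) S -> 0 < d ->
  (forall n, mult n != 0%N -> d <= normc (z - pt n)) ->
  csummable (fun n => (mult n)%:R * ((z - pt n)^-1 - (p - pt n)^-1)).
Proof.
move=> mS d0 h; set K := normc (p - z) * (normc (p - z) / d + 1).
have K0 : 0 <= K.
  by rewrite mulr_ge0 ?normc_ge0// addr_ge0// divr_ge0 ?normc_ge0 ?ltW.
exists (K * S) => N; apply: (@le_trans _ _ (\sum_(n < N) K * inv_sq mult n)).
  apply: ler_sum => n _; have [m0|m0] := eqVneq (mult n) 0%N.
    by rewrite m0 mul0r normc0 mulr_ge0// inv_sq_ge0.
  by apply: logder_term_le => //; exact: h.
by rewrite -mulr_sumr; apply: ler_wpM2l.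
Qed.

Lemma cprod'_logder mult z (d : R) : sum_le (inv_sq mult) S -> 0 < d ->
  (forall n, mult n != 0%N -> d <= normc (z - pt n)) ->
  cprod' mult z = cprod mult z * logder_sum mult z.
Proof.
move=> mS d0 hz; have [C C0 h] := cprod_e_jets.
have zn n : mult n != 0%N -> z != pt n.
  move=> /hz; apply: contraTneq => ->; rewrite subrr normc0 -ltNge//.
have E n : cprod_e' mult n z / cprod_e mult n z =
    (mult n)%:R * ((z - pt n)^-1 - (p - pt n)^-1).
  rewrite /cprod_e /cprod_e'; have [->|m0] := eqVneq (mult n) 0%N.
    by rewrite !mul0r.
  rewrite -efactor_logder ?pp ?zn//.
  case: (mult n) m0 (zn n) => // m m0 /(_ isT) znm.
  by rewrite /= exprS; field; rewrite expf_neq0 efactor_neq0 ?pp.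
rewrite /cprod' /cprod (iprod'_logder (fun n => scaled_ge0 mult _ n C0)
  (scaled_le (normc (z - p) + 1) mS C0) (fun n => h mult _ n (r1 z)) (ball_mem z)).
- by congr (_ * _); apply: eq_csum.
- move=> n; rewrite /cprod_e; have [->|m0] := eqVneq (mult n) 0%N.
    by rewrite expr0 oner_neq0.
  by rewrite expf_neq0// efactor_neq0// zn.
- by under eq_fun do rewrite E; exact: csummable_logder mS d0 hz.
Qed.

End canonical_product.

(** * Integrals along horizontal lines *)

Section affine_change_of_variables.
Context (R : realType).
Local Notation mu := (@lebesgue_measure R).
Implicit Types (a b : R) (g : R -> R).

Lemma is_derive_affine a b (x : R) : is_derive x 1 (fun x : R => a * x + b) a.
Proof.
have := is_deriveD (is_deriveZ a (is_derive_id x 1)) (is_derive_cst b x 1).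
by rewrite addr0 -[a *: 1]/(a * 1) mulr1.
Qed.

Lemma derive1_affine a b : (fun x : R => a * x + b)^`()%classic = cst a.
Proof.
apply/funext => x; rewrite derive1E.
exact: (@derive_val _ _ _ _ _ _ _ (is_derive_affine a b x)).
Qed.

Lemma affine_cvgy a b : 0 < a -> (fun x : R => a * x + b) @ +oo%R --> +oo%R.
Proof.
move=> a0; apply/cvgryPge => A; near=> x.
rewrite -lerBlDr mulrC -ler_pdivrMr//; near: x; exact: nbhs_pinfty_ge.
Unshelve. all: by end_near. Qed.

Lemma affine_cvgNy a b : 0 < a -> (fun x : R => a * x + b) @ -oo%R --> -oo%R.
Proof.
move=> a0; apply/cvgrNyPle => A; near=> x.
rewrite -lerBrDr mulrC -ler_pdivlMr//; near: x; exact: nbhs_ninfty_le.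
Unshelve. all: by end_near. Qed.

Lemma continuous_affine a b : continuous (fun x : R => a * x + b).
Proof.
move=> x; apply/differentiable_continuous/derivable1_diffP.
by have [] := is_derive_affine a b x.
Qed.

Lemma ge0_integral_affine a b g : 0 < a -> continuous g -> (forall x, 0 <= g x) ->
  (\int[mu]_x (g x)%:E = \int[mu]_x (g (a * x + b) * a)%:E)%E.
Proof.
move=> a0 cg g0; rewrite (@increasing_ge0_integration_by_substitutionT R (fun x => a * x + b))//.
- by rewrite derive1_affine; apply: eq_integral => x _.
- by move=> x y xy; rewrite ltrD2r ltr_pM2l.
- by rewrite derive1_affine; exact: cst_continuous.
- by rewrite derive1_affine; exact: is_cvg_cst.
- by rewrite derive1_affine; exact: is_cvg_cst.
- exact: affine_cvgNy.
- exact: affine_cvgy.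
Qed.

Lemma integrable_affine a b g : 0 < a -> continuous g ->
  mu.-integrable setT (EFin \o g) -> mu.-integrable setT (EFin \o (fun x => g (a * x + b))).
Proof.
move=> a0 cg /integrableP[mg ig].
have cga : continuous (fun x => g (a * x + b)).
  by move=> x; apply: continuous_comp; [exact: continuous_affine|exact: cg].
apply/integrableP; split.
  by apply/measurable_EFinP; exact: continuous_measurable_fun.
move: ig; rewrite /= (@ge0_integral_affine a b (fun x => `|g x|))//; last first.
  by move=> x; apply: continuous_comp; [exact: cg|exact: norm_continuous].
under eq_integral do rewrite EFinM muleC.
rewrite ge0_integralZl//; last 2 first.
- apply/measurable_EFinP; apply: continuous_measurable_fun => x.
  by apply: continuous_comp; [exact: cga|exact: norm_continuous].
- by rewrite lee_fin ltW.
move=> h; rewrite ltNge; apply/negP; rewrite leye_eq => /eqP e.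
by move: h; rewrite e gt0_muley.
Qed.

Lemma Rintegral_affine a b g : 0 < a -> continuous g ->
  mu.-integrable setT (EFin \o g) -> \int[mu]_x g x = a * \int[mu]_x g (a * x + b).
Proof.
move=> a0 cg ig.
(* The substitution rule is applied to two nonnegative functions whose difference is [g]. *)
pose gp : R -> R := fun x => `|g x| + g x; pose gm : R -> R := fun x => `|g x|.
have cn : continuous gm.
  by move=> x; apply: continuous_comp; [exact: cg|exact: norm_continuous].
have cp : continuous gp by move=> x; apply: cvgD; [exact: cn|exact: cg].
have im : mu.-integrable setT (EFin \o gm) by exact: integrable_norm ig.
have ip : mu.-integrable setT (EFin \o gp).
  by have := integrableD measurableT im ig; apply: eq_integrable.
have E (h : R -> R) : continuous h -> (forall x, 0 <= h x) -> mu.-integrable setT (EFin \o h) ->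
    \int[mu]_x h x = a * \int[mu]_x h (a * x + b).
  move=> ch h0 ih; rewrite -RintegralZl//; last exact: integrable_affine.
  congr fine; rewrite (ge0_integral_affine b a0 ch h0).
  by apply: eq_integral => x _; rewrite mulrC.
have -> : \int[mu]_x g x = \int[mu]_x gp x - \int[mu]_x gm x.
  by rewrite -RintegralB//; apply: eq_Rintegral => x _; rewrite /gp /gm; ring.
have gp0 x : 0 <= gp x by rewrite /gp; have := ler_norm (- g x); rewrite normrN; lra.
have gm0 x : 0 <= gm x by exact: normr_ge0.
rewrite (E gp cp gp0 ip) (E gm cn gm0 im) -mulrBr -RintegralB//; try exact: integrable_affine.
by congr (_ * _); apply: eq_Rintegral => x _; rewrite /gp /gm; ring.
Qed.

End affine_change_of_variables.

Section line_integrals.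
Context (R : realType).
Local Notation mu := (@lebesgue_measure R).
Implicit Types (f : R -> R[i]) (a b : R).

Definition ccontinuous f :=
  continuous (fun x => complex.Re (f x)) /\ continuous (fun x => complex.Im (f x)).

Lemma ccontinuous_measurable f : ccontinuous f ->
  @cmeasurable _ (measurableTypeR R) R f.
Proof. by move=> [r i]; split; exact: continuous_measurable_fun. Qed.

Lemma ccontinuous_lip f : (forall x, exists r K : R, 0 < r /\ forall y, `|y - x| < r ->
    normc (f y - f x) <= K * `|y - x|) -> ccontinuous f.
Proof.
move=> h; suff c (u : R -> R) : (forall x, exists r K : R, 0 < r /\ forall y, `|y - x| < r ->
    `|u y - u x| <= K * `|y - x|) -> continuous u.
  split; apply: c => x; have [r [K [r0 k]]] := h x; exists r, K; split => // y /k.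
    by rewrite -Re_B; apply: le_trans; exact: Re_le_normc.
  by rewrite -Im_B; apply: le_trans; exact: Im_le_normc.
move=> {}h x; have [r [K [r0 k]]] := h x.
apply/cvgrPdist_lt => e e0.
have K1 : 0 < `|K| + 1 by have := normr_ge0 K; lra.
apply/nbhs_ballP; exists (Num.min r (e / (`|K| + 1))) => /=.
  by rewrite lt_min r0 divr_gt0.
move=> y; rewrite /ball /= distrC lt_min => /andP[yr ye].
rewrite distrC; apply: (le_lt_trans (k y yr)).
apply: (@le_lt_trans _ _ ((`|K| + 1) * `|y - x|)).
  by apply: ler_wpM2r => //; have := ler_norm K; lra.
by rewrite mulrC -ltr_pdivlMr.
Qed.

Lemma cintegrable_affine f a b : 0 < a -> ccontinuous f -> cintegrable mu f ->
  cintegrable mu (fun x => f (a * x + b)).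
Proof.
move=> a0 [cr ci] [ir ii]; split.
  exact: (@integrable_affine _ a b (fun x => complex.Re (f x))).
exact: (@integrable_affine _ a b (fun x => complex.Im (f x))).
Qed.

Lemma cintegral_affine f a b : 0 < a -> ccontinuous f -> cintegrable mu f ->
  cintegral mu f = a%:C * cintegral mu (fun x => f (a * x + b)).
Proof.
move=> a0 [cr ci] [ir ii]; apply: complex_eqP.
  rewrite Re_M /= mul0r subr0.
  exact: (@Rintegral_affine _ a b (fun x => complex.Re (f x))).
rewrite Im_M /= mul0r addr0.
exact: (@Rintegral_affine _ a b (fun x => complex.Im (f x))).
Qed.

Lemma cintegral_shift f b : ccontinuous f -> cintegrable mu f ->
  cintegral mu (fun x => f (x + b)) = cintegral mu f.
Proof.
move=> cf jf; rewrite [RHS](cintegral_affine b ltr01 cf jf).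
by rewrite -[1%:C]/(1 : R[i]) mul1r; apply: eq_cintegral => x; rewrite mul1r.
Qed.

Lemma cintegrable_shift f b : ccontinuous f -> cintegrable mu f ->
  cintegrable mu (fun x => f (x + b)).
Proof.
move=> cf jf; have := cintegrable_affine b ltr01 cf jf.
by under eq_fun do rewrite mul1r.
Qed.

(* F (z + i d) - F z and
   i (F (z + d) - F z) agree to second order in d, and the latter has integral
   zero by translation invariance. *)
Lemma line_integral_const (F F' : R[i] -> R[i]) (Y : R) (K : R -> R) :
  mu.-integrable setT (EFin \o K) ->
  (forall y, `|y| <= Y -> ccontinuous (fun x => F (x +i* y))) ->
  (forall z, `|complex.Im z| <= Y -> normc (F z) <= K (complex.Re z)) ->
  (forall z w, `|complex.Im z| <= Y -> `|complex.Im w| <= Y -> normc (z - w) <= 1 ->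
     normc (F z - F w - F' w * (z - w)) <= K (complex.Re w) * normc (z - w) ^+ 2) ->
  forall y y', `|y| <= Y -> `|y'| <= Y ->
  cintegral mu (fun x => F (x +i* y)) = cintegral mu (fun x => F (x +i* y')).
Proof.
move=> iK cF bF rF y y' yY y'Y.
pose I t := cintegral mu (fun x => F (x +i* t)).
have jF t : `|t| <= Y -> cintegrable mu (fun x => F (x +i* t)).
  move=> tY; apply: cintegrable_dom iK _; first exact/ccontinuous_measurable/cF.
  by move=> x; apply: bF.
pose B := \int[mu]_x K x.
have step t u : `|t| <= Y -> `|u| <= Y -> `|u - t| <= 1 ->
    normc (I u - I t) <= 2 * B * (u - t) ^+ 2.
  move=> tY uY ut; set d := u - t.
  have E : I u - I t = cintegral mu (fun x =>
      (F (x +i* u) - F (x +i* t)) - 'i%C * (F ((x + d) +i* t) - F (x +i* t))).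
    have j1 := jF _ tY; have j2 := jF _ uY.
    have j3 := cintegrable_shift d (cF _ tY) j1.
    rewrite cintegralB; [|exact: cintegrableB|exact/cintegrableZ/cintegrableB].
    rewrite cintegralZ; last exact: cintegrableB.
    rewrite !cintegralB// (@cintegral_shift (fun x => F (x +i* t)) d (cF _ tY) j1).
    by rewrite subrr mulr0 subr0.
  rewrite E; apply: (@le_trans _ _ (\int[mu]_x (2 * d ^+ 2 * K x))).
    apply: normc_cintegral_le.
    - have j1 := jF _ tY; have j2 := jF _ uY.
      have j3 := cintegrable_shift d (cF _ tY) j1.
      by apply: cintegrableB; [exact: cintegrableB|exact/cintegrableZ/cintegrableB].
    - by apply: eq_integrable (integrableZl measurableT (2 * d ^+ 2) iK).
    - move=> x; pose w : R[i] := x +i* t.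
      have e1 : (x +i* u) - w = 0 +i* d.
        by apply: complex_eqP; rewrite /= ?subrr.
      have e2 : ((x + d) +i* t) - w = d%:C.
        by apply: complex_eqP; rewrite /= ?subrr//; ring.
      have := rF (x +i* u) w uY tY; rewrite e1 normc_i => /(_ ut) h1.
      have := rF ((x + d) +i* t) w tY tY; rewrite e2 normcR => /(_ ut) h2.
      rewrite -/w; have -> : F (x +i* u) - F w - 'i%C * (F ((x + d) +i* t) - F w) =
        (F (x +i* u) - F w - F' w * (0 +i* d)) -
        'i%C * (F ((x + d) +i* t) - F w - F' w * d%:C).
        have -> : 0 +i* d = 'i%C * d%:C :> R[i] by apply: complex_eqP => /=; ring.
        by ring.
      apply: (le_trans (normcB _ _)); rewrite normcM normc_i normr1 mul1r.
      apply: (le_trans (lerD h1 h2)); rewrite real_normK ?num_real//=.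
      by rewrite le_eqVlt; apply/orP; left; apply/eqP; ring.
  by rewrite RintegralZl// le_eqVlt; apply/orP; left; apply/eqP; rewrite /B; ring.
have sY s : 0 <= s <= 1 -> `|y + s * (y' - y)| <= Y.
  move=> /andP[s0 s1]; have -> : y + s * (y' - y) = (1 - s) * y + s * y' by ring.
  apply: (le_trans (ler_normD _ _)); rewrite !normrM.
  rewrite (@ger0_norm _ (1 - s)) ?(ger0_norm s0) ?subr_ge0//.
  have -> : Y = (1 - s) * Y + s * Y by ring.
  by apply: lerD; apply: ler_wpM2l => //; rewrite subr_ge0.
have d0 : 0 < (`|y' - y| + 1)^-1 by rewrite invr_gt0; have := normr_ge0 (y' - y); lra.
have : I (y + 1 * (y' - y)) = I (y + 0 * (y' - y)); last first.
  by rewrite mul0r mul1r addr0 (addrC y) subrK.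
apply: (@rem2_const R (fun s => I (y + s * (y' - y))) _ (2 * B * (y' - y) ^+ 2) d0).
move=> s t s01 t01 st.
apply: (le_trans (step _ _ _ _ _)); rewrite ?sY//.
- have -> : y + s * (y' - y) - (y + t * (y' - y)) = (s - t) * (y' - y) by ring.
  rewrite normrM; apply: (@le_trans _ _ ((`|y' - y| + 1)^-1 * (`|y' - y| + 1))).
    by apply: ler_pM => //; lra.
  by rewrite mulVf// gt_eqF//; have := normr_ge0 (y' - y); lra.
- by rewrite le_eqVlt; apply/orP; left; apply/eqP; ring.
Qed.

End line_integrals.

Section order2.
Context (R : realType).
Implicit Types (f g : R[i] -> R[i]).
Local Notation cball r := [set z : R[i] | normc z <= r].

(** A step of length at most 1 may exceed 1 after multiplication by [a]. Then
    [1 <= normc a * normc (z - w)], so the crude bound [2 * M0] of the increment is already of first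
    and of second order; this explains the summands [2 * M0]. *)
Lemma jet_affine (D : set R[i]) f (f' : R[i] -> R[i]) M (a b : R[i]) : jet D f f' M ->
  jet [set z | D (a * z + b)] (fun z => f (a * z + b)) (fun z => a * f' (a * z + b))
    (3 * (1 + normc a) ^+ 2 * M).
Proof.
move=> [M0 [M1 [M2 [[p0 p1 p2 hM] h0 h1 h2]]]].
have a0 := normc_ge0 a.
exists M0, (normc a * (M1 + 2 * M0)), (normc a ^+ 2 * (M2 + M1 + 2 * M0)); split.
- split; rewrite ?mulr_ge0 ?addr_ge0 ?mulr_ge0 ?sqr_ge0//.
  apply: (@le_trans _ _ (3 * (1 + normc a) ^+ 2 * (M0 + M1 + M2))); last first.
    by apply: ler_wpM2l => //; rewrite mulr_ge0// sqr_ge0.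
  rewrite -subr_ge0; have -> : 3 * (1 + normc a) ^+ 2 * (M0 + M1 + M2) -
    (M0 + normc a * (M1 + 2 * M0) + normc a ^+ 2 * (M2 + M1 + 2 * M0)) =
    M0 * (2 + 4 * normc a + normc a ^+ 2) + M1 * (3 + 5 * normc a + 2 * normc a ^+ 2)
    + M2 * (3 + 6 * normc a + 2 * normc a ^+ 2) by ring.
  have q0 := sqr_ge0 (normc a).
  by rewrite !addr_ge0// mulr_ge0// !addr_ge0// mulr_ge0.
- by move=> w; exact: h0.
- move=> w Dw; rewrite normcM; apply: ler_wpM2l => //.
  by apply: (le_trans (h1 _ Dw)); lra.
- move=> z w Dz Dw zw /=.
  have e : a * z + b - (a * w + b) = a * (z - w) by ring.
  have n0 := normc_ge0 (z - w).
  have en : normc (a * (z - w)) = normc a * normc (z - w) by rewrite normcM.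
  have [s1|s1] := leP (normc (a * (z - w))) 1.
    have := h2 _ _ Dz Dw; rewrite e => /(_ s1)[l1 l2].
    split.
      apply: (le_trans l1); rewrite en -mulrA mulrCA; apply: ler_wpM2l => //.
      by apply: ler_wpM2r => //; lra.
    have -> : a * f' (a * w + b) * (z - w) = f' (a * w + b) * (a * (z - w)) by ring.
    apply: (le_trans l2); rewrite en exprMn mulrA (mulrC M2).
    by apply: ler_wpM2r; rewrite ?sqr_ge0//; apply: ler_wpM2l; rewrite ?sqr_ge0//; lra.
  have d0 : normc (f (a * z + b) - f (a * w + b)) <= 2 * M0.
    apply: (le_trans (normcB _ _)); have := h0 _ Dz; have := h0 _ Dw; lra.
  have s2 : 1 <= normc a * normc (z - w) by rewrite -en ltW.
  have m0 : 2 * M0 * 1 <= 2 * M0 * (normc a * normc (z - w)).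
    by apply: ler_wpM2l => //; rewrite mulr_ge0.
  split.
    apply: (le_trans d0); rewrite mulr1 in m0; apply: (le_trans m0).
    rewrite mulrA (mulrC _ (normc a)); apply: ler_wpM2r => //.
    by apply: ler_wpM2l => //; lra.
  apply: (le_trans (normcB _ _)).
  have -> : a * f' (a * w + b) * (z - w) = f' (a * w + b) * (a * (z - w)) by ring.
  rewrite (normcM (f' _)) en.
  have l1 : normc (f' (a * w + b)) * (normc a * normc (z - w)) <=
      M1 * (normc a * normc (z - w)).
    by apply: ler_wpM2r; [exact: mulr_ge0|exact: h1].
  apply: (le_trans (lerD d0 l1)).
  rewrite mulr1 in m0.
  have q : normc a * normc (z - w) <= (normc a * normc (z - w)) ^+ 2.
    by rewrite expr2 ler_peMl// mulr_ge0.
  have -> : normc a ^+ 2 * (M2 + M1 + 2 * M0) * normc (z - w) ^+ 2 =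
    (normc a * normc (z - w)) ^+ 2 * M2 + M1 * (normc a * normc (z - w)) ^+ 2
     + 2 * M0 * (normc a * normc (z - w)) ^+ 2 by ring.
  have t0 : 0 <= (normc a * normc (z - w)) ^+ 2 * M2 by rewrite mulr_ge0// sqr_ge0.
  have t1 := ler_wpM2l p1 q.
  have t2 : 2 * M0 * (normc a * normc (z - w)) <= 2 * M0 * (normc a * normc (z - w)) ^+ 2.
    by apply: ler_wpM2l q; rewrite mulr_ge0.
  lra.
Qed.

(* f is entire of order at most 2 and finite type, with derivative f'. *)
Definition order2 f f' := exists C c : R, [/\ 0 <= C, 0 <= c &
  forall r, 1 <= r -> jet (cball r) f f' (C * expR (c * r ^+ 2))].

Lemma eq_order2 f f' g g' : f =1 g -> f' =1 g' -> order2 f f' -> order2 g g'.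
Proof. by move=> /funext -> /funext ->. Qed.

Lemma order2M f f' g g' : order2 f f' -> order2 g g' ->
  order2 (fun z => f z * g z) (fun z => f' z * g z + f z * g' z).
Proof.
move=> [C [c [C0 c0 jf]]] [E [e [E0 e0 jg]]]; exists (C * E), (c + e).
split; rewrite ?mulr_ge0 ?addr_ge0// => r r1.
have := jetM (jf r r1) (jg r r1); rewrite mulrDl expRD.
by rewrite (_ : _ * (E * _) = C * E * (expR (c * r ^+ 2) * expR (e * r ^+ 2)))//; ring.
Qed.

Lemma order2D f f' g g' : order2 f f' -> order2 g g' ->
  order2 (fun z => f z + g z) (fun z => f' z + g' z).
Proof.
move=> [C [c [C0 c0 jf]]] [E [e [E0 e0 jg]]]; exists (C + E), (c + e).
split; rewrite ?addr_ge0// => r r1.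
apply: jetW (jetD (jf r r1) (jg r r1)); rewrite mulrDl.
by apply: lerD; apply: ler_wpM2l => //; rewrite ler_expR;
  apply: ler_wpM2r; rewrite ?sqr_ge0//; lra.
Qed.

Lemma order2_cst c : order2 (fun=> c) (fun=> 0).
Proof.
exists (normc c), 0; split; rewrite ?normc_ge0// => r r1.
by rewrite mul0r expR0 mulr1; exact: jet_cst.
Qed.

Lemma order2Z c f f' : order2 f f' -> order2 (fun z => c * f z) (fun z => c * f' z).
Proof.
move=> /(order2M (order2_cst c)); apply: eq_order2 => z //.
by rewrite mul0r add0r.
Qed.

Lemma order2B f f' g g' : order2 f f' -> order2 g g' ->
  order2 (fun z => f z - g z) (fun z => f' z - g' z).
Proof.
move=> of_ /(order2Z (-1)); move=> /(order2D of_).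
by apply: eq_order2 => z; rewrite mulN1r.
Qed.

Lemma order2_affine (a b : R[i]) f f' : order2 f f' ->
  order2 (fun z => f (a * z + b)) (fun z => a * f' (a * z + b)).
Proof.
move=> [C [c [C0 c0 jf]]]; set s := 1 + normc a + normc b.
have a0 := normc_ge0 a; have b0 := normc_ge0 b.
exists (3 * (1 + normc a) ^+ 2 * C), (c * s ^+ 2); split.
- by rewrite mulr_ge0// mulr_ge0// sqr_ge0.
- by rewrite mulr_ge0// sqr_ge0.
move=> r r1; have r0 : 0 <= r by lra.
have rs : 1 <= s * r.
  by rewrite -[1]mulr1; apply: ler_pM => //; rewrite /s; lra.
rewrite -mulrA -(mulrA c) -exprMn mulrA.
rewrite -(mulrA _ C); apply: jet_subset (jet_affine a b (jf (s * r) rs)) => z /= zr.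
apply: (le_trans (normcD _ _)); rewrite normcM /s mulrDl mulrDl mul1r.
have h1 : normc a * normc z <= normc a * r by exact: ler_wpM2l.
have h2 : normc b * 1 <= normc b * r by exact: ler_wpM2l.
lra.
Qed.

Lemma jet_cexp_linear c r : 1 <= r ->
  jet (cball r) (fun z => cexp (c * z)) (fun z => c * cexp (c * z))
    (11 * expR (10 * normc c * r ^+ 2)).
Proof.
move=> r1; have n0 := normc_ge0 c; have r0 : 0 <= r by lra.
have := jetZ c (@jet_id _ (cball r) r (fun z h => h) r0) => jg.
apply: (@jetW _ _ _ _ (expR (normc c * r) * (11 * expR (4 * (normc c * (r + 1)))))).
  rewrite mulrCA; apply: ler_wpM2l => //; rewrite -expRD ler_expR.
  have -> : normc c * r + 4 * (normc c * (r + 1)) = normc c * (5 * r + 4) by ring.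
  rewrite (mulrC 10) -mulrA; apply: ler_wpM2l => //; rewrite expr2.
  have : r * 1 <= r * r by exact: ler_wpM2l.
  lra.
have := jet_cexp jg (expR_ge0 (normc c * r)).
have h w : cball r w -> normc (cexp (c * w)) <= expR (normc c * r).
  move=> /= wr; apply: (le_trans (normc_cexp_le _)); rewrite ler_expR normcM.
  exact: ler_wpM2l.
by move=> /(_ h); apply: eq_jet => z _; rewrite ?mulr1.
Qed.

Lemma order2_cexp c : order2 (fun z => cexp (c * z)) (fun z => c * cexp (c * z)).
Proof.
exists 11, (10 * normc c); split => //; first by rewrite mulr_ge0// normc_ge0.
by move=> r; exact: jet_cexp_linear.
Qed.

Lemma order2_character (w : R) :
  order2 (character w) (fun z => (0 +i* (2 * pi * w)) * character w z).
Proof. exact: order2_cexp. Qed.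

End order2.

(** * The kernel exp (- z^4) and its integrals *)

Section kernel.
Context (R : realType).
Local Notation mu := (@lebesgue_measure R).
Implicit Types (f : R[i] -> R[i]) (x y Y : R).

(* exp (- z^4) decays on horizontal lines faster than functions of order 2 grow. *)
Definition kern (z : R[i]) : R[i] := cexp (- z ^+ 4).
Definition kern' (z : R[i]) : R[i] := - (4 * z ^+ 3) * kern z.

(** Expanding around [x] in powers of [z - x], whose jet on the slab is bounded independently of
    [x], perturbs [- x ^+ 4] only by an amount of cubic growth. *)
Lemma kern_jet Y : 0 <= Y -> exists2 c : R, 0 <= c & forall x,
  jet [set z | `|complex.Re z - x| <= 1 /\ `|complex.Im z| <= Y] kern kern'
    (expR (c * (1 + `|x|) ^+ 3 - x ^+ 4)).
Proof.
move=> Y0; set B := 3 + Y; pose c0 := 15 * B ^+ 4 : R.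
have B1 : 1 <= B by rewrite /B; lra.
have B0 : 0 <= B by lra.
have c00 : 0 <= c0 by rewrite mulr_ge0// exprn_ge0.
exists (5 * c0 + 11); first by lra.
move=> x; set D := [set z | _].
have jz : jet D (fun z => z - x%:C) (fun=> 1) B.
  exists (1 + Y), 1, 0; split.
  - by split => //; rewrite /B; lra.
  - move=> w [w1 w2]; apply: (le_trans (normc_le_ReIm _)).
    by rewrite Re_B Im_B /= subr0 lerD.
  - by move=> w _; rewrite normc1.
  - move=> z w _ _ _; have -> : z - x%:C - (w - x%:C) = z - w by ring.
    by rewrite !mul1r lexx subrr normc0 mul0r.
have B_1 k : B ^+ k <= B ^+ 4 * B ^+ k.
  by rewrite ler_peMl ?exprn_ge0// -[1](expr1n _ 4) lerXn2r ?nnegrE.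
set X := 1 + `|x|; have X1 : 1 <= X by rewrite /X lerDl.
have X0 : 0 <= X by lra.
have xX : `|x| <= X by rewrite /X; lra.
have ck : forall n, (n <= 4)%N -> B ^+ n <= B ^+ 4.
  by move=> n n4; rewrite ler_weXn2l.
have xk : forall n, (n <= 3)%N -> `|x| ^+ n <= X ^+ 3.
  move=> n n3; apply: (@le_trans _ _ (X ^+ n)); first by rewrite lerXn2r ?nnegrE.
  by rewrite ler_weXn2l.
have jz2 := jetM jz jz; have jz3 := jetM jz2 jz; have jz4 := jetM jz3 jz.
have jg : jet D (fun z => x%:C ^+ 4 - z ^+ 4) (fun z => - (4 * z ^+ 3)) (c0 * X ^+ 3).
  (* Binomial formula z^4 - x^4 = h^4 + 4 x h^3 + 6 x^2 h^2 + 4 x^3 h with h = z - x; the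
     coefficients add up to the 15 in [c0]. *)
  have := jetN (jetD (jetD jz4 (jetZ (4 * x%:C) jz3)) (jetD (jetZ (6 * x%:C ^+ 2) jz2) (jetZ (4 * x%:C ^+ 3) jz))).
  move=> h; apply: jetW; last apply: eq_jet h; last 2 first.
  - by move=> z _; ring.
  - by move=> z _; ring.
  have -> : normc (4 * x%:C) = 4 * `|x| by rewrite normcM normcR normc_nat.
  have -> : normc (6 * x%:C ^+ 2) = 6 * `|x| ^+ 2.
    by rewrite normcM normcX normcR normc_nat.
  have -> : normc (4 * x%:C ^+ 3) = 4 * `|x| ^+ 3.
    by rewrite normcM normcX normcR normc_nat.
  have -> : c0 * X ^+ 3 = B ^+ 4 * X ^+ 3 + 4 * (X ^+ 3 * B ^+ 4) +
    (6 * (X ^+ 3 * B ^+ 4) + 4 * (X ^+ 3 * B ^+ 4)) by rewrite /c0; ring.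
  apply: lerD; apply: lerD.
  - have -> : B * B * B * B = B ^+ 4 * 1 by ring.
    by apply: ler_wpM2l; rewrite ?exprn_ge0// -(expr0 `|x|); exact: xk.
  - rewrite -[leLHS]mulrA ler_pM2l//; apply: ler_pM; rewrite ?mulr_ge0//.
      by rewrite -[leLHS]expr1; exact: (xk 1%N).
    by rewrite (_ : B * B * B = B ^+ 3) ?ck//; ring.
  - rewrite -[leLHS]mulrA ler_pM2l//; apply: ler_pM; rewrite ?mulr_ge0 ?exprn_ge0//.
      exact: xk.
    by rewrite (_ : B * B = B ^+ 2) ?ck.
  - rewrite -[leLHS]mulrA ler_pM2l//; apply: ler_pM; rewrite ?exprn_ge0//.
      exact: xk.
    by rewrite -{1}[B]expr1 ck.
have E0 := expR_ge0 (c0 * X ^+ 3).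
have := jetZ (expR (- x ^+ 4))%:C (jet_cexp jg E0 _) => h.
have /h {h} : forall w, D w -> normc (cexp (x%:C ^+ 4 - w ^+ 4)) <= expR (c0 * X ^+ 3).
  move=> w Dw; apply: (le_trans (normc_cexp_le _)); rewrite ler_expR.
  exact: jet_bound jg Dw.
have ke z : (expR (- x ^+ 4))%:C * cexp (x%:C ^+ 4 - z ^+ 4) = kern z.
  have -> : (expR (- x ^+ 4))%:C = cexp (- x%:C ^+ 4) :> R[i].
    have -> : - x%:C ^+ 4 = (- x ^+ 4)%:C :> R[i] by rewrite rmorphN rmorphXn.
    by rewrite /cexp /= cos0 sin0; apply: complex_eqP => /=; ring.
  by rewrite -cexpD /kern; congr cexp; ring.
move=> h; apply: jetW; last apply: eq_jet h; last 2 first.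
- by move=> z _; exact: ke.
- by move=> z _; rewrite /kern' -ke; ring.
rewrite normcR ger0_norm ?expR_ge0//.
have -> : (5 * c0 + 11) * X ^+ 3 - x ^+ 4 = - x ^+ 4 + (c0 * X ^+ 3 + (11 * X ^+ 3 + 4 * (c0 * X ^+ 3))) by ring.
rewrite !expRD; apply: ler_wpM2l; rewrite ?expR_ge0//.
apply: ler_wpM2l; rewrite ?expR_ge0//; apply: ler_wpM2r; rewrite ?expR_ge0//.
apply: (le_trans _ (le_mul_expR _)); rewrite -[leLHS]mulr1; apply: ler_wpM2l => //.
by rewrite -(expr0 `|x|); exact: xk.
Qed.

End kernel.

Section kernel_integrals.
Context (R : realType).
Local Notation mu := (@lebesgue_measure R).
Implicit Types (F : R[i] -> R[i]) (x y Y : R).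

(** For t = |x|: (1 + t)^3 <= 4 (1 + t^3) and t^2 <= 1 + t^3 give c (1 + t)^3 + t^2 <= a + a t^3
    with a = 4 c + 1, and a t^3 <= a^4 + t^4 by comparing t with a. *)
Lemma gauss_majorant (c : R) : 0 <= c -> exists2 K0 : R, 0 <= K0 &
  forall x, expR (c * (1 + `|x|) ^+ 3 - x ^+ 4) <= K0 * gauss_fun x.
Proof.
move=> c0; set a := 4 * c + 1; have a0 : 0 <= a by rewrite /a; lra.
exists (expR (a + a ^+ 4)); first exact: expR_ge0.
move=> x; rewrite /gauss_fun -expRD ler_expR.
have -> : x ^+ 4 = `|x| ^+ 4 by rewrite -normrX ger0_norm// exprn_even_ge0.
have -> : x ^+ 2 = `|x| ^+ 2 by rewrite -normrX ger0_norm// sqr_ge0.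
have t0 := normr_ge0 x; move: (`|x|) t0 => t t0.
have h1 : (1 + t) ^+ 3 <= 4 * (1 + t ^+ 3).
  have e : 4 * (1 + t ^+ 3) - (1 + t) ^+ 3 = 3 * ((1 + t) * (1 - t) ^+ 2) by ring.
  rewrite -subr_ge0 e; apply: mulr_ge0 => //; apply: mulr_ge0; last exact: sqr_ge0.
  lra.
have t3 : 0 <= t ^+ 3 by rewrite exprn_ge0.
have h2 : t ^+ 2 <= 1 + t ^+ 3.
  have [t1|t1] := leP t 1.
    have : t ^+ 2 <= 1 by rewrite exprn_ile1.
    lra.
  have : t ^+ 2 <= t ^+ 3 by rewrite ler_weXn2l// ltW.
  lra.
have h3 : a * t ^+ 3 <= a ^+ 4 + t ^+ 4.
  have [ta|ta] := leP t a.
    have : a * t ^+ 3 <= a * a ^+ 3 by apply: ler_wpM2l => //; rewrite lerXn2r ?nnegrE.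
    have : 0 <= t ^+ 4 by rewrite exprn_ge0.
    rewrite -exprS; lra.
  have : a * t ^+ 3 <= t * t ^+ 3 by apply: ler_wpM2r => //; exact: ltW.
  have : 0 <= a ^+ 4 by rewrite exprn_ge0.
  rewrite -exprS; lra.
have h4 : c * (1 + t) ^+ 3 <= c * (4 * (1 + t ^+ 3)) by apply: ler_wpM2l.
have h5 : c * (4 * (1 + t ^+ 3)) + (1 + t ^+ 3) = a + a * t ^+ 3 by rewrite /a; ring.
lra.
Qed.

Lemma integrable_gauss (K0 : R) :
  mu.-integrable setT (EFin \o (fun x => K0 * gauss_fun x)).
Proof. by apply: eq_integrable (integrableZl measurableT K0 (@integrableT_gauss R)). Qed.

Definition slab Y x : set R[i] :=
  [set z | `|complex.Re z - x| <= 1 /\ `|complex.Im z| <= Y].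

Lemma order2_kern_jet F (F' : R[i] -> R[i]) Y : 0 <= Y -> order2 F F' -> exists2 K0 : R, 0 <= K0 &
  forall x, jet (slab Y x) (fun z => F z * kern z)
    (fun z => F' z * kern z + F z * kern' z) (K0 * gauss_fun x).
Proof.
move=> Y0 [C [c [C0 c0 jF]]]; have [e e0 jk] := kern_jet Y0.
set B := 2 + Y; have B0 : 0 <= B by rewrite /B; lra.
have ce0 : 0 <= c * B ^+ 2 + e by rewrite addr_ge0// mulr_ge0// sqr_ge0.
have [K0 K00 hK] := gauss_majorant ce0.
exists (C * K0); first exact: mulr_ge0.
move=> x; set X := 1 + `|x|; have X1 : 1 <= X by rewrite /X lerDl.
have rx : 1 <= B * X by rewrite -[1]mulr1; apply: ler_pM => //; rewrite /B; lra.
have jF' : jet (slab Y x) F F' (C * expR (c * (B * X) ^+ 2)).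
  apply: jet_subset (jF _ rx) => z [z1 z2]; apply: (le_trans (normc_le_ReIm _)).
  have z3 : `|complex.Re z| <= 1 + `|x|.
    have -> : complex.Re z = (complex.Re z - x) + x by rewrite subrK.
    by apply: (le_trans (ler_normD _ _)); rewrite lerD2r.
  have : (1 + Y) * 1 <= (1 + Y) * X by apply: ler_wpM2l => //; lra.
  rewrite /B /X in z3 *; lra.
apply: jetW (jetM jF' (jk x)).
rewrite -[leLHS]mulrA -[leRHS]mulrA; apply: ler_wpM2l => //.
apply: le_trans (hK x); rewrite -expRD ler_expR -/X.
have : c * (B * X) ^+ 2 <= c * B ^+ 2 * X ^+ 3.
  rewrite exprMn mulrA; apply: ler_wpM2l; first by rewrite mulr_ge0// sqr_ge0.
  by rewrite ler_weXn2l.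
lra.
Qed.

Lemma slab_mem Y z : `|complex.Im z| <= Y -> slab Y (complex.Re z) z.
Proof. by move=> h; split => //; rewrite subrr normr0. Qed.

Lemma slab_near Y z w : `|complex.Im z| <= Y -> normc (z - w) <= 1 ->
  slab Y (complex.Re w) z.
Proof.
by move=> h zw; split => //; apply: le_trans zw; rewrite -Re_B; exact: Re_le_normc.
Qed.

Lemma ccontinuous_kern F (F' : R[i] -> R[i]) y : order2 F F' ->
  ccontinuous (fun x => F (x +i* y) * kern (x +i* y)).
Proof.
move=> oF; have [K0 K00 j] := order2_kern_jet (normr_ge0 y) oF.
apply: ccontinuous_lip => x; exists 1, (K0 * gauss_fun x); split => // t tx.
have e : (t +i* y) - (x +i* y) = (t - x)%:C.
  by apply: complex_eqP; rewrite /= ?subrr.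
have sx : slab `|y| x (x +i* y) by exact: (@slab_mem _ (x +i* y)).
have st : slab `|y| x (t +i* y).
  by apply: (@slab_near _ _ (x +i* y)) => //; rewrite e normcR ltW.
by have := jet_lip (j x) st sx; rewrite e normcR; apply; exact: ltW.
Qed.

Lemma cintegrable_kern F (F' : R[i] -> R[i]) y : order2 F F' ->
  cintegrable mu (fun x => F (x +i* y) * kern (x +i* y)).
Proof.
move=> oF; have [K0 K00 j] := order2_kern_jet (normr_ge0 y) oF.
apply: cintegrable_dom (integrable_gauss K0) _.
  exact/ccontinuous_measurable/(ccontinuous_kern _ oF).
by move=> x; apply: jet_bound (j x) _; exact: (@slab_mem _ (x +i* y)).
Qed.

(** The contour shift: [order2_kern_jet] provides one Gaussian majorant for the whole slab between
    the two lines, as [line_integral_const] requires. *)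
Lemma kern_line F (F' : R[i] -> R[i]) y : order2 F F' ->
  cintegral mu (fun x => F (x +i* y) * kern (x +i* y)) =
  cintegral mu (fun x => F (x +i* 0) * kern (x +i* 0)).
Proof.
move=> oF; have [K0 K00 j] := order2_kern_jet (normr_ge0 y) oF.
apply: (@line_integral_const _ (fun z => F z * kern z)
  (fun z => F' z * kern z + F z * kern' z) `|y| (fun x => K0 * gauss_fun x)).
- exact: integrable_gauss.
- by move=> t _; exact: ccontinuous_kern oF.
- by move=> z zy; apply: jet_bound (j _) _; exact: slab_mem.
- move=> z w zy wy zw; apply: (jet_rem (j _)) => //; last exact: slab_mem.
  exact: slab_near.
- by [].
- by rewrite normr0.
Qed.

Definition kern_mass : R[i] := cintegral mu (fun x => kern (x +i* 0)).

Lemma kern_real x : kern (x +i* 0) = (expR (- x ^+ 4))%:C.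
Proof.
have -> : x +i* 0 = x%:C by [].
have -> : kern x%:C = cexp ((- x ^+ 4)%:C) by rewrite /kern rmorphN rmorphXn.
by rewrite /cexp /= cos0 sin0; apply: complex_eqP => /=; ring.
Qed.

Lemma order2_1 : order2 (fun=> 1 : R[i]) (fun=> 0 : R[i]).
Proof. exact: order2_cst. Qed.

Lemma cintegrable_kern1 : cintegrable mu (fun x => kern (x +i* 0)).
Proof.
by have := cintegrable_kern 0 order2_1; under eq_fun do rewrite mul1r.
Qed.

(** On the real axis the kernel is positive, and at least [expR (-1)] on [0, 1]. *)
Lemma kern_mass_neq0 : kern_mass != 0.
Proof.
suff p : 0 < \int[mu]_x complex.Re (kern (x +i* 0)).
  by apply/eqP => e; move: p; rewrite -[X in 0 < X]/(complex.Re kern_mass) e ltxx.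
apply: (@lt_le_trans _ _ (\int[mu]_x (expR (-1) * \1_(`[0, 1]%classic) x))).
  rewrite RintegralZl//; last exact: integrable_indic_itv.
  rewrite mulr_gt0 ?expR_gt0// /Rintegral integral_indic//= setIT.
  by rewrite lebesgue_measure_itv/= lte_fin ltr01 oppr0 adde0.
apply: le_Rintegral => //.
- apply: eq_integrable (integrableZl measurableT (expR (-1)) (integrable_indic_itv 0 1 true false)) => //.
- by have [] := cintegrable_kern1.
- move=> x _; rewrite kern_real /= indicE; case: (boolP (x \in _)) => h; last first.
    by rewrite mulr0 expR_ge0.
  rewrite mulr1 ler_expR lerN2; move: h => /set_mem; rewrite /= in_itv /= => /andP[x0 x1].
  by rewrite exprn_ile1.
Qed.

Lemma character_half : character (2^-1 : R) 1 = -1.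
Proof.
rewrite /character mulr1 /cexp /= expR0.
have -> : 2 * pi / 2 = pi :> R by rewrite mulrAC divff// mul1r.
by rewrite cospi sinpi; apply: complex_eqP => /=; ring.
Qed.

Definition kern_hat (m : R) : R[i] :=
  cintegral mu (fun x => character m (x +i* 0) * kern (x +i* 0)).

Lemma kern_hat0 : kern_hat 0 = kern_mass.
Proof. by apply: eq_cintegral => x; rewrite character0 mul1r. Qed.

(* Riemann-Lebesgue: a shift by half a period changes the sign of the
   oscillating factor. *)
Lemma kern_hat_le : exists2 B : R, 0 <= B &
  forall m : R, 1 <= `|m| -> normc (kern_hat m) <= B / `|m|.
Proof.
have [K0 K00 j] := order2_kern_jet (lexx 0) order2_1.
pose B := \int[mu]_x (K0 * gauss_fun x).
have B0 : 0 <= B.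
  by apply: Rintegral_ge0 => x _; rewrite mulr_ge0// gauss_fun_ge0.
exists B => // m m1; have m0 : m != 0 by rewrite -normr_gt0 (lt_le_trans ltr01).
have n0 : 0 < `|m| by rewrite normr_gt0.
(* Half a period of [character m]; the lower bound 1 on the modulus of [m] keeps it within the range
   of [jet_lip]. *)
pose s := (2 * m)^-1.
have s1 : `|s| <= `|m|^-1.
  rewrite /s normfV normrM gtr0_norm// invfM.
  rewrite ler_piMl ?invr_ge0//; lra.
have s2 : `|s| <= 1 by apply: (le_trans s1); rewrite invf_le1.
pose f x := character m (x +i* 0) * kern (x +i* 0).
have cf : ccontinuous f := ccontinuous_kern 0 (order2_character m).
have jf : cintegrable mu f := cintegrable_kern 0 (order2_character m).
have jf' := cintegrable_shift s cf jf.
have fs x : f x + f (x + s) =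
    character m (x +i* 0) * (kern (x +i* 0) - kern ((x + s) +i* 0)).
  rewrite /f; have -> : (x + s) +i* 0 = (x +i* 0) + s%:C.
    by apply: complex_eqP => /=; rewrite ?addr0.
  rewrite character_Dr.
  have -> : character m s%:C = -1.
    rewrite -character_half /character; congr cexp.
    apply: complex_eqP => /=; rewrite /s; field => //.
  ring.
have E : 2 * kern_hat m = cintegral mu (fun x => f x + f (x + s)).
  by rewrite cintegralD// cintegral_shift// -/(kern_hat m); ring.
have : normc (2 * kern_hat m) <= \int[mu]_x (`|m|^-1 * (K0 * gauss_fun x)).
  rewrite E; apply: normc_cintegral_le.
  - exact: cintegrableD.
  - by apply: eq_integrable (integrableZl measurableT `|m|^-1 (integrable_gauss K0)).
  - move=> x; rewrite fs normcM normc_character /= mulr0 oppr0 expR0 mul1r.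
    have e : (x +i* 0) - ((x + s) +i* 0) = (- s)%:C.
      by apply: complex_eqP; rewrite /= ?subrr//; ring.
    have sx : slab 0 x (x +i* 0).
      by apply: (@slab_mem _ (x +i* 0)); rewrite /= normr0.
    have st : slab 0 x ((x + s) +i* 0).
      apply: (@slab_near _ _ (x +i* 0)); first by rewrite /= normr0.
      by rewrite normcBC e normcR normrN.
    have := jet_lip (j x) sx st; rewrite e normcR normrN !mul1r => /(_ s2) h.
    apply: (le_trans h); rewrite mulrC; apply: ler_wpM2r => //.
    by rewrite mulr_ge0// gauss_fun_ge0.
rewrite RintegralZl//; last exact: integrable_gauss.
rewrite -/B normcM normc_nat mulrC => h.
have k0 := normc_ge0 (kern_hat m); rewrite mulrC.
by rewrite mulr_natr mulr2n in h; lra.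
Qed.

End kernel_integrals.

Section sum_integral.
Context d (T : measurableType d) (R : realType) (mu : {measure set T -> \bar R}).

Lemma cmeasurable_sum (f : nat -> T -> R[i]) N : (forall n, cmeasurable (f n)) ->
  cmeasurable (fun x => \sum_(n < N) f n x).
Proof.
move=> mf; split; (under eq_fun do rewrite ?Re_sum ?Im_sum);
  by apply: measurable_sum => i; have [] := mf i.
Qed.

(** Partial sums are dominated by the integrable function [B * K], so dominated convergence
    exchanges integral and sum. *)
Lemma cintegral_csum (f : nat -> T -> R[i]) (g : nat -> R) (K : T -> R) B :
  (forall n, cmeasurable (f n)) -> cmeasurable (fun x => csum (f ^~ x)) ->
  mu.-integrable setT (EFin \o K) -> (forall x, 0 <= K x) ->
  (forall n x, normc (f n x) <= g n * K x) -> sum_le g B ->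
  (forall n, 0 <= g n) ->
  csummable (fun n => cintegral mu (f n)) /\
  cintegral mu (fun x => csum (f ^~ x)) = csum (fun n => cintegral mu (f n)).
Proof.
move=> mf ms iK K0 fg gB g0.
have ig n : mu.-integrable setT (EFin \o (fun x => g n * K x)).
  by apply: eq_integrable (integrableZl measurableT (g n) iK).
have jf n : cintegrable mu (f n) by apply: cintegrable_dom (ig n) _.
have sI : csummable (fun n => cintegral mu (f n)).
  have I0 : 0 <= \int[mu]_x K x by apply: Rintegral_ge0.
  apply: (@csummable_dom _ _ (fun n => g n * \int[mu]_x K x) (B * \int[mu]_x K x)).
    by move=> n; rewrite -RintegralZl//; apply: normc_cintegral_le.
  by move=> N; rewrite -mulr_suml; apply: ler_wpM2r.
split => //; apply: ccvg_unique (csum_ccvg sI).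
apply: (@eq_ccvg _ (fun N => cintegral mu (fun x => \sum_(n < N) f n x))).
  by move=> N; rewrite cintegral_sum.
have iB : mu.-integrable setT (EFin \o (fun x => B * K x)).
  by apply: eq_integrable (integrableZl measurableT B iK).
apply: (cdominated_cvg _ _ iB) => //.
- by move=> N; exact: cmeasurable_sum.
- move=> N x; apply: (le_trans (normc_sum _ _ _)).
  apply: (@le_trans _ _ (\sum_(n < N) g n * K x)); first exact: ler_sum.
  by rewrite -mulr_suml; apply: ler_wpM2r.
- move=> x; apply: csum_ccvg; apply: (csummable_dom (g := fun n => g n * K x) (B := B * K x)).
    by move=> n; exact: fg.
  by move=> N; rewrite -mulr_suml; apply: ler_wpM2r.
Qed.

End sum_integral.

(** * Mean values and the identity principle for functions of order 2 *)

Section coefficients.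
Context (R : realType).
Local Notation mu := (@lebesgue_measure R).
Implicit Types (F : R[i] -> R[i]) (x y Y : R).

Lemma character_scale (w T : R) z : character w (T%:C * z) = character (w * T) z.
Proof.
have e : (0 +i* (2 * pi * w)) * T%:C = 0 +i* (2 * pi * (w * T)) :> R[i].
  by apply: complex_eqP; rewrite ?Re_M ?Im_M /=; ring.
by rewrite /character (mulrA (0 +i* (2 * pi * w)) T%:C z) e.
Qed.

Lemma kern_line_bound (y : R) : exists2 K0 : R, 0 <= K0 &
  forall x t, `|t| <= `|y| -> normc (kern (x +i* t)) <= K0 * gauss_fun x.
Proof.
have [K0 K00 j] := order2_kern_jet (normr_ge0 y) (order2_1 R).
exists K0 => // x t ty; have := jet_bound (j x) (@slab_mem _ _ (x +i* t) ty).
by rewrite mul1r.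
Qed.

Lemma harmonic_bound (e : R) : 0 < e -> exists N, forall k, (N <= k)%N -> 1 / k.+1%:R < e.
Proof.
move=> e0; exists (Num.truncn (1 / e)) => k hk.
rewrite ltr_pdivrMr ?ltr0n// mulrC -ltr_pdivrMr//.
by apply: (lt_le_trans (truncnS_gt _)); rewrite ler_nat ltnS.
Qed.

Lemma kern_hat_cvg (m : R) : m != 0 -> ccvg (fun k : nat => kern_hat (m * k.+1%:R)) 0.
Proof.
move=> m0; have [B B0 hB] := kern_hat_le R; apply/ccvgP => e e0.
have n0 : 0 < `|m| by rewrite normr_gt0.
have q0 : 0 < Num.min `|m| (e * `|m| / (B + 1)).
  by rewrite lt_min n0 divr_gt0// ?mulr_gt0//; lra.
have [N hN] := harmonic_bound q0; exists N => k /hN; rewrite lt_min => /andP[h1 h2].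
have k0 : 0 < k.+1%:R :> R by rewrite ltr0n.
have nk : `|m * k.+1%:R| = `|m| * k.+1%:R by rewrite normrM (ger0_norm (ltW k0)).
rewrite subr0; apply: (le_lt_trans (hB _ _)).
  by rewrite nk; move: h1; rewrite ltr_pdivrMr// => /ltW.
rewrite nk ltr_pdivrMr; last by rewrite mulr_gt0.
move: h2; rewrite ltr_pdivrMr// mulrAC ltr_pdivlMr; last lra.
by rewrite mul1r -mulrA; lra.
Qed.

(** An unnormalised Bohr mean of F times e^{- 2 pi i w z}: rescaling the argument by [k.+1] amounts
    to spreading the kernel over a length of that order. *)
Definition mean_seq F (w : R) (k : nat) : R[i] :=
  cintegral mu (fun x => F (k.+1%:R * x +i* 0) * character (- w) (k.+1%:R * x +i* 0) *
     kern (x +i* 0)).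

(* The mean of F against the kernel can be computed on any horizontal line,
   where the Dirichlet expansion may be integrated term by term. *)
Lemma mean_seq_cvg F (F' : R[i] -> R[i]) (c : nat -> R[i]) (om : nat -> R) y B w :
  order2 F F' ->
  sum_le (fun n => normc (c n) * expR (- (2 * pi * om n * y))) B ->
  (forall x, F (x +i* y) = csum (fun n => c n * character (om n) (x +i* y))) ->
  ccvg (mean_seq F w) (csum (fun n => if om n == w then c n else 0) * kern_mass R).
Proof.
move=> oF cB FE.
have sw : csummable (fun n => if om n == w then c n else 0).
  apply: (@csummable_dom _ _ (fun n => expR (2 * pi * w * y) * (normc (c n) * expR (- (2 * pi * om n * y)))) (expR (2 * pi * w * y) * B)).
    move=> n; case: eqVneq => [->|_]; last first.
      by rewrite normc0 !mulr_ge0 ?expR_ge0 ?normc_ge0.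
    by rewrite mulrCA -expRD subrr expR0 mulr1.
  by move=> N; rewrite -mulr_sumr; apply: ler_wpM2l; rewrite ?expR_ge0.
have [K0 K00 hK] := kern_line_bound y.
(* The rescaling carries the line of height [t k] to that of height [y], where the expansion holds.
   These heights are bounded by that of [y] in modulus, so one Gaussian majorant serves every
   [k]. *)
pose t (k : nat) : R := y / k.+1%:R.
have kp (k : nat) : 0 < k.+1%:R :> R by rewrite ltr0n.
have ty k : `|t k| <= `|y|.
  rewrite /t normrM ler_piMr// normfV invf_le1 ?normr_gt0 ?gt_eqF//.
  by rewrite ger0_norm ?ler1n// ltW.
have scl k x u : k.+1%:R%:C * (x +i* u) = (k.+1%:R * x) +i* (k.+1%:R * u) :> R[i].
  by apply: complex_eqP => /=; ring.
have kt k : k.+1%:R * t k = y by rewrite /t mulrC divfK// gt_eqF.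
pose f k n x := (c n * character (om n - w) (k.+1%:R * x +i* y)) * kern (x +i* t k).
pose J := \int[mu]_x (K0 * gauss_fun x).
have fb k n x : normc (f k n x) <=
    (expR (2 * pi * w * y) * (normc (c n) * expR (- (2 * pi * om n * y)))) * (K0 * gauss_fun x).
  rewrite /f normcM; apply: ler_pM; rewrite ?normc_ge0//; last by apply: hK; exact: ty.
  rewrite normcM normc_character mulrCA; apply: ler_wpM2l; first exact: normc_ge0.
  by rewrite /= -expRD ler_expR le_eqVlt; apply/orP; left; apply/eqP; ring.
have ochar k n := order2_affine (k.+1%:R%:C) 0 (order2_character (om n - w)).
have fE k n x : f k n x = c n * (character (om n - w) (k.+1%:R%:C * (x +i* t k) + 0) * kern (x +i* t k)).
  by rewrite /f scl kt addr0 mulrA.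
have fm k n : @cmeasurable _ (measurableTypeR R) R (f k n).
  rewrite (_ : f k n = (fun x => c n * (character (om n - w)
    (k.+1%:R%:C * (x +i* t k) + 0) * kern (x +i* t k)))); last exact/funext.
  apply: (@cintegrable_measurable _ _ _ mu); apply: cintegrableZ.
  exact: cintegrable_kern (ochar k n).
(* Each single term is moved back to the real axis, where it is a Fourier transform of the kernel at
   a frequency that grows with [k] unless [om n = w]. *)
have fI k n : cintegral mu (f k n) = c n * kern_hat ((om n - w) * k.+1%:R).
  transitivity (cintegral mu (fun x => c n * (character (om n - w) (k.+1%:R%:C * (x +i* t k) + 0) * kern (x +i* t k)))).
    by apply: eq_cintegral => x; rewrite fE.
  rewrite cintegralZ; last exact: cintegrable_kern (ochar k n).
  congr (_ * _); rewrite (kern_line (t k) (ochar k n)).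
  by apply: eq_cintegral => x; rewrite addr0 character_scale.
have oG k := order2_affine (k.+1%:R%:C) 0 (order2M oF (order2_character (- w))).
have mE k : mean_seq F w k = cintegral mu (fun x => csum ((f k) ^~ x)).
  transitivity (cintegral mu (fun x => F (k.+1%:R%:C * (x +i* 0) + 0) *
     character (- w) (k.+1%:R%:C * (x +i* 0) + 0) * kern (x +i* 0))).
    by apply: eq_cintegral => x; rewrite scl mulr0 addr0.
  rewrite -(kern_line (t k) (oG k)); apply: eq_cintegral => x.
  rewrite addr0 scl kt FE -mulrA mulrC -csumZ; last first.
    apply: csummable_dom cB => n.
    by rewrite normcM normc_character.
  apply: eq_csum => n; rewrite /f (addrC (om n)) characterD; ring.
have sg : sum_le (fun n => expR (2 * pi * w * y) * (normc (c n) * expR (- (2 * pi * om n * y))))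
   (expR (2 * pi * w * y) * B).
  by move=> N; rewrite -mulr_sumr; apply: ler_wpM2l; rewrite ?expR_ge0.
have gp n : 0 <= expR (2 * pi * w * y) * (normc (c n) * expR (- (2 * pi * om n * y))).
  by rewrite !mulr_ge0 ?expR_ge0 ?normc_ge0.
have sm k : @cmeasurable _ (measurableTypeR R) R (fun x => csum ((f k) ^~ x)).
  have := cintegrable_measurable (cintegrable_kern (t k) (oG k)).
  congr cmeasurable; apply/funext => x.
  rewrite addr0 scl kt FE -mulrA mulrC -csumZ; last first.
    apply: csummable_dom cB => n.
    by rewrite normcM normc_character.
  apply: eq_csum => n; rewrite /f (addrC (om n)) characterD; ring.
have g0 x : 0 <= K0 * gauss_fun x by rewrite mulr_ge0// gauss_fun_ge0.
have sumI k := cintegral_csum (fm k) (sm k) (integrable_gauss K0) g0 (fb k) sg gp.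
apply: (@eq_ccvg _ (fun k => csum (fun n => cintegral mu (f k n)))).
  by move=> k; rewrite mE (sumI k).2.
have -> : csum (fun n => if om n == w then c n else 0) * kern_mass R =
   csum (fun n => kern_mass R * (if om n == w then c n else 0)).
  by rewrite csumZ// mulrC.
apply: (@csum_tannery _ _ _ (fun n => expR (2 * pi * w * y) * (normc (c n) * expR (- (2 * pi * om n * y))) * J) (expR (2 * pi * w * y) * B * J)).
- move=> k n; rewrite -RintegralZl//; last exact: integrable_gauss.
  apply: normc_cintegral_le => //.
  + apply: cintegrable_dom (fm k n) _ (fb k n).
    by apply: eq_integrable (integrableZl measurableT _ (integrable_gauss K0)).
  + by apply: eq_integrable (integrableZl measurableT _ (integrable_gauss K0)).
- have J0 : 0 <= J by apply: Rintegral_ge0 => x _; exact: g0.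
  by move=> N; rewrite -mulr_suml; apply: ler_wpM2r => //; exact: sg.
- move=> n; apply: (@eq_ccvg _ (fun k => c n * kern_hat ((om n - w) * k.+1%:R))).
    by move=> k; rewrite fI.
  case: eqVneq => [->|nw].
    rewrite mulrC; apply: (@eq_ccvg _ (fun=> c n * kern_mass R)); last exact: ccvg_cst.
    by move=> k; rewrite subrr mul0r kern_hat0.
  rewrite mulr0 -(mulr0 (c n)); apply: ccvgZ; apply: kern_hat_cvg.
  by rewrite subr_eq0.
Qed.

(** The dilates [F (T k * z + z0)] are averaged against the kernel. The average may be computed on
    any horizontal line, in particular on the one mapped to height [Y], so it is 0; as [T k] tends
    to 0 it also tends to [F z0 * kern_mass R]. *)
Lemma order2_eq0 F (F' : R[i] -> R[i]) Y : order2 F F' ->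
  (forall x, F (x +i* Y) = 0) -> forall z, F z = 0.
Proof.
move=> oF F0 z0.
pose T (k : nat) : R := k.+1%:R^-1.
have T0 k : 0 < T k by rewrite invr_gt0 ltr0n.
have T1 k : T k <= 1 by rewrite invf_le1 ?ltr0n// ler1n.
have oG k := order2_affine (T k)%:C z0 oF.
have I0 k : cintegral mu (fun x => F ((T k)%:C * (x +i* 0) + z0) * kern (x +i* 0)) = 0.
  (* The height that the dilation about [z0] carries to [Y]. *)
  rewrite -(kern_line ((Y - complex.Im z0) / T k) (oG k)).
  transitivity (cintegral mu (fun x => 0 : R[i])).
    apply: eq_cintegral => x.
    have -> : (T k)%:C * (x +i* ((Y - complex.Im z0) / T k)) + z0 =
        (T k * x + complex.Re z0) +i* Y.
      apply: complex_eqP; rewrite ?Re_D ?Im_D /=; first by ring.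
      by field; rewrite gt_eqF.
    by rewrite F0 mul0r.
  by apply: complex_eqP; rewrite /= /Rintegral integral0.
have [C [c [C0 c0 jF]]] := oF.
set s := normc z0 + 2; have n0 := normc_ge0 z0.
have [e e0 jk] := kern_jet (lexx (0 : R)).
have ce : 0 <= c * s ^+ 2 + e by rewrite addr_ge0// mulr_ge0// sqr_ge0.
have [K0 K00 hK] := gauss_majorant ce.
have lim : ccvg (fun k => cintegral mu (fun x => F ((T k)%:C * (x +i* 0) + z0) * kern (x +i* 0)))
    (cintegral mu (fun x => F z0 * kern (x +i* 0))).
  apply: (cdominated_cvg _ _ (integrable_gauss (C * K0))).
  - by move=> k; exact: (cintegrable_measurable (cintegrable_kern 0 (oG k))).
  - exact: (cintegrable_measurable (cintegrableZ (F z0) (cintegrable_kern1 R))).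
  - move=> k x; rewrite normcM -mulrA.
    set X := 1 + `|x|; have X1 : 1 <= X by rewrite /X lerDl.
    have sX : 1 <= s * X by rewrite -[1]mulr1; apply: ler_pM => //; rewrite /s; lra.
    have h1 : normc (F ((T k)%:C * (x +i* 0) + z0)) <= C * expR (c * (s * X) ^+ 2).
      apply: jet_bound (jF _ sX) _; apply: (le_trans (normcD _ _)).
      rewrite normcM normcR (ger0_norm (ltW (T0 k))) -[x +i* 0]/(x%:C) normcR.
      have : T k * `|x| <= 1 * `|x| by apply: ler_wpM2r.
      have : normc z0 * 1 <= normc z0 * X by apply: ler_wpM2l.
      have := normr_ge0 x; rewrite /s /X; lra.
    have h2 : normc (kern (x +i* 0)) <= expR (e * X ^+ 3 - x ^+ 4).
      apply: jet_bound (jk x) _; split; rewrite /= ?subrr normr0//.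
    apply: (le_trans (ler_pM _ _ h1 h2)); rewrite ?normc_ge0//.
    rewrite -mulrA; apply: ler_wpM2l => //; apply: le_trans (hK x).
    rewrite -expRD ler_expR -/X.
    have : c * (s * X) ^+ 2 <= c * s ^+ 2 * X ^+ 3.
      rewrite exprMn mulrA; apply: ler_wpM2l; first by rewrite mulr_ge0// sqr_ge0.
      by rewrite ler_weXn2l.
    lra.
  - move=> x; rewrite mulrC; apply: eq_ccvg (fun k => mulrC _ _) _.
    apply: ccvgZ; apply/ccvgP => eps eps0.
    set r := normc z0 + 1; have r1 : 1 <= r by rewrite /r lerDr.
    set M := C * expR (c * r ^+ 2).
    have M0 : 0 <= M by rewrite mulr_ge0// expR_ge0.
    have x1 : 0 < `|x| + 1 by have := normr_ge0 x; lra.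
    have q0 : 0 < Num.min (`|x| + 1)^-1 (eps / ((M + 1) * (`|x| + 1))).
      by rewrite lt_min invr_gt0 x1/= divr_gt0// mulr_gt0//; lra.
    have [N hN] := harmonic_bound q0; exists N => k /hN.
    rewrite div1r -/(T k) lt_min => /andP[h1 h2].
    have nx : normc ((T k)%:C * (x +i* 0)) = T k * `|x|.
      by rewrite normcM normcR (ger0_norm (ltW (T0 k))) -[x +i* 0]/(x%:C) normcR.
    have tx : T k * (`|x| + 1) < 1 by rewrite -ltr_pdivlMr// div1r.
    have tx1 : T k * `|x| <= 1 by have := T0 k; lra.
    have := jet_lip (jF r r1) (z := (T k)%:C * (x +i* 0) + z0) (w := z0).
    rewrite addrK nx -/M => h; apply: (le_lt_trans (h _ _ tx1)).
    + by rewrite /= (le_trans (normcD _ _))// nx /r addrC lerD2l.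
    + by rewrite /= /r lerDl.
    + have t1 : T k * ((M + 1) * (`|x| + 1)) < eps by rewrite -ltr_pdivlMr// mulr_gt0//; lra.
      apply: le_lt_trans t1; rewrite mulrCA; apply: ler_wpM2l; first exact: ltW.
      apply: ler_pM => //; lra.
have : F z0 * kern_mass R = 0.
  rewrite -cintegralZ; last exact: cintegrable_kern1.
  by apply: ccvg_unique lim _; apply: eq_ccvg (ccvg_cst 0) => k; rewrite I0.
by move/eqP; rewrite mulf_eq0 (negbTE (kern_mass_neq0 R)) orbF => /eqP.
Qed.

End coefficients.

(** * Enumerations and Dirichlet series *)

Section enumeration.
Context (I : choiceType).

(* A partial enumeration: the n-th item is e n when v n holds. *)
Definition enumerates (D : set I) (e : nat -> I) (v : nat -> bool) :=
  [/\ forall n, v n -> D (e n),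
      forall n m, v n -> v m -> e n = e m -> n = m &
      forall i, D i -> exists2 n, v n & e n = i].

Lemma countable_enumerates (D : set I) (i0 : I) : countable D ->
  exists e v, enumerates D e v.
Proof.
move=> /countable_injP[f fi].
pose P n i := D i /\ f i = n.
pose e n := if pselect (exists i, P n i) is left h then projT1 (cid h) else i0.
pose v n := `[< exists i, P n i >].
have ve n : v n -> P n (e n).
  by move=> /asboolP h; rewrite /e; case: pselect => // h'; exact: (projT2 (cid h')).
exists e, v; split.
- by move=> n /ve [].
- by move=> n m /ve[_ h1] /ve[_ h2] eE; rewrite -h1 -h2 eE.
- move=> i Di; exists (f i); first by apply/asboolP; exists i.
  have /ve[De fe] : v (f i) by apply/asboolP; exists i.
  by apply: fi => //; exact: mem_set.
Qed.

Variables (D : set I) (e : nat -> I) (v : nat -> bool).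
Hypothesis eD : enumerates D e v.

Lemma big_enumerates (V : nmodType) (G : I -> V) (X : {fset I}) N :
  (forall i, i \in X -> D i -> exists2 n : nat, v n & (n < N)%N /\ e n = i) ->
  \sum_(i <- X) (if i \in D then G i else 0) =
  \sum_(n < N) (if v n && (e n \in X) then G (e n) else 0).
Proof.
have [vD vi _] := eD => XN.
transitivity (\sum_(i <- X) \sum_(n < N) (if v n && (e n == i) then G i else 0)).
  rewrite big_seq [RHS]big_seq; apply: eq_bigr => i iX.
  case: (boolP (i \in D)) => iD; last first.
    rewrite big1// => n _; case: ifP => // /andP[/vD vn /eqP ei].
    by move: iD; rewrite -ei mem_set//; exact: vn.
  have [n vn [nN en]] := XN i iX (set_mem iD).
  rewrite (bigD1 (Ordinal nN))//= vn en eqxx /= big1 ?addr0// => m mn.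
  case: ifP => // /andP[vm /eqP em]; move: mn; rewrite -val_eqE /=.
  by rewrite (vi m n)// ?eqxx// em en.
rewrite exchange_big /=; apply: eq_bigr => n _.
case: (boolP (v n)) => vn /=; last by rewrite big1.
case: ifP => enX.
  rewrite (big_fsetD1 (e n))//= eqxx big1_fset ?addr0// => i.
  by rewrite !inE => /andP[/negbTE]; rewrite eq_sym => ->.
rewrite big_seq big1// => i iX; case: eqP => // ei.
by move: iX; rewrite -ei enX.
Qed.

Lemma enumerates_bound (X : {fset I}) : exists N, forall M, (N <= M)%N ->
  forall i, i \in X -> D i -> exists2 n : nat, v n & (n < M)%N /\ e n = i.
Proof.
have [_ _ De] := eD.
have /choice[g hg] : forall i, exists n, D i -> v n /\ e n = i.
  move=> i; case: (pselect (D i)) => [/De[n vn en]|nD]; first by exists n.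
  by exists 0%N.
exists (\max_(i : X) g (val i)).+1 => M hM i iX Di.
have [vn en] := hg i Di; exists (g i) => //; split => //.
apply: leq_trans hM; rewrite ltnS.
exact: (@leq_bigmax _ (fun i : X => g (val i)) (FSetSub iX)).
Qed.

Lemma esum_enumerates (R : realType) (a : I -> \bar R) :
  (forall i, D i -> (0 <= a i)%E) ->
  (\esum_(i in D) a i = \esum_(n in [set n | v n]) a (e n))%E.
Proof.
move=> a0; have [vD vi De] := eD.
apply: reindex_esum => //; split.
- by move=> n /vD.
- by move=> n m /set_mem vn /set_mem vm; exact: vi.
- by move=> i /De[n vn <-]; exists n.
Qed.

Lemma sum_le_esum (R : realType) (a : I -> R) (B : R) :
  (forall i, D i -> 0 <= a i) -> (\esum_(i in D) (a i)%:E <= B%:E)%E ->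
  sum_le (fun n => if v n then a (e n) else 0) B.
Proof.
move=> a0; rewrite esum_enumerates; last by move=> i /a0; rewrite lee_fin.
have [vD _ _] := eD.
rewrite -(@nneseries_esum _ (fun n => (a (e n))%:E) v); last first.
  by move=> n vn; rewrite lee_fin; exact/a0/vD.
move=> h N; rewrite -lee_fin; apply: le_trans h.
rewrite -sumEFin -(big_mkord xpredT (fun n => (if v n then a (e n) else 0)%:E)).
rewrite (eq_bigr (fun n => if v n then (a (e n))%:E else 0%E)); last by move=> n _; case: ifP.
rewrite -big_mkcond; apply: nneseries_lim_ge => n _ vn.
by rewrite lee_fin; exact/a0/vD.
Qed.

Lemma esum_le_sum (R : realType) (a : I -> R) (B : R) :
  (forall i, D i -> 0 <= a i) -> sum_le (fun n => if v n then a (e n) else 0) B ->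
  (\esum_(i in D) (a i)%:E <= B%:E)%E.
Proof.
move=> a0 h; rewrite esum_enumerates; last by move=> i /a0; rewrite lee_fin.
have [vD _ _] := eD.
rewrite -(@nneseries_esum _ (fun n => (a (e n))%:E) v); last first.
  by move=> n vn; rewrite lee_fin; exact/a0/vD.
rewrite eseries_mkcond.
rewrite (eq_eseriesr (g := fun n => (if v n then a (e n) else 0)%:E)); last first.
  by move=> n _; case: ifP.
apply: sum_le_nneseries h => n; case: ifP => // /vD; exact: a0.
Qed.

(** Once a finite set contains the first [N] items, its sum differs from the series by terms of the
    tail only, whatever else it contains. *)
Lemma has_csum_enumerates (R : realType) (G : I -> R[i]) :
  csummable (fun n => if v n then G (e n) else 0) ->
  has_csum D G (csum (fun n => if v n then G (e n) else 0)).
Proof.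
set f := fun n => _ => sf; have [B fB] := sf.
have tail (t : R) : 0 < t -> exists N, forall M, \sum_(N <= n < N + M) normc (f n) <= t.
  by move=> t0; exact: (sum_le_tail fB t0).
have pF := @summability.totally_filter I.
rewrite /has_csum; apply/cvgrPdist_lt => eps eps0.
have er : eps = (complex.Re eps)%:C.
  by move: eps0; case: (eps) => u w; rewrite ltcE /= => /andP[/eqP -> _].
have {}eps0 : 0 < complex.Re eps by move: eps0; rewrite {1}er ltcR.
rewrite er; move: (complex.Re eps) eps0 => {er}t t0.
have t2 : 0 < t / 2 by rewrite divr_gt0.
have [N hN] := tail _ t2.
exists [fset i in map e (iota 0 N)]%fset => // X /= JX.
rewrite normcE ltcR /summability.partial_sum.
rewrite -(big_seq_fsetE _ _ xpredT (fun i => if i \in D then G i else 0))/=.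
have [M0 hM0] := enumerates_bound X.
have key K : (maxn N M0 <= K)%N ->
    normc (\sum_(n < K) f n - \sum_(i <- X) (if i \in D then G i else 0)) <= t / 2.
  rewrite geq_max => /andP[NK MK].
  rewrite (big_enumerates G (hM0 K MK)) -sumrB.
  rewrite -(big_mkord xpredT (fun n => f n - (if v n && (e n \in X) then G (e n) else 0))).
  rewrite (big_cat_nat (leq0n N) NK) /= big_nat_cond big1 ?add0r; last first.
    move=> n /andP[/andP[_ nN] _]; rewrite /f; case: (boolP (v n)) => vn /=; last by rewrite subrr.
    have -> : e n \in X.
      by apply: (fsubsetP JX); rewrite inE map_f// mem_iota add0n.
    by rewrite subrr.
  apply: (le_trans (normc_sum _ _ _)).
  apply: le_trans (hN (K - N)%N); rewrite subnKC//; apply: ler_sum => n _.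
  rewrite /f; case: (v n) => /=; last by rewrite subrr.
  by case: (e n \in X); rewrite ?subrr ?normc0 ?normc_ge0// subr0.
apply: (@le_lt_trans _ _ (t / 2)); last lra.
apply: (@ccvg_le _ (fun K => \sum_(n < K + maxn N M0) f n - \sum_(i <- X) (if i \in D then G i else 0))).
  apply: ccvgB; last exact: ccvg_cst.
  apply/ccvgP => u u0; have [L hL] := (ccvgP _ _).1 (csum_ccvg sf) u u0.
  by exists L => n Ln; apply: hL; rewrite (leq_trans Ln)// leq_addr.
by move=> K; apply: key; rewrite leq_addl.
Qed.

Lemma has_csum_unique (R : realType) (G : I -> R[i]) s t :
  has_csum D G s -> has_csum D G t -> s = t.
Proof.
have pF := @summability.totally_filter I.
by move=> hs ht; apply: (cvg_unique _ hs ht).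
Qed.

End enumeration.

Section zero_derivative.
Context (R : realType).

(** With derivative 0 the Taylor remainder bounds increments quadratically, and [rem2_const] applies
    along the segment. *)
Lemma jet_const (D : set R[i]) (f f' : R[i] -> R[i]) M a b : jet D f f' M ->
  (forall z, D z -> f' z = 0) ->
  (forall t : R, 0 <= t <= 1 -> D (a + t%:C * (b - a))) -> f b = f a.
Proof.
move=> jf f0 hD; have M0 := jet_ge0 jf.
set L := normc (b - a); have L0 : 0 <= L := normc_ge0 _.
have d0 : 0 < (L + 1)^-1 by rewrite invr_gt0; lra.
have : f (a + 1%:C * (b - a)) = f (a + 0%:C * (b - a)); last first.
  by rewrite -[1%:C]/(1 : R[i]) -[0%:C]/(0 : R[i]) mul1r mul0r addr0 addrC subrK.
apply: (@rem2_const R (fun t => f (a + t%:C * (b - a))) _ (M * L ^+ 2) d0) => s t s01 t01 st.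
have e : a + s%:C * (b - a) - (a + t%:C * (b - a)) = (s - t)%:C * (b - a).
  by rewrite rmorphB; ring.
have en : normc ((s - t)%:C * (b - a)) = `|s - t| * L by rewrite normcM normcR.
have h1 : `|s - t| * L <= 1.
  apply: (@le_trans _ _ ((L + 1)^-1 * (L + 1))); last by rewrite mulVf// gt_eqF//; lra.
  by apply: ler_pM => //; lra.
have := jet_rem jf (hD s s01) (hD t t01); rewrite e en => /(_ h1).
rewrite f0 ?mul0r ?subr0; last exact: hD.
suff -> : M * L ^+ 2 * (s - t) ^+ 2 = M * (`|s - t| * L) ^+ 2 by [].
by rewrite exprMn real_normK ?num_real//; ring.
Qed.

End zero_derivative.

Section exponential_series.
Context (R : realType).

Definition exp_term (z : R[i]) (k : nat) : R[i] := (k`!%:R)^-1 * z ^+ k.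

Lemma sum_le_exp (x : R) : 0 <= x -> sum_le (fun k => (k`!%:R)^-1 * x ^+ k) (expR x).
Proof.
move=> x0 N; rewrite /expR.
rewrite [leLHS](_ : _ = series (exp_coeff x) N).
  apply: nondecreasing_cvgn_le; last exact: is_cvg_series_exp_coeff.
  by apply: nondecreasing_series => n *; exact: exp_coeff_ge0.
by rewrite /series /= big_mkord; apply: eq_bigr => k _; rewrite /exp_coeff /= mulrC.
Qed.

Lemma csummable_exp z : csummable (exp_term z).
Proof.
apply: csummable_dom (sum_le_exp (normc_ge0 z)) => k.
by rewrite /exp_term normcM normcV normc_nat normcX.
Qed.

Lemma csumS (f : nat -> R[i]) : csummable (fun n => f n.+1) -> f 0%N = 0 ->
  csum f = csum (fun n => f n.+1).
Proof.
move=> sf f0; apply: (@csum_inj _ succn f) => //; first exact: succn_inj.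
by case=> [|n] // /(_ n); rewrite eqxx.
Qed.

Lemma jet_exp_term (r : R) k : 0 <= r -> jet [set z : R[i] | normc z <= r]
  (fun z => exp_term z k) (fun z => if k is k'.+1 then exp_term z k' else 0)
  ((k`!%:R)^-1 * (r + 1) ^+ k).
Proof.
move=> r0; have j : forall m, jet [set z : R[i] | normc z <= r] (fun z => z ^+ m)
    (fun z => m%:R * z ^+ m.-1) ((r + 1) ^+ m).
  elim=> [|m IH].
    rewrite expr0 -(normc1 R); apply: eq_jet (jet_cst _ 1) => z _; first by rewrite expr0.
    by rewrite mul0r.
  rewrite exprSr; apply: eq_jet (jetM IH (@jet_id _ _ r (fun z h => h) r0)) => z _.
    by rewrite exprSr.
  case: m {IH} => [|m] /=; first by rewrite mul0r !expr0; ring.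
  by rewrite -[m.+2%:R]natr1 exprSr; ring.
have := jetZ (k`!%:R)^-1 (j k); rewrite normcV normc_nat.
apply: eq_jet => z _ //; case: k => [|k]; first by rewrite mul0r mulr0.
rewrite /exp_term factS natrM /= mulrA; congr (_ * _).
by rewrite invfM mulrC mulrA divff ?mul1r// pnatr_eq0.
Qed.

(** The series is its own derivative, so its product with [cexp (- z)] has derivative 0 and takes
    the value 1 at the origin. *)
Lemma cexp_series (z : R[i]) : cexp z = csum (exp_term z).
Proof.
pose E w := csum (exp_term w).
pose r := normc z; have r0 : 0 <= r := normc_ge0 z.
have r10 : 0 <= r + 1 by lra.
have jE : jet [set w : R[i] | normc w <= r] E E (expR (r + 1)).
  have := jet_csum (fun k => jet_exp_term k r0) (sum_le_exp r10).
  apply: eq_jet => w _ //; rewrite csumS//; exact: csummable_exp.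
have jid := @jet_id _ [set w : R[i] | normc w <= r] r (fun z h => h) r0.
have jC := jet_cexp (jetN jid) (expR_ge0 r) _.
have {}jC := jC (fun w (wr : normc w <= r) => _).
have h w : normc w <= r -> normc (cexp (- w)) <= expR r.
  by move=> wr; apply: (le_trans (normc_cexp_le _)); rewrite normcN ler_expR.
have {jC}jC := jet_cexp (jetN jid) (expR_ge0 r) h.
have : E z * cexp (- z) = E 0 * cexp (- 0).
  apply: (jet_const (jetM jE jC)).
    by move=> w _ /=; ring.
  move=> t /andP[t0 t1]; rewrite /= add0r subr0 normcM normcR ger0_norm//.
  by rewrite ler_piMl.
have -> : E 0 = 1.
  rewrite /E -[RHS](csum_delta 0%N); apply: eq_csum => -[|k].
    by rewrite /exp_term fact0 invr1 expr0 mul1r.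
  by rewrite /exp_term exprS mul0r mulr0.
rewrite oppr0 cexp0 mul1r cexpN => /(congr1 (fun x => x * cexp z)).
by rewrite mul1r divfK ?cexp_neq0// => ->.
Qed.

End exponential_series.

(** * The algebra of absolutely convergent Dirichlet series on a line *)

Section dirichlet_algebra.
Context (R : realType) (L : set R) (y : R).
Hypothesis L0 : L 0.
Hypothesis LD : forall a b, L a -> L b -> L (a + b).
Implicit Types (f g : R -> R[i]) (B : R).

Definition wt (a : R) : R := expR (- (2 * pi * a * y)).

Lemma wt0 : wt 0 = 1. Proof. by rewrite /wt mulr0 mul0r oppr0 expR0. Qed.

Lemma wtD a b : wt (a + b) = wt a * wt b.
Proof. by rewrite /wt -expRD; congr expR; ring. Qed.

Lemma wt_ge0 a : 0 <= wt a. Proof. exact: expR_ge0. Qed.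

Lemma normc_character_line a x : normc (character a (x +i* y)) = wt a.
Proof. by rewrite normc_character. Qed.

(* Absolutely convergent Dirichlet series on the line Im z = y with
   frequencies in L and norm at most B. *)
Definition dser B f := exists (c : nat -> R[i]) (om : nat -> R),
  [/\ forall n, L (om n), sum_le (fun n => normc (c n) * wt (om n)) B &
      forall x, f x = csum (fun n => c n * character (om n) (x +i* y))].

Lemma dser_cst c : dser (normc c) (fun=> c).
Proof.
exists (fun n => if n == 0%N then c else 0), (fun=> 0); split => //.
- move=> [|N]; first by rewrite big_ord0 normc_ge0.
  rewrite big_ord_recl wt0 mulr1 big1 ?addr0// => i _.
  by rewrite -[X in normc X]/(0 : R[i]) normc0 mul0r.
- move=> x; rewrite -[LHS](csum_delta 0%N); apply: eq_csum => n.
  by rewrite character0 mulr1.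
Qed.

Lemma eq_dser B f g : f =1 g -> dser B f -> dser B g.
Proof. by move=> /funext ->. Qed.

Lemma dserZ c B f : dser B f -> dser (normc c * B) (fun x => c * f x).
Proof.
move=> [c' [om [h1 h2 h3]]]; exists (fun n => c * c' n), om; split => //.
- move=> N; under eq_bigr do rewrite normcM -mulrA.
  by rewrite -mulr_sumr; apply: ler_wpM2l => //; exact: normc_ge0.
- move=> x; rewrite h3 -csumZ; last first.
    by apply: csummable_dom h2 => n; rewrite normcM normc_character_line.
  by apply: eq_csum => n; rewrite mulrA.
Qed.

Lemma dser_csum (b : nat -> R) B (f : nat -> R -> R[i]) : sum_le b B ->
  (forall k, dser (b k) (f k)) -> dser B (fun x => csum (f ^~ x)).
Proof.
move=> bB /choice[c /choice[om h]].
(* Codes that are not pairs carry the coefficient 0, but still need a frequency in [L]; [L0]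
   provides one. *)
pose OM n := if CodeSeq.decode n is [:: k; j] then om k j else 0.
exists (csum2 c), OM.
have E n : normc (csum2 c n) * wt (OM n) =
    normc (csum2 (fun k j => (normc (c k j) * wt (om k j))%:C : R[i]) n).
  rewrite /csum2 /OM; case: (CodeSeq.decode n) => [|k [|j [|? ?]]];
    rewrite ?normc0 ?mul0r//.
  by rewrite normcR ger0_norm// mulr_ge0 ?normc_ge0 ?wt_ge0.
split.
- move=> n; rewrite /OM; case: (CodeSeq.decode n) => [|k [|j [|? ?]]]//.
  by have [+ _ _] := h k; exact.
- suff : sum_le (fun n => normc (csum2 (fun k j => (normc (c k j) * wt (om k j))%:C : R[i]) n)) B.
    by apply: sum_leW => n; rewrite E.
  apply: (sum_le_csum2 bB) => k; have [_ + _] := h k; apply: sum_leW => j.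
  by rewrite normcR ger0_norm// mulr_ge0 ?normc_ge0 ?wt_ge0.
- move=> x; transitivity (csum (fun k => csum (fun j => c k j * character (om k j) (x +i* y)))).
    by apply: eq_csum => k; have [_ _ ->] := h k.
  rewrite -(csum_csum2 bB); last first.
    move=> k; have [_ + _] := h k; apply: sum_leW => j.
    by rewrite normcM normc_character_line.
  apply: eq_csum => n; rewrite /csum2 /OM.
  by case: (CodeSeq.decode n) => [|k [|j [|? ?]]]; rewrite ?mul0r.
Qed.

Lemma dserM B B' f g : dser B f -> dser B' g -> dser (B * B') (fun x => f x * g x).
Proof.
move=> [c [om [h1 h2 h3]]] dg; have [c' [om' [k1 k2 k3]]] := dg.
have B0 : 0 <= B' := sum_le_cst_ge0 k2.
apply: (@eq_dser _ (fun x => csum (fun n => (c n * character (om n) (x +i* y)) * g x))).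
  move=> x; rewrite h3 mulrC -csumZ; last first.
    by apply: csummable_dom h2 => n; rewrite normcM normc_character_line.
  by apply: eq_csum => n; rewrite mulrC.
apply: (dser_csum (b := fun n => normc (c n) * wt (om n) * B')).
  by move=> N; rewrite -mulr_suml; apply: ler_wpM2r.
move=> n; exists (fun m => c n * c' m), (fun m => om n + om' m); split.
- by move=> m; exact: LD.
- move=> N; under eq_bigr do rewrite normcM wtD mulrACA.
  rewrite -mulr_sumr; apply: ler_wpM2l; last exact: k2.
  by rewrite mulr_ge0 ?normc_ge0 ?wt_ge0.
- move=> x; rewrite k3 -csumZ; last first.
    by apply: csummable_dom k2 => m; rewrite normcM normc_character_line.
  by apply: eq_csum => m; rewrite characterD; ring.
Qed.

Lemma dserX B f k : dser B f -> dser (B ^+ k) (fun x => f x ^+ k).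
Proof.
move=> df; elim: k => [|k IH].
  rewrite expr0 -(normc1 R); apply: eq_dser (dser_cst 1) => x; by rewrite expr0.
rewrite exprS; apply: eq_dser (dserM df IH) => x; by rewrite exprS.
Qed.

(** The exponential series in the Banach algebra of absolutely convergent expansions; [L] being
    closed under addition, powers keep their frequencies in [L]. *)
Lemma dser_cexp B f : dser B f -> dser (expR B) (fun x => cexp (f x)).
Proof.
move=> df; have B0 : 0 <= B by have [c [om [_ h _]]] := df; exact: sum_le_cst_ge0 h.
apply: (@eq_dser _ (fun x => csum (exp_term (f x)))).
  by move=> x; rewrite cexp_series.
apply: (dser_csum (sum_le_exp B0)) => k.
have := dserZ (k`!%:R)^-1 (dserX k df); rewrite normcV normc_nat.
exact.
Qed.

End dirichlet_algebra.

Section regrouping.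
Context (R : realType) (c : nat -> R[i]) (om : nat -> R) (y B : R).
Hypothesis cB : sum_le (fun n => normc (c n) * wt y (om n)) B.

(** The frequencies [om] may repeat, as they do in an expanded exponential; this is the total
    coefficient of one frequency. *)
Definition coef (w : R) : R[i] := csum (fun n => if om n == w then c n else 0).

Definition coef_supp : set R := [set w | coef w != 0].

Lemma coef_supp_range w : coef_supp w -> exists n, om n == w.
Proof.
move=> /eqP q0; apply: contrapT => h; apply: q0; rewrite /coef -[RHS]csum0.
apply: eq_csum => n; case: ifP => // e; exfalso; apply: h; by exists n.
Qed.

Let ex n : exists m, om m == om n. Proof. by exists n. Qed.
(** The least index with the same frequency represents its class, so that [csum_fiber] collects
    equal frequencies. *)
Let p n := ex_minn (ex n).

Let om_p n : om (p n) = om n.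
Proof. by rewrite /p; case: ex_minnP => m /eqP. Qed.

Let p_eq n m : om n = om m -> p n = p m.
Proof.
move=> e; rewrite /p; case: ex_minnP => a /eqP ae ha; case: ex_minnP => b /eqP be hb.
apply/eqP; rewrite eqn_leq ha ?hb//; first by rewrite ae e.
by rewrite be -e.
Qed.

Definition first_index n := (p n == n) && (coef (om n) != 0).

Lemma first_index_enumerates : enumerates coef_supp om first_index.
Proof.
split.
- by move=> n /andP[_].
- by move=> n m /andP[/eqP pn _] /andP[/eqP pm _] /p_eq; rewrite pn pm.
- move=> w qw; have [n /eqP on] := coef_supp_range qw.
  exists (p n); last by rewrite om_p.
  by rewrite /first_index (p_eq (om_p n)) om_p on eqxx.
Qed.

Let term x n : R[i] := c n * character (om n) (x +i* y).

Let term_le x : sum_le (fun n => normc (term x n)) B.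
Proof. by apply: sum_leW cB => n; rewrite normcM normc_character_line. Qed.

Lemma csummable_coef w : csummable (fun n => if om n == w then c n else 0).
Proof.
apply: (@csummable_dom _ _ (fun n => (wt y w)^-1 * (normc (c n) * wt y (om n))) ((wt y w)^-1 * B)).
  move=> n; case: eqVneq => [->|_].
    by rewrite mulrCA mulVf ?mulr1// gt_eqF// expR_gt0.
  by rewrite normc0 !mulr_ge0 ?invr_ge0 ?expR_ge0 ?normc_ge0.
move=> N; rewrite -mulr_sumr; apply: ler_wpM2l => //.
by rewrite invr_ge0 expR_ge0.
Qed.

Lemma csum_fiber_first x k : csum (fiber p (term x) k) =
  if first_index k then coef (om k) * character (om k) (x +i* y) else 0.
Proof.
rewrite /first_index; case: (eqVneq (p k) k) => pk /=.
  transitivity (coef (om k) * character (om k) (x +i* y)); last first.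
    by case: eqVneq => //= ->; rewrite mul0r.
  rewrite mulrC -csumZ; last exact: csummable_coef.
  apply: eq_csum => n; rewrite /fiber.
  have -> : (p n == k) = (om n == om k).
    apply/eqP/eqP => [<-|/p_eq ->//]; by rewrite om_p.
  by case: eqVneq => [e|_]; [rewrite /term e mulrC|rewrite mulr0].
rewrite -[RHS]csum0; apply: eq_csum => n; rewrite /fiber; case: eqP => // pn.
by move: pk; rewrite -pn (p_eq (om_p n)) eqxx.
Qed.

Lemma csum_regroup x : csum (term x) =
  csum (fun n => if first_index n then coef (om n) * character (om n) (x +i* y) else 0).
Proof.
rewrite (csum_fiber p); last by exists B.
by apply: eq_csum => k; exact: csum_fiber_first.
Qed.

Lemma coef_wt_le : sum_le (fun n => if first_index n then
  normc (coef (om n)) * wt y (om n) else 0) B.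
Proof.
apply: sum_leW (sum_le_csum_fiber p (term_le 0)) => k; rewrite csum_fiber_first.
by case: ifP => _; [rewrite normcM normc_character_line|exact: normc_ge0].
Qed.

Context (F F' : R[i] -> R[i]) (M : R).
Hypothesis oF : order2 F F'.
Hypothesis FE : forall x, F (x +i* y) = csum (term x).
Hypothesis coefM : forall w, coef_supp w -> `|w| <= M.

(** On a bounded set of frequencies the weights [wt y] are bounded below by a positive constant, so
    absolute convergence on one line gives that of the coefficients themselves. *)
Lemma coef_le : sum_le (fun n => if first_index n then normc (coef (om n)) else 0)
  (expR (2 * pi * `|M| * `|y|) * B).
Proof.
move=> N; apply: (@le_trans _ _ (\sum_(n < N) expR (2 * pi * `|M| * `|y|) *
   (if first_index n then normc (coef (om n)) * wt y (om n) else 0))); last first.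
  by rewrite -mulr_sumr; apply: ler_wpM2l; [exact: expR_ge0|exact: coef_wt_le].
apply: ler_sum => n _; case: (boolP (first_index n)) => fn; last by rewrite mulr0.
rewrite mulrCA; rewrite -[leLHS]mulr1; apply: ler_wpM2l; first exact: normc_ge0.
rewrite /wt -expRD; apply: le1_expR.
have [vD _ _] := first_index_enumerates.
have h : `|om n| <= `|M| by apply: (le_trans (coefM (vD _ fn))); exact: ler_norm.
have p0 : 0 <= 2 * pi :> R by rewrite mulr_ge0// pi_ge0.
have -> : 2 * pi * `|M| * `|y| - 2 * pi * om n * y =
  2 * pi * (`|M| * `|y| - om n * y) by ring.
rewrite mulr_ge0// subr_ge0; apply: (le_trans (ler_norm _)); rewrite normrM.
by apply: ler_wpM2r.
Qed.

Definition regrouped (z : R[i]) : R[i] :=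
  csum (fun n => if first_index n then coef (om n) * character (om n) z else 0).

Lemma regrouped_order2 : exists G', order2 regrouped G'.
Proof.
pose B' := expR (2 * pi * `|M| * `|y|) * B.
have B'0 : 0 <= B' by apply: mulr_ge0; [exact: expR_ge0|exact: sum_le_cst_ge0 cB].
pose k0 : R := 10 * (2 * pi * `|M|).
have p0 : 0 <= 2 * pi :> R by rewrite mulr_ge0// pi_ge0.
exists (fun z => csum (fun n => if first_index n then coef (om n) *
   ((0 +i* (2 * pi * om n)) * character (om n) z) else 0)).
exists (B' * 11), k0; split; [exact: mulr_ge0|by apply: mulr_ge0 => //; exact: mulr_ge0|].
move=> r r1.
apply: (jet_csum (M := fun n => (if first_index n then normc (coef (om n)) else 0) *
   (11 * expR (k0 * r ^+ 2)))); last first.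
  move=> N; rewrite -mulr_suml -mulrA; apply: ler_wpM2r; last exact: coef_le.
  by rewrite mulr_ge0// expR_ge0.
move=> n; case: (boolP (first_index n)) => fn; last first.
  rewrite mul0r -(normc0 R); exact: jet_cst.
apply: jetZ; apply: jetW (jet_cexp_linear _ r1).
rewrite ler_pM2l// ler_expR; apply: ler_wpM2r; first exact: sqr_ge0.
rewrite /k0 ler_pM2l// normc_i normrM ger0_norm//; apply: ler_wpM2l => //.
have [vD _ _] := first_index_enumerates.
by apply: (le_trans (coefM (vD _ fn))); exact: ler_norm.
Qed.

(** Both sides have order at most 2 and agree on the line of height [y]; [order2_eq0] extends the
    equality to the plane. *)
Lemma regrouped_eq z : F z = regrouped z.
Proof.
have [G' oG] := regrouped_order2.
apply/eqP; rewrite -subr_eq0; apply/eqP.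
apply: (order2_eq0 (Y := y) (order2B oF oG)) => x.
by rewrite FE csum_regroup subrr.
Qed.

Lemma regrouped_dirichlet : is_dirichlet_series F coef_supp coef.
Proof.
split.
- apply: (@sub_countable _ _ _ (range om)); last exact: card_image_le.
  apply: subset_card_le => w /coef_supp_range [n /eqP <-]; by exists n.
- exists M; split; first exact: num_real.
  by move=> N MN w /coefM h; apply: (le_trans h); exact: ltW.
- apply: le_lt_trans (ltry (expR (2 * pi * `|M| * `|y|) * B)).
  apply: (esum_le_sum first_index_enumerates) => [w _|]; first exact: normc_ge0.
  exact: coef_le.
- move=> z; rewrite regrouped_eq.
  apply: (has_csum_enumerates first_index_enumerates
    (G := fun w => coef w * character w z)).
  pose k := 2 * pi * `|M| * `|complex.Im z|.
  apply: (@csummable_dom _ _ (fun n => (if first_index n then normc (coef (om n)) else 0)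
     * expR k) (expR (2 * pi * `|M| * `|y|) * B * expR k)).
    move=> n; case: (boolP (first_index n)) => fn; last by rewrite normc0 mul0r.
    rewrite normcM normc_character; apply: ler_wpM2l; first exact: normc_ge0.
    rewrite ler_expR; apply: (le_trans (ler_norm _)); rewrite normrN !normrM.
    rewrite (ger0_norm (pi_ge0 R)) ger0_norm//; apply: ler_wpM2r => //.
    apply: ler_wpM2l; first by rewrite mulr_ge0// pi_ge0.
    have [vD _ _] := first_index_enumerates.
    by apply: (le_trans (coefM (vD _ fn))); exact: ler_norm.
  by move=> N; rewrite -mulr_suml; apply: ler_wpM2r; [exact: expR_ge0|exact: coef_le].
Qed.

End regrouping.

Section finite_sums.
Context (R : realType).

Lemma has_csum_finite (I : choiceType) (D : set I) (G : I -> R[i]) : finite_set D ->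
  has_csum D G (\sum_(i <- fset_set D) G i).
Proof.
move=> fD; have pF := @summability.totally_filter I.
apply/cvgrPdist_lt => e e0; exists (fset_set D) => // X /= DX.
rewrite /summability.partial_sum.
rewrite -(big_seq_fsetE _ _ xpredT (fun i => if i \in D then G i else 0))/=.
rewrite (_ : \sum_(i <- X) _ = \sum_(i <- fset_set D) G i) ?subrr ?normr0//.
rewrite -(big_fset_incl _ DX) => [|i iX]; last first.
  by rewrite in_fset_set// => /negbTE ->.
by rewrite big_seq [RHS]big_seq; apply: eq_bigr => i; rewrite in_fset_set// => ->.
Qed.

Lemma finite_dirichlet_exponential_polynomial (Q : R[i] -> R[i]) (W : set R) (q : R -> R[i]) :
  is_dirichlet_series Q W q -> finite_set W -> is_exponential_polynomial Q.
Proof.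
move=> [_ _ _ hQ] fW.
pose s : seq R := fset_set W.
exists (size s), (fun j => q (nth 0 s j)), (fun j => nth 0 s j) => z.
rewrite (has_csum_unique (hQ z) (@has_csum_finite _ W (fun w => q w * character w z) fW)).
by rewrite -[LHS]/(\sum_(w <- s) q w * character w z) (big_nth 0) big_mkord.
Qed.

End finite_sums.

(** * The multiset and its density *)

Section complex_topology.
Context (R : realType).

(** A single condition that yields both continuity for the topology of [R[i]] and Borel
    measurability; the functions integrated against the multiset measure below satisfy it. *)
Definition loclip (f : R[i] -> R[i]) := forall z, exists r K : R, 0 < r /\
  forall w, normc (w - z) < r -> normc (f w - f z) <= K * normc (w - z).

Lemma loclip_near (f : R[i] -> R[i]) z (e : R) : loclip f -> 0 < e ->
  exists2 d : R, 0 < d & forall w, normc (w - z) < d -> normc (f w - f z) < e.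
Proof.
move=> lf e0; have [r [K [r0 h]]] := lf z.
have K1 : 0 < `|K| + 1 by have := normr_ge0 K; lra.
exists (Num.min r (e / (`|K| + 1))); first by rewrite lt_min r0 divr_gt0.
move=> w; rewrite lt_min => /andP[wr we]; apply: (le_lt_trans (h w wr)).
apply: (@le_lt_trans _ _ ((`|K| + 1) * normc (w - z))).
  by apply: ler_wpM2r; [exact: normc_ge0|have := ler_norm K; lra].
by rewrite mulrC -ltr_pdivlMr.
Qed.

Lemma loclip_continuous (f : R[i] -> R[i]) : loclip f -> continuous f.
Proof.
move=> lf z; have pf : ProperFilter (nbhs (z : R[i])) by exact: nbhs_pfilter.
apply/cvgrPdist_lt => e e0.
have er : e = (complex.Re e)%:C.
  by move: e0; case: (e) => u v; rewrite ltcE /= => /andP[/eqP -> _].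
have {}e0 : 0 < complex.Re e by move: e0; rewrite {1}er ltcR.
have [d d0 h] := loclip_near z lf e0.
by apply: (@near_normc _ z d _ d0) => w /h hw; rewrite normcE er ltcR normcBC.
Qed.

Lemma loclip_measurable (f : R[i] -> R[i]) : loclip f ->
  @cmeasurable _ (borelC R) R f.
Proof.
move=> lf.
suff h (u : R[i] -> R) : (forall z (e : R), 0 < e ->
    exists2 d : R, 0 < d & forall w, normc (w - z) < d -> `|u w - u z| < e) ->
    @measurable_fun _ _ (borelC R) R setT u.
  split; apply: h => z e e0; have [d d0 hd] := loclip_near z lf e0; exists d => // w /hd.
    by apply: le_lt_trans; rewrite -Re_B; exact: Re_le_normc.
  by apply: le_lt_trans; rewrite -Im_B; exact: Im_le_normc.
move=> hu; apply: (measurability _ (RGenOInfty.measurableE R)).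
move=> /= _ [_ [a ->]] <-; rewrite setTI; apply: sub_sigma_algebra.
rewrite /= openE => z /=; rewrite in_itv /= andbT => az.
have [d d0 h] := hu z (u z - a) ltac:(by rewrite subr_gt0).
apply: (@near_normc _ z d _ d0) => w /h; rewrite /= in_itv /= andbT ltr_norml => /andP[+ _].
lra.
Qed.

Lemma continuous_Complex : continuous (fun p : R * R => p.1 +i* p.2).
Proof.
move=> p; have pf : ProperFilter (nbhs (p : R * R)) by exact: nbhs_pfilter.
apply/cvgrPdist_lt => e e0.
have er : e = (complex.Re e)%:C.
  by move: e0; case: (e) => u v; rewrite ltcE /= => /andP[/eqP -> _].
have {}e0 : 0 < complex.Re e by move: e0; rewrite {1}er ltcR.
have e2 : 0 < complex.Re e / 2 by rewrite divr_gt0.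
exists (ball p.1 (complex.Re e / 2), ball p.2 (complex.Re e / 2)).
  by split; exact: nbhsx_ballx.
move=> q [/= q1 q2].
rewrite normcE er ltcR; apply: (le_lt_trans (normc_le_ReIm _)).
rewrite Re_B Im_B /=; rewrite /ball /= in q1 q2; lra.
Qed.

Definition box (a b : R) : set R[i] :=
  [set z | `|complex.Re z| <= a /\ `|complex.Im z| <= b].

Lemma box_compact a b : compact (box a b).
Proof.
have -> : box a b = (fun p : R * R => p.1 +i* p.2) @` (`[- a, a]%classic `*` `[- b, b]%classic).
  apply/seteqP; split => [[x y] [/= h1 h2]|_ [[x y] [/= h1 h2] <-]].
    by exists (x, y) => //; split => /=; rewrite in_itv /= -ler_norml.
  by split; rewrite /= ler_norml; move: h1 h2; rewrite !in_itv.
apply: continuous_compact; first exact/continuous_subspaceT/continuous_Complex.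
by apply: compact_setX; exact: segment_compact.
Qed.

Lemma box_closed a b : closed (box a b).
Proof.
apply: compact_closed; last exact: box_compact.
exact: norm_hausdorff.
Qed.

Lemma locally_finite_countable (S : set R[i]) : locally_finite S -> countable S.
Proof.
move=> lS; have -> : S = \bigcup_(n in [set: nat]) (S `&` box n%:R n%:R).
  apply/seteqP; split => [z Sz|z [n _ []]//].
  pose n := (Num.truncn (normc z)).+1.
  have zn : normc z <= n%:R by exact/ltW/truncnS_gt.
  exists n => //; split => //; split; apply: le_trans zn.
    exact: Re_le_normc.
  exact: Im_le_normc.
apply: bigcup_countable; first exact: countableP.
by move=> n _; apply/finite_set_countable/lS/box_compact.
Qed.

End complex_topology.

Section multiset_integral.
Context (R : realType) (A : R[i] -> nat) (e : nat -> R[i]) (v : nat -> bool).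
Hypothesis eA : enumerates (msupp A) e v.
Local Notation mu := (multiset_measure A).

Definition mmult n : nat := if v n then A (e n) else 0.

(** The measure becomes a series of weighted Dirac masses, against which integrals are computed mass
    by mass. *)
Lemma multiset_measureE (B : set (borelC R)) :
  (multiset_measure A B = \sum_(n <oo) ((mmult n)%:R%:E * \d_(e n : borelC R) B))%E.
Proof.
rewrite /multiset_measure.
transitivity (\esum_(a in msupp A) ((A a)%:R * \1_B a : R)%R%:E)%E.
  rewrite esum_mkcond [RHS]esum_mkcond; apply: eq_esum => a _.
  rewrite indicE; have [A0|A0] := eqVneq (A a) 0%N.
    by rewrite A0 mul0r; case: ifP; case: ifP.
  rewrite (mem_set (A0 : msupp A a)).
  by case: (a \in B); rewrite ?mulr1 ?mulr0.
rewrite (esum_enumerates eA); last by move=> a _; rewrite lee_fin mulr_ge0.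
rewrite -(@nneseries_esum _ (fun n => ((A (e n))%:R * \1_B (e n) : R)%:E) v); last first.
  by move=> n vn; rewrite lee_fin mulr_ge0.
rewrite eseries_mkcond; apply: eq_eseriesr => n _.
rewrite /mmult diracE EFinM indicE; case: ifP => // _.
by rewrite mul0e.
Qed.

Lemma ge0_integral_multiset (f : borelC R -> R) :
  measurable_fun setT f -> (forall z, 0 <= f z) ->
  (\int[mu]_z (f z)%:E = \sum_(n <oo) ((mmult n)%:R * f (e n))%:E)%E.
Proof.
move=> mf f0.
pose k n : {nonneg R} := NngNum (ler0n R (mmult n)).
pose m n := mscale (k n) (\d_(e n : borelC R)).
transitivity (\int[mseries m 0]_z (f z)%:E)%E.
  congr (integral _ _ _); apply/funext => B; rewrite multiset_measureE.
  by rewrite /mseries; apply: eq_eseriesr.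
rewrite ge0_integral_measure_series//; last 2 first.
  by move=> z _; rewrite lee_fin.
  exact/measurable_EFinP.
apply: eq_eseriesr => n _.
rewrite ge0_integral_mscale//; last 2 first.
  exact/measurable_EFinP.
  by move=> z _; rewrite lee_fin.
rewrite integral_dirac//; last exact/measurable_EFinP.
by rewrite diracT mul1e EFinM.
Qed.

Lemma integral_multiset (f : borelC R -> R[i]) : cmeasurable f ->
  csummable (fun n => (mmult n)%:R * f (e n)) ->
  cintegral mu f = csum (fun n => (mmult n)%:R * f (e n)).
Proof.
move=> [mr mi] [B sB].
have key (u : borelC R -> R) : measurable_fun setT u ->
    sum_le (fun n => (mmult n)%:R * `|u (e n)|) B ->
    \int[mu]_z u z = \int[@counting nat R]_n ((mmult n)%:R * u (e n)).
  move=> mu' uB.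
  have ge (w : borelC R -> R) : measurable_fun setT w -> (forall z, 0 <= w z) ->
      \int[mu]_z w z = \int[@counting nat R]_n ((mmult n)%:R * w (e n)).
    move=> mw w0; rewrite /Rintegral ge0_integral_multiset//.
    by rewrite ge0_integral_count// => n; rewrite lee_fin mulr_ge0.
  have mn : measurable_fun setT (fun z => `|u z|).
    exact: measurableT_comp.
  have inn : mu.-integrable setT (EFin \o (fun z => `|u z|)).
    apply/integrableP; split; first exact/measurable_EFinP.
    under eq_integral do rewrite /= normr_id.
    rewrite ge0_integral_multiset//.
    by apply: (le_lt_trans (sum_le_nneseries _ uB)) (ltry _) => n; rewrite mulr_ge0.
  have iu : mu.-integrable setT (EFin \o u) by exact: le_Rintegrable mu' inn _.
  have ip : mu.-integrable setT (EFin \o (fun z => `|u z| + u z)).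
    by have := integrableD measurableT inn iu; apply: eq_integrable.
  have -> : \int[mu]_z u z = \int[mu]_z (`|u z| + u z) - \int[mu]_z `|u z|.
    by rewrite -RintegralB//; apply: eq_Rintegral => z _; ring.
  have icn : (@counting nat R).-integrable setT (EFin \o (fun n => (mmult n)%:R * `|u (e n)|)).
    by apply: sum_le_integrable uB => n; rewrite mulr_ge0.
  have icu : (@counting nat R).-integrable setT (EFin \o (fun n => (mmult n)%:R * u (e n))).
    apply: le_Rintegrable icn _ => // n; rewrite normrM ger0_norm//.
  rewrite !ge//; last 2 first.
    exact: measurable_funD.
    by move=> z; have := ler_norm (- u z); rewrite normrN; lra.
  rewrite -RintegralB//; last first.
    have := integrableD measurableT icn icu; apply: eq_integrable => // n _ /=.
    by rewrite -EFinD mulrDr.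
  by apply: eq_Rintegral => n _; ring.
have nB (u : R[i] -> R) : (forall z, `|u z| <= normc z) ->
    sum_le (fun n => (mmult n)%:R * `|u (f (e n))|) B.
  move=> hu; apply: sum_leW sB => n; rewrite normcM normc_nat.
  by apply: ler_wpM2l.
apply: complex_eqP => /=.
  rewrite key//; last by apply: nB; exact: Re_le_normc.
  by apply: eq_Rintegral => n _; rewrite -(rmorph_nat (real_complex R)) Re_M /= mul0r subr0.
rewrite key//; last by apply: nB; exact: Im_le_normc.
by apply: eq_Rintegral => n _; rewrite -(rmorph_nat (real_complex R)) Im_M /= mul0r addr0.
Qed.

End multiset_integral.

Section density.
Context (R : realType) (H : R) (A : R[i] -> nat) (e : nat -> R[i]) (v : nat -> bool).
Hypothesis H0 : 0 <= H.
Hypothesis A_strip : msupp A `<=` strip H.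
Hypothesis A_ap : almost_periodic_multiset A.
Hypothesis eA : enumerates (msupp A) e v.
Local Notation mu := (multiset_measure A).
Local Notation mult := (mmult A e v).

Definition tent (a t : R) : R := Num.max 0 (a - `|t|).

(** A product of tents: Lipschitz, hence admissible in the definition of almost periodicity, and
    wide enough to be at least 1 wherever points are to be counted ([bump_ge1]). *)
Definition bump (z : R[i]) : R[i] := (tent 2 (complex.Re z) * tent (H + 2) (complex.Im z))%:C.

Lemma tent_ge0 a t : 0 <= tent a t.
Proof. by rewrite /tent le_max lexx. Qed.

Lemma tent_le a t : 0 <= a -> tent a t <= a.
Proof. by move=> a0; rewrite /tent ge_max a0 /=; have := normr_ge0 t; lra. Qed.

Lemma tent_neq0 a t : tent a t != 0 -> `|t| <= a.
Proof.
rewrite /tent; case: (leP `|t| a) => // ta.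
by rewrite max_l ?eqxx//; lra.
Qed.

Lemma tent_lip a t u : `|tent a t - tent a u| <= `|t - u|.
Proof.
have h1 : `|t| - `|u| <= `|t - u| by rewrite lerBlDr; have := ler_normD (t - u) u; rewrite subrK.
have h2 : `|u| - `|t| <= `|t - u|.
  by rewrite distrC lerBlDr; have := ler_normD (u - t) t; rewrite subrK.
have := normr_ge0 (t - u).
rewrite /tent ler_norml; case: (leP 0 (a - `|t|)) => c1; case: (leP 0 (a - `|u|)) => c2; lra.
Qed.

Lemma bump_loclip : loclip bump.
Proof.
move=> z; exists 1, (H + 4); split => // w _.
rewrite /bump -rmorphB normcR.
have -> : tent 2 (complex.Re w) * tent (H + 2) (complex.Im w) -
   tent 2 (complex.Re z) * tent (H + 2) (complex.Im z) =
  tent 2 (complex.Re w) * (tent (H + 2) (complex.Im w) - tent (H + 2) (complex.Im z)) +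
  (tent 2 (complex.Re w) - tent 2 (complex.Re z)) * tent (H + 2) (complex.Im z) by ring.
apply: (le_trans (ler_normD _ _)); rewrite !normrM.
rewrite (ger0_norm (tent_ge0 2 _)) (ger0_norm (tent_ge0 (H + 2) _)).
have -> : (H + 4) * normc (w - z) = 2 * normc (w - z) + normc (w - z) * (H + 2) by ring.
apply: lerD; apply: ler_pM; rewrite ?tent_ge0 ?normr_ge0//.
- by rewrite tent_le.
- by apply: (le_trans (tent_lip _ _ _)); rewrite -Im_B Im_le_normc.
- by apply: (le_trans (tent_lip _ _ _)); rewrite -Re_B Re_le_normc.
- by apply: tent_le; rewrite addr_ge0.
Qed.

Lemma bump_neq0 z : bump z != 0 -> box 2 (H + 2) z.
Proof.
move=> b0; have : tent 2 (complex.Re z) * tent (H + 2) (complex.Im z) != 0.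
  by apply: contraNneq b0; rewrite /bump => ->.
by rewrite mulf_eq0 negb_or => /andP[/tent_neq0 h1 /tent_neq0 h2].
Qed.

Lemma bump_compact : compactly_supported bump.
Proof.
apply: (subclosed_compact _ (box_compact (a := 2) (b := H + 2))); first exact: closed_closure.
rewrite [X in _ `<=` X](closure_id (box 2 (H + 2))).1; last exact: box_closed.
by apply: closure_subset => z /= /bump_neq0.
Qed.

Lemma bump_ge1 z : `|complex.Re z| <= 1 -> `|complex.Im z| <= H -> 1 <= complex.Re (bump z).
Proof.
move=> h1 h2; rewrite /bump /= -[1]mulr1; apply: ler_pM => //.
  by rewrite /tent le_max; apply/orP; right; lra.
by rewrite /tent le_max; apply/orP; right; lra.
Qed.

Lemma bump_Re_ge0 z : 0 <= complex.Re (bump z).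
Proof. by rewrite /bump /= mulr_ge0 ?tent_ge0. Qed.

Lemma mmult_neq0 n : mult n != 0%N -> v n.
Proof. by rewrite /mmult; case: (v n). Qed.

Lemma convolution_bump_sum x : exists N0 : nat, forall N, (N0 <= N)%N ->
  convolution bump mu x = \sum_(n < N) (mult n)%:R * bump (x - e n).
Proof.
have [lfA _] := A_ap.
set K := box (`|complex.Re x| + 2) (`|complex.Im x| + (H + 2)).
have fK : finite_set (msupp A `&` K) by apply: lfA; exact: box_compact.
have [N0 hN0] := enumerates_bound eA (fset_set (msupp A `&` K)).
have van n : (N0 <= n)%N -> (mult n)%:R * bump (x - e n) = 0.
  move=> Nn; apply/eqP; rewrite mulf_eq0; apply/orP; case: (boolP (v n)) => vn; last first.
    by left; rewrite /mmult (negbTE vn).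
  right; apply/negPn/negP => /bump_neq0 [h1 h2].
  have [vD vi _] := eA; have sn := vD n vn.
  have Kn : K (e n).
    split.
      have -> : complex.Re (e n) = complex.Re x - complex.Re (x - e n).
        by rewrite Re_B; ring.
      by apply: (le_trans (ler_normB _ _)); rewrite lerD2l.
    have -> : complex.Im (e n) = complex.Im x - complex.Im (x - e n).
      by rewrite Im_B; ring.
    by apply: (le_trans (ler_normB _ _)); rewrite lerD2l.
  have eX : e n \in fset_set (msupp A `&` K) by rewrite in_fset_set// mem_set.
  have [m vm [mN em]] := hN0 N0 (leqnn _) (e n) eX sn.
  by move: mN; rewrite (vi m n vm vn em) ltnNge Nn.
exists N0 => N N0N.
have van' n : (N <= n)%N -> (mult n)%:R * bump (x - e n) = 0.
  by move=> Nn; apply: van; exact: leq_trans Nn.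
rewrite /convolution (integral_multiset eA (f := fun w => bump (x - w))).
- exact: csum_finite van'.
- apply: loclip_measurable => z; have [r [L [r0 h]]] := bump_loclip (x - z).
  exists r, L; split => // w wr; have := h (x - w).
  have -> : x - w - (x - z) = - (w - z) by ring.
  by rewrite normcN; exact.
- exact: csummable_finite van'.
Qed.

(** Some almost period carries a given real point into [0, L], changing the value by less than 1,
    and continuity gives a maximum on that segment. *)
Lemma convolution_bump_bounded : exists M : R, forall x : R,
  complex.Re (convolution bump mu (x +i* 0)) <= M.
Proof.
have [_ ap] := A_ap.
have [cg /(_ 0 1 1 ltr01 ltr01) [L hL]] := ap bump (loclip_continuous bump_loclip) bump_compact.
set g := convolution bump mu in cg hL *.
have L0 : 0 <= L by have [tau _ ?] := hL 0; lra.
pose u x := complex.Re (g (x +i* 0)).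
have cu : {within `[0, L]%classic, continuous u}.
  apply: continuous_subspaceT => x.
  apply/cvgrPdist_lt => eps eps0.
  have epsC : 0 < eps%:C by rewrite ltcR.
  have := cg (x +i* 0); move=> /cvgrPdist_lt /(_ _ epsC).
  move=> /nearP_normc [d d0 hd].
  apply/nbhs_ballP; exists d => // y; rewrite /ball /= => yd.
  have e1 : (y +i* 0) - (x +i* 0) = (y - x)%:C.
    by apply: complex_eqP; rewrite /= ?subrr.
  have := hd (y +i* 0); rewrite e1 normcR distrC => /(_ yd).
  rewrite normcE ltcR; apply: le_lt_trans.
  by rewrite /u -Re_B; exact: Re_le_normc.
have [c _ hc] := EVT_max L0 cu.
exists (u c + 1) => x; suff : u x <= u c + 1 by [].
have [tau /= htau /andP[t1 t2]] := hL (- x).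
have h3 : normc (g ((x + tau) +i* 0) - g (x +i* 0)) < 1.
  rewrite -lte_fin; apply: le_lt_trans htau; apply: ereal_sup_ubound.
  by exists (x, 0) => //=; rewrite lexx ler01.
have h4 : u (x + tau) <= u c by apply: hc; rewrite in_itv /=; lra.
have := Re_le_normc (g ((x + tau) +i* 0) - g (x +i* 0)).
rewrite Re_B ler_norml -/(u (x + tau)) -/(u x) => /andP[h5 h6]; lra.
Qed.

Lemma unit_box_count : exists M : R, forall x N,
  \sum_(n < N | `|complex.Re (e n) - x| <= 1) (mult n)%:R <= M.
Proof.
have [M hM] := convolution_bump_bounded; exists M => x N.
apply: le_trans (hM x); have [N0 hN0] := convolution_bump_sum (x +i* 0).
rewrite (hN0 (maxn N N0) (leq_maxr _ _)) Re_sum.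
have E n : complex.Re ((mult n)%:R * bump ((x +i* 0) - e n)) =
    (mult n)%:R * complex.Re (bump ((x +i* 0) - e n)).
  by rewrite -(rmorph_nat (real_complex R)) Re_M /= mul0r subr0.
rewrite (eq_bigr _ (fun (i : 'I_(maxn N N0)) _ => E i)).
rewrite -(big_mkord xpredT (fun n => (mult n)%:R * complex.Re (bump ((x +i* 0) - e n)))).
rewrite (big_cat_nat (leq0n N) (leq_maxl N N0)) /= big_mkord.
have t0 : 0 <= \sum_(N <= n < maxn N N0) (mult n)%:R * complex.Re (bump ((x +i* 0) - e n)).
  by apply: sumr_ge0 => n _; rewrite mulr_ge0 ?bump_Re_ge0.
apply: (@le_trans _ _ (\sum_(n < N) (mult n)%:R * complex.Re (bump ((x +i* 0) - e n)))); last lra.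
rewrite big_mkcond; apply: ler_sum => n _; case: ifP => h; last first.
  by rewrite mulr_ge0 ?bump_Re_ge0.
have [->|m0] := eqVneq (mult n) 0%N; first by rewrite mul0r.
rewrite ler_peMr//; have vn := mmult_neq0 m0; have [vD _ _] := eA.
apply: bump_ge1; first by rewrite Re_B /= distrC.
by rewrite Im_B /= sub0r normrN; exact: A_strip (vD n vn).
Qed.

(** The default 0 lies in the strip, so distance estimates hold for every index, including those of
    multiplicity 0. *)
Definition mpt n : R[i] := if v n then e n else 0.

Variable P : R.
Hypothesis PH : H + 1 <= P.

Lemma mpt_dist n : 1 <= normc ((0 +i* P) - mpt n).
Proof.
apply: le_trans (Im_le_normc _); rewrite Im_B /=.
have h : `|complex.Im (mpt n)| <= H.
  rewrite /mpt; case: (boolP (v n)) => vn; last by rewrite normr0.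
  by have [vD _ _] := eA; exact: A_strip (vD n vn).
apply: le_trans (ler_norm _); have := ler_norm (complex.Im (mpt n)); have := PH; lra.
Qed.

(** Points are sorted by the integer part j of the modulus of their real part. One class lies within
    horizontal distance 1 of j + 1/2 or of its opposite, so it counts at most [2 * M] by
    [unit_box_count]. *)
Lemma inv_sq_summable : exists S, sum_le (inv_sq (0 +i* P) mpt mult) S.
Proof.
have [M hM] := unit_box_count; exists (12 * M) => N.
pose k n := Num.truncn `|complex.Re (e n)|.
(* A telescoping majorant: it equals 6/((j + 1)(j + 2)), hence is at least 1/(1 + j^2), and its sum
   is at most 6, whence [12 * M]. *)
pose b (j : nat) : R := 6 * (j.+1%:R^-1 - j.+2%:R^-1).
have b0 j : 0 <= b j.
  by rewrite mulr_ge0// subr_ge0 lef_pV2 ?posrE ?ltr0n// ler_nat.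
have T n : inv_sq (0 +i* P) mpt mult n <= (mult n)%:R * b (k n).
  rewrite /inv_sq; have [->|m0] := eqVneq (mult n) 0%N; first by rewrite !mul0r.
  have vn := mmult_neq0 m0; have [vD _ _] := eA.
  apply: ler_wpM2l => //.
  have kr : (k n)%:R <= `|complex.Re (e n)| by rewrite truncn_le.
  have h1 : 1 <= P - complex.Im (e n).
    have := A_strip (vD n vn); rewrite /strip /= => h.
    have := ler_norm (complex.Im (e n)); have := PH; lra.
  have k0 : 0 <= (k n)%:R :> R by [].
  have d1 : 1 + (k n)%:R ^+ 2 <= normc ((0 +i* P) - mpt n) ^+ 2.
    rewrite normc_sqr /mpt vn Re_B Im_B /= sub0r sqrrN addrC; apply: lerD.
      rewrite -(real_normK (num_real (complex.Re (e n)))).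
      by rewrite lerXn2r ?nnegrE.
    by rewrite expr_ge1//; lra.
  have q0 : 0 < 1 + (k n)%:R ^+ 2 :> R by have := sqr_ge0 ((k n)%:R : R); lra.
  apply: (@le_trans _ _ (1 + (k n)%:R ^+ 2)^-1).
    by rewrite lef_pV2 ?posrE// (lt_le_trans q0).
  have -> : b (k n) = 6 / ((1 + (k n)%:R) * (2 + (k n)%:R)).
    rewrite /b -[(k n).+2%:R]natr1 -natr1; field.
    by rewrite !gt_eqF//; lra.
  rewrite ler_pdivlMr; last by rewrite mulr_gt0//; lra.
  rewrite mulrC ler_pdivrMr//.
  have := sqr_ge0 ((k n)%:R - 1 : R); rewrite !expr2; nra.
apply: (@le_trans _ _ (\sum_(n < N) (mult n)%:R * b (k n))).
  by apply: ler_sum => n _; exact: T.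
pose K := (\max_(n < N) k n).+1.
have E (n : 'I_N) : (mult n)%:R * b (k n) =
    \sum_(j < K) (if k n == j then (mult n)%:R * b j else 0).
  have kK : (k n < K)%N by rewrite ltnS; exact: (@leq_bigmax _ (fun n : 'I_N => k n)).
  rewrite (bigD1 (Ordinal kK))//= eqxx big1 ?addr0// => j.
  by case: (eqVneq (k n) j) => // kj /eqP; case; exact: val_inj.
under eq_bigr do rewrite E.
rewrite exchange_big /=.
apply: (@le_trans _ _ (\sum_(j < K) (2 * M) * b j)).
  apply: ler_sum => j _.
  rewrite -big_mkcond -mulr_suml; apply: ler_wpM2r => //.
  have h1 := hM (j%:R + 2^-1) N; have h2 := hM (- (j%:R + 2^-1)) N.
  apply: (@le_trans _ _ (\sum_(n < N | `|complex.Re (e n) - (j%:R + 2^-1)| <= 1) (mult n)%:R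
    + \sum_(n < N | `|complex.Re (e n) - (- (j%:R + 2^-1))| <= 1) (mult n)%:R)); last lra.
  rewrite big_mkcond [X in _ <= X + _]big_mkcond [X in _ <= _ + X]big_mkcond -big_split /=.
  apply: ler_sum => n _; have m0 : 0 <= (mult n)%:R :> R by [].
  case: eqP => kj; last by apply: addr_ge0; case: ifP.
  have t1 : j%:R <= `|complex.Re (e n)| by rewrite -kj truncn_le.
  have t2 : `|complex.Re (e n)| < j%:R + 1 by rewrite -kj natr1 truncnS_gt.
  have [x0|x0] := leP 0 (complex.Re (e n)).
    rewrite ger0_norm// in t1 t2; rewrite ifT; last by rewrite ler_norml; lra.
    by rewrite lerDl; case: ifP.
  rewrite ltr0_norm// in t1 t2; rewrite addrC ifT; last by rewrite ler_norml; lra.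
  by rewrite lerDl; case: ifP.
rewrite -mulr_sumr /b -mulr_sumr.
have M0 : 0 <= M by have := hM 0 0%N; rewrite big_ord0.
have -> : 12 * M = 2 * M * (6 * 1) by ring.
apply: ler_wpM2l; first by rewrite mulr_ge0.
rewrite ler_pM2l//.
have -> : \sum_(j < K) (j.+1%:R^-1 - j.+2%:R^-1) = 1 - K.+1%:R^-1 :> R.
  elim: (K) => [|m IH]; first by rewrite big_ord0 invr1 subrr.
  by rewrite big_ord_recr /= IH; ring.
by rewrite lerBlDr lerDl invr_ge0.
Qed.

End density.

(** * Smooth cut-offs *)

Section smooth_functions.
Context (R : realType).
Implicit Types (f g : R -> R) (n : nat).

(** Derivatives are existential witnesses order by order, which makes closure under sums, products
    and inverses a plain induction; [smooth_derivable] converts to iterated derivatives. *)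
Fixpoint smoothN n f : Prop :=
  if n is n'.+1 then exists2 df : R -> R, forall x : R, is_derive x 1 f (df x) & smoothN n' df
  else True.

Definition smooth f := forall n, smoothN n f.

Lemma smoothN_le n f : smoothN n.+1 f -> smoothN n f.
Proof.
elim: n f => // n ih f [df hd sd]; exists df => //; exact: ih.
Qed.

Lemma derive1_is_derive f (df : R -> R) : (forall x : R, is_derive x 1 f (df x)) ->
  f^`()%classic = df.
Proof.
by move=> h; apply/funext => x; rewrite derive1E; exact: (@derive_val _ _ _ _ _ _ _ (h x)).
Qed.

Lemma smooth_derivable f : smooth f -> forall n x, derivable (derive1n n f) x 1.
Proof.
move=> sf n; have : smoothN n.+1 f by exact: sf.
elim: n f {sf} => [|n ih] f.
  by move=> [df hd _] x; have [] := hd x.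
move=> [df hd sd] x; have := ih df sd x.
by rewrite /derive1n iterSr (derive1_is_derive hd).
Qed.

Lemma smooth_derive f : smooth f -> exists2 df : R -> R, forall x : R, is_derive x 1 f (df x) & smooth df.
Proof.
move=> sf; have [df hd _] := sf 1%N; exists df => // n.
have [dg hg sg] := sf n.+1.
by rewrite -(derive1_is_derive hd) (derive1_is_derive hg).
Qed.

Lemma is_derive_continuous f (df : R -> R) : (forall x : R, is_derive x 1 f (df x)) -> continuous f.
Proof.
move=> h x; apply/differentiable_continuous/derivable1_diffP.
by have [] := h x.
Qed.

Lemma smooth_continuous f : smooth f -> continuous f.
Proof. by move=> /smooth_derive[df h _]; exact: is_derive_continuous h. Qed.

Lemma smoothN_cst n (c : R) : smoothN n (fun=> c).
Proof.
elim: n c => // n ih c; exists (fun=> 0) => [x|]; first exact: is_derive_cst.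
exact: ih.
Qed.

Lemma smoothND n f g : smoothN n f -> smoothN n g -> smoothN n (fun x => f x + g x).
Proof.
elim: n f g => // n ih f g [df hf sf] [dg hg sg].
exists (fun x => df x + dg x); last exact: ih.
by move=> x; exact: is_deriveD (hf x) (hg x).
Qed.

Lemma smoothNM n f g : smoothN n f -> smoothN n g -> smoothN n (fun x => f x * g x).
Proof.
elim: n f g => // n ih f g sf sg.
have [df hf sdf] := sf; have [dg hg sdg] := sg.
exists (fun x => f x * dg x + g x * df x) => [x|]; first exact: is_deriveM (hf x) (hg x).
by apply: smoothND; apply: ih => //; exact: smoothN_le.
Qed.

Lemma is_derive_comp_affine f (df a b x : R) : is_derive (a * x + b) 1 f df ->
  is_derive x 1 (fun x => f (a * x + b)) (a * df).
Proof.
move=> h; have := @is_derive1_comp R f (fun x => a * x + b) x df a h (is_derive_affine a b x).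
by rewrite mulrC.
Qed.

Lemma smoothN_affine n f (a b : R) : smoothN n f -> smoothN n (fun x => f (a * x + b)).
Proof.
elim: n f => // n ih f [df hf sf].
exists (fun x => a * df (a * x + b)) => [x|]; first exact: is_derive_comp_affine.
by apply: smoothNM; [exact: smoothN_cst|exact: ih].
Qed.

Lemma smoothNV n f : (forall x, f x != 0) -> smoothN n f -> smoothN n (fun x => (f x)^-1).
Proof.
move=> f0; elim: n => // n ih sf.
have := ih (smoothN_le sf) => si; have [df hf sdf] := sf.
exists (fun x => -1 * (f x)^-1 * (f x)^-1 * df x) => [x|].
  have := is_deriveV (f0 x) (hf x).
  suff -> : - f x ^- 2 *: df x = -1 * (f x)^-1 * (f x)^-1 * df x by [].
  by rewrite -[_ *: _]/(_ * _) mulN1r expr2 invfM !mulNr.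
by do 3?apply: smoothNM => //; exact: smoothN_cst.
Qed.

Lemma smoothN_expR n : smoothN n (@expR R).
Proof. by elim: n => // n ih; exists (@expR R) => // x; exact: is_derive_expR. Qed.

Lemma smoothN_sincos n : smoothN n (@sin R) /\ smoothN n (@cos R).
Proof.
elim: n => // n [sn cn]; split.
  by exists (@cos R) => // x; exact: is_derive_sin.
exists (fun x => -1 * sin x).
  by move=> x; rewrite mulN1r; exact: is_derive_cos.
by apply: smoothNM => //; exact: smoothN_cst.
Qed.

Lemma is_derive_sq f (a K : R) : (forall x, `|f x - f a| <= K * (x - a) ^+ 2) ->
  is_derive a 1 f 0.
Proof.
move=> h.
have c : (fun t => t^-1 *: (f (t *: 1 + a) - f a)) @ 0^' --> (0 : R).
  apply/cvgrPdist_lt => e e0.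
  have K1 : 0 < `|K| + 1 by have := normr_ge0 K; lra.
  apply/nbhs_ballP; exists (e / (`|K| + 1)) => /=; first exact: divr_gt0.
  move=> t; rewrite /ball /= sub0r normrN => ht tn0.
  rewrite sub0r normrN -[t *: 1]/(t * 1) mulr1 -[_ *: _]/(_ * _) normrM normfV.
  have t0 : 0 < `|t| by rewrite normr_gt0.
  rewrite mulrC ltr_pdivrMr//; apply: (le_lt_trans (h _)); rewrite addrK.
  rewrite -real_normK ?num_real// expr2 mulrA ltr_pM2r//.
  apply: (@le_lt_trans _ _ ((`|K| + 1) * `|t|)).
    by apply: ler_wpM2r; [exact: ltW|have := ler_norm K; lra].
  by rewrite mulrC -ltr_pdivlMr.
apply: DeriveDef; first by apply/cvg_ex; exists 0.
exact: cvg_lim c.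
Qed.

Lemma horner_expR_bound (p : {poly R}) :
  exists2 K : R, 0 <= K & forall x : R, 0 <= x -> `|p.[x]| <= K * expR x.
Proof.
exists (\sum_(i < size p) `|p`_i| * i`!%:R); first by apply: sumr_ge0 => i _; rewrite mulr_ge0.
move=> x x0; rewrite horner_coef mulr_suml; apply: (le_trans (ler_norm_sum _ _ _)).
apply: ler_sum => i _; rewrite normrM -mulrA; apply: ler_wpM2l => //.
rewrite ger0_norm ?exprn_ge0// mulrC -ler_pdivrMr ?ltr0n ?fact_gt0//.
case: (nat_of_ord i) => [|k]; first by rewrite expr0 fact0 divr1; exact: le1_expR.
by apply: le_trans (expR_ge1Dxn k x0); rewrite lerDr.
Qed.

(** The functions p(1/t) e^{-1/t} extended by 0 form a family closed under differentiation, which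
    replaces p by X^2 (p - p'). *)
Definition flat (p : {poly R}) (t : R) : R :=
  if 0 < t then p.[t^-1] * expR (- t^-1) else 0.

(** Exponential domination of the polynomial [p * 'X^2] leaves a factor [t ^+ 2]; by [is_derive_sq]
    the derivative at 0 is then 0. *)
Lemma flat_sq p : exists K : R, forall t, `|flat p t| <= K * t ^+ 2.
Proof.
have [K K0 hK] := horner_expR_bound (p * 'X^2).
exists K => t; rewrite /flat; case: ifP => t0; last by rewrite normr0 mulr_ge0 ?sqr_ge0.
have i0 : 0 < t^-1 by rewrite invr_gt0.
have := hK _ (ltW i0); rewrite hornerM hornerXn normrM (ger0_norm (sqr_ge0 _)).
rewrite normrM (ger0_norm (expR_ge0 _)) expRN -ler_pdivlMr ?exprn_gt0// => h.
rewrite ler_pdivrMr ?expR_gt0//; apply: (le_trans h).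
by rewrite -exprVn invrK mulrAC.
Qed.

Lemma is_derive_flat p (x : R) : is_derive x 1 (flat p) (flat ('X^2 * (p - p^`())) x).
Proof.
have [x0|x0|->] := ltgtP x 0.
- have -> : flat ('X^2 * (p - p^`())) x = 0 by rewrite /flat ltNge (ltW x0).
  apply: (near_eq_is_derive _ (is_derive_cst (0 : R) x 1)).
  by near=> t; rewrite /flat ltNge ltW//; near: t; exact: lt_nbhsl.
- have xn : x != 0 by rewrite gt_eqF.
  have dV := is_deriveV xn (is_derive_id x (1 : R)).
  have d1 := @is_derive1_comp R (horner p) (fun t => t^-1) x _ _ (is_derive_poly p x^-1) dV.
  have d2 := @is_derive1_comp R (@expR R) (fun t => - t^-1) x _ _ (is_derive_expR (- x^-1))
    (is_deriveN dV).
  have := is_deriveM d1 d2; set l := (X in is_derive _ _ _ X) => h.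
  have -> : flat ('X^2 * (p - p^`())) x = l.
    have -> : l = p.[x^-1] * (expR (- x^-1) * - (- x ^- 2 * 1)) + expR (- x^-1) * (p^`().[x^-1] * (- x ^- 2 * 1)) by [].
    rewrite /flat x0 hornerM hornerD hornerN hornerXn -exprVn.
    set u := p.[_]; set w := _.[_]; ring.
  apply: near_eq_is_derive h.
  by near=> t; rewrite /flat ifT//; near: t; exact: lt_nbhsr.
- have -> : flat ('X^2 * (p - p^`())) 0 = 0 by rewrite /flat ltxx.
  have [K hK] := flat_sq p; apply: (@is_derive_sq _ _ K) => t.
  by rewrite {2}/flat ltxx !subr0.
Unshelve. all: by end_near. Qed.

Lemma smoothN_flat n p : smoothN n (flat p).
Proof.
elim: n p => // n ih p; exists (flat ('X^2 * (p - p^`()))) => // x; exact: is_derive_flat.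
Qed.

(** The usual smooth step from 0 to 1; the denominator is positive because [t] and [1 - t] are never
    both nonpositive. *)
Definition sstep (t : R) : R := flat 1 t / (flat 1 t + flat 1 (1 - t)).

Lemma flat1_ge0 t : 0 <= flat 1 t.
Proof. by rewrite /flat; case: ifP => // _; rewrite hornerE mul1r expR_ge0. Qed.

Lemma flat1_gt0 t : 0 < t -> 0 < flat 1 t.
Proof. by move=> t0; rewrite /flat t0 hornerE mul1r expR_gt0. Qed.

Lemma flat1_le0 t : t <= 0 -> flat 1 t = 0.
Proof. by move=> t0; rewrite /flat ltNge t0. Qed.

Lemma flat1_denom t : 0 < flat 1 t + flat 1 (1 - t).
Proof.
case: (ltP 0 t) => t0.
  by rewrite ltr_wpDr// ?flat1_gt0// flat1_ge0.
by rewrite ltr_wpDl// ?flat1_gt0// ?flat1_ge0//; lra.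
Qed.

Lemma sstep_smooth : smooth sstep.
Proof.
move=> n; apply: smoothNM; first exact: smoothN_flat.
apply: smoothNV; first by move=> t; rewrite gt_eqF// flat1_denom.
apply: smoothND; first exact: smoothN_flat.
have := @smoothN_affine n (flat 1) (-1) 1 (smoothN_flat n 1).
by under eq_fun do rewrite mulN1r (addrC _ 1).
Qed.

Lemma sstep0 t : t <= 0 -> sstep t = 0.
Proof. by move=> t0; rewrite /sstep flat1_le0// mul0r. Qed.

Lemma sstep1 t : 1 <= t -> sstep t = 1.
Proof.
move=> t1; rewrite /sstep (@flat1_le0 (1 - t)); last lra.
by rewrite addr0 divff// gt_eqF// flat1_gt0//; lra.
Qed.

Lemma sstep_ge0 t : 0 <= sstep t.
Proof. by rewrite divr_ge0 ?flat1_ge0// ltW// flat1_denom. Qed.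

Lemma sstep_le1 t : sstep t <= 1.
Proof. by rewrite ler_pdivrMr ?flat1_denom// mul1r lerDl flat1_ge0. Qed.

End smooth_functions.

Section smooth_complex.
Context (R : realType).
Implicit Types (f g : R -> R[i]).

Definition csmooth f :=
  smooth (fun t => complex.Re (f t)) /\ smooth (fun t => complex.Im (f t)).

Lemma csmooth_cst (c : R[i]) : csmooth (fun=> c).
Proof. by split => n; exact: smoothN_cst. Qed.

Lemma csmoothD f g : csmooth f -> csmooth g -> csmooth (fun t => f t + g t).
Proof.
move=> [fr fi] [gr gi]; split => n.
  by under eq_fun do rewrite Re_D; exact: smoothND.
by under eq_fun do rewrite Im_D; exact: smoothND.
Qed.

Lemma csmoothM f g : csmooth f -> csmooth g -> csmooth (fun t => f t * g t).
Proof.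
move=> [fr fi] [gr gi]; split => n.
  under eq_fun do rewrite Re_M -mulN1r.
  by apply: smoothND; first exact: smoothNM; do 2?apply: smoothNM; rewrite //; exact: smoothN_cst.
by under eq_fun do rewrite Im_M; apply: smoothND; exact: smoothNM.
Qed.

Lemma csmoothR (u : R -> R) : smooth u -> csmooth (fun t => (u t)%:C).
Proof. by move=> su; split => // n; exact: smoothN_cst. Qed.

Lemma csmooth_character (z : R[i]) : csmooth (fun t => character t z).
Proof.
pose a := - (2 * pi * complex.Im z); pose c := 2 * pi * complex.Re z.
(* The summands [+ 0] give the arguments the affine form expected by [smoothN_affine]. *)
have h t : character t z = (expR (a * t + 0))%:C * (cos (c * t + 0) +i* sin (c * t + 0)).
  rewrite /character /cexp Re_M Im_M; congr (_%:C * (cos _ +i* sin _)); rewrite /= /a /c.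
  - by congr expR; ring.
  - by ring.
  - by ring.
under eq_fun do rewrite h.
apply: csmoothM; first by apply: csmoothR => n; apply: smoothN_affine; exact: smoothN_expR.
have sc n := @smoothN_sincos R n.
by split => n; apply: smoothN_affine; have [] := sc n.
Qed.

Lemma csmooth_ccontinuous f : csmooth f -> ccontinuous f.
Proof. by move=> [r i]; split; exact: smooth_continuous. Qed.

Lemma test_function_csmooth f (M : R) : csmooth f -> (forall t, M < `|t| -> f t = 0) ->
  test_function f.
Proof.
move=> [sr si] f0; split; [|exact: smooth_derivable..].
apply: (@subclosed_compact _ _ `[- M, M]%classic).
- exact: closed_closure.
- exact: segment_compact.
rewrite (closure_id `[- M, M]%classic).1; last exact: itv_closed.
apply: closureS => t /= /eqP ft; rewrite in_itv /= -ler_norml leNgt.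
by apply/negP => /f0.
Qed.

Definition cis_derive f (t : R) (l : R[i]) :=
  is_derive t 1 (fun t => complex.Re (f t)) (complex.Re l) /\
  is_derive t 1 (fun t => complex.Im (f t)) (complex.Im l).

Lemma cis_deriveM f g t l k : cis_derive f t l -> cis_derive g t k ->
  cis_derive (fun t => f t * g t) t (l * g t + f t * k).
Proof.
move=> [fr fi] [gr gi]; split.
  have -> : (fun t => complex.Re (f t * g t)) = (fun t => complex.Re (f t)) *
      (fun t => complex.Re (g t)) - (fun t => complex.Im (f t)) * (fun t => complex.Im (g t)).
    by apply/funext => x; rewrite Re_M.
  apply: (is_derive_eq (is_deriveB (is_deriveM fr gr) (is_deriveM fi gi))).
  by rewrite Re_D !Re_M -![_ *: _]/(_ * _); ring.
have -> : (fun t => complex.Im (f t * g t)) = (fun t => complex.Re (f t)) *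
    (fun t => complex.Im (g t)) + (fun t => complex.Im (f t)) * (fun t => complex.Re (g t)).
  by apply/funext => x; rewrite Im_M.
apply: (is_derive_eq (is_deriveD (is_deriveM fr gi) (is_deriveM fi gr))).
by rewrite Im_D !Im_M -![_ *: _]/(_ * _); ring.
Qed.

Lemma cis_deriveR (u du : R -> R) (t : R) : is_derive t 1 u (du t) ->
  cis_derive (fun t => (u t)%:C) t (du t)%:C.
Proof. by move=> h; split => //; exact: is_derive_cst. Qed.

Lemma cis_derive_character (z : R[i]) (t : R) :
  cis_derive (fun t => character t z) t ((0 +i* (2 * pi)) * z * character t z).
Proof.
pose a := - (2 * pi * complex.Im z); pose c := 2 * pi * complex.Re z.
have h t' : character t' z = (expR (a * t' + 0))%:C * (cos (c * t' + 0) +i* sin (c * t' + 0)).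
  rewrite /character /cexp Re_M Im_M; congr (_%:C * (cos _ +i* sin _)); rewrite /= /a /c.
  - by congr expR; ring.
  - by ring.
  - by ring.
have hf : (fun t => character t z) = (fun t => (expR (a * t + 0))%:C *
    (cos (c * t + 0) +i* sin (c * t + 0))) by apply/funext => t'; exact: h.
rewrite hf h; have -> : (0 +i* (2 * pi)) * z = a +i* c.
  by apply: complex_eqP; rewrite ?Re_M ?Im_M /= /a /c; ring.
set E := (expR _)%:C; set T := cos _ +i* sin _.
have -> : (a +i* c) * (E * T) = (a * expR (a * t + 0))%:C * T + E * ('i%C * c%:C * T).
  rewrite /E; have -> : a +i* c = a%:C + 'i%C * c%:C by apply: complex_eqP => /=; ring.
  have -> : (a * expR (a * t + 0))%:C = a%:C * (expR (a * t + 0))%:C :> R[i].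
    by apply: complex_eqP => /=; ring.
  by ring.
apply: (@cis_deriveM (fun t => (expR (a * t + 0))%:C)
  (fun t => cos (c * t + 0) +i* sin (c * t + 0)) t (a * expR (a * t + 0))%:C).
  exact: (@cis_deriveR (fun t => expR (a * t + 0)) (fun t => a * expR (a * t + 0)) t
    (@is_derive_comp_affine R expR _ a 0 t (is_derive_expR _))).
split.
  have h1 := @is_derive_comp_affine R cos (- sin (c * t + 0)) c 0 t (is_derive_cos _).
  have e1 : c * - sin (c * t + 0) = complex.Re ('i%C * c%:C * T).
    by rewrite !Re_M /T /=; ring.
  by rewrite -e1; exact: h1.
have h1 := @is_derive_comp_affine R sin (cos (c * t + 0)) c 0 t (is_derive_sin _).
have e1 : c * cos (c * t + 0) = complex.Im ('i%C * c%:C * T).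
  by rewrite !Im_M /T /=; ring.
by rewrite -e1; exact: h1.
Qed.

End smooth_complex.

Section windows.
Context (R : realType).
Local Notation mu := (@lebesgue_measure R).
Implicit Types (u : R -> R) (M : R).

Lemma integrable_window u M : continuous u -> (forall t, M < `|t| -> u t = 0) ->
  mu.-integrable setT (EFin \o u).
Proof.
move=> cu u0.
have -> : EFin \o u = (EFin \o u) \_ `[- M, M]%classic.
  apply/funext => t; rewrite patchE; case: ifPn => //.
  rewrite notin_setE /= in_itv /= -ler_norml => /negP; rewrite -ltNge => /u0 /= -> //.
have h := @continuous_compact_integrable _ u `[- M, M]%classic (@segment_compact _ _ _)
  (continuous_subspaceT cu).
exact: (integrable_mkcond _ _).1 h.
Qed.

Lemma Rintegral_derive u du M : 0 < M -> (forall t : R, is_derive t 1 u (du t)) -> continuous du ->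
  (forall t, M < `|t| -> du t = 0) -> \int[mu]_t du t = u M - u (- M).
Proof.
move=> M0 hd cd d0.
have -> : du = du \_ `[- M, M]%classic.
  apply/funext => t; rewrite patchE; case: ifPn => //.
  by rewrite notin_setE /= in_itv /= -ler_norml => /negP; rewrite -ltNge => /d0.
have cu := is_derive_continuous hd.
rewrite -Rintegral_mkcond /Rintegral (@continuous_FTC2 _ du u)//.
- by rewrite gtrN.
- exact: continuous_subspaceT.
- split; first by move=> t _; have [] := hd t.
    by apply: cvg_at_right_filter; exact: cu.
  by apply: cvg_at_left_filter; exact: cu.
- by move=> t _; rewrite (derive1_is_derive hd).
Qed.

End windows.

(** * Transforms of cut-offs *)

Section window_transform.
Context (R : realType).
Local Notation mu := (@lebesgue_measure R).
Implicit Types (u : R -> R) (M : R) (z : R[i]).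

(** The sign in the exponent is positive: the value at [z - a] is the c-Fourier transform at [a] of
    u(t) e^{2 pi i t z}. *)
Definition wtransform u z : R[i] :=
  cintegral mu (fun t : R => (u t)%:C * character t z).

Definition window u M := continuous u /\ forall t, M < `|t| -> u t = 0.

Definition wmass u : R := \int[mu]_t `|u t|.

Lemma windowN u M : window u M -> window (fun t => `|u t|) M.
Proof.
move=> [cu u0]; split; last by move=> t /u0 ->; rewrite normr0.
by move=> t; apply: continuous_comp; [exact: cu|exact: norm_continuous].
Qed.

Lemma wmass_ge0 u : 0 <= wmass u.
Proof. by apply: Rintegral_ge0 => t _. Qed.

Lemma window_measurable u M (f : R -> R[i]) : window u M -> csmooth f ->
  @cmeasurable _ (measurableTypeR R) R (fun t => (u t)%:C * f t).
Proof.
move=> [cu u0] /csmooth_ccontinuous[cr ci]; apply: ccontinuous_measurable; split.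
  have -> : (fun t => complex.Re ((u t)%:C * f t)) = (fun t => u t * complex.Re (f t)).
    by apply/funext => t; rewrite Re_M /= mul0r subr0.
  by move=> t; apply: cvgM; [exact: cu|exact: cr].
have -> : (fun t => complex.Im ((u t)%:C * f t)) = (fun t => u t * complex.Im (f t)).
  by apply/funext => t; rewrite Im_M /= mul0r addr0.
by move=> t; apply: cvgM; [exact: cu|exact: ci].
Qed.

Lemma window_cintegral u M (f : R -> R[i]) (C : R) : window u M -> csmooth f ->
  (forall t, `|t| <= M -> normc (f t) <= C) ->
  cintegrable mu (fun t => (u t)%:C * f t) /\
  normc (cintegral mu (fun t => (u t)%:C * f t)) <= wmass u * C.
Proof.
move=> wu sf fC.
have iu : mu.-integrable setT (EFin \o (fun t => `|u t|)).
  by have [c0 z0] := windowN wu; exact: integrable_window z0.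
have iC : mu.-integrable setT (EFin \o (fun t => C * `|u t|)).
  by apply: eq_integrable (integrableZl measurableT C iu).
have le t : normc ((u t)%:C * f t) <= C * `|u t|.
  rewrite normcM normcR mulrC; case: (leP `|t| M) => tM.
    by apply: ler_wpM2r => //; exact: fC.
  by have [_ /(_ t tM) ->] := wu; rewrite normr0 !mulr0.
have ji : cintegrable mu (fun t => (u t)%:C * f t).
  by apply: cintegrable_dom iC le; exact: window_measurable wu sf.
split=> //; apply: (le_trans (normc_cintegral_le ji iC le)).
by rewrite RintegralZl// mulrC.
Qed.

Lemma normc_character_le (t M : R) z : `|t| <= M ->
  normc (character t z) <= expR (2 * pi * M * `|complex.Im z|).
Proof.
move=> tM; rewrite normc_character ler_expR.
apply: (le_trans (ler_norm _)); rewrite normrN !normrM.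
rewrite (ger0_norm (pi_ge0 R)) (@ger0_norm _ 2)//.
apply: ler_wpM2r => //; apply: ler_wpM2l => //.
by apply: mulr_ge0 => //; exact: pi_ge0.
Qed.

Lemma character_sub1_le (t M : R) z : `|t| <= M ->
  normc (character t z - 1) <= 5 * (2 * pi * M * normc z) * expR (2 * (2 * pi * M * normc z)).
Proof.
move=> tM; rewrite /character; apply: (le_trans (cexp_sub1_le _)).
have h : normc ((0 +i* (2 * pi * t)) * z) <= 2 * pi * M * normc z.
  rewrite normcM normc_i !normrM (ger0_norm (pi_ge0 R)) (@ger0_norm _ 2)//.
  apply: ler_wpM2r; first exact: normc_ge0.
  by apply: ler_wpM2l => //; apply: mulr_ge0 => //; exact: pi_ge0.
have n0 := normc_ge0 ((0 +i* (2 * pi * t)) * z).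
apply: ler_pM; [lra|exact: expR_ge0|lra|by rewrite ler_expR; lra].
Qed.

Section one_window.
Context (u : R -> R) (M : R).
Hypothesis wu : window u M.

Lemma wtransform_integrable z : cintegrable mu (fun t => (u t)%:C * character t z).
Proof.
by have [] := window_cintegral wu (csmooth_character z)
  (fun t (h : `|t| <= M) => normc_character_le z h).
Qed.

Lemma wtransform_bound z :
  normc (wtransform u z) <= wmass u * expR (2 * pi * M * `|complex.Im z|).
Proof.
by have [] := window_cintegral wu (csmooth_character z)
  (fun t (h : `|t| <= M) => normc_character_le z h).
Qed.

Lemma wtransform_diff z w : normc (wtransform u (z + w) - wtransform u z) <=
  wmass u * (expR (2 * pi * M * `|complex.Im z|) *
    (5 * (2 * pi * M * normc w) * expR (2 * (2 * pi * M * normc w)))).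
Proof.
rewrite /wtransform -cintegralB; try exact: wtransform_integrable.
have s1 : csmooth (fun t => character t z * (character t w - 1)).
  apply: csmoothM; first exact: csmooth_character.
  by apply: csmoothD; [exact: csmooth_character|exact: csmooth_cst].
have b t : `|t| <= M -> normc (character t z * (character t w - 1)) <=
    expR (2 * pi * M * `|complex.Im z|) *
    (5 * (2 * pi * M * normc w) * expR (2 * (2 * pi * M * normc w))).
  move=> tM; rewrite normcM; apply: ler_pM; try exact: normc_ge0.
    exact: normc_character_le.
  exact: character_sub1_le.
have [_] := window_cintegral wu s1 b.
suff -> : cintegral mu (fun t => (u t)%:C * (character t z * (character t w - 1))) =
  cintegral mu (fun x => (u x)%:C * character x (z + w) - (u x)%:C * character x z) by [].
apply: eq_cintegral => t; rewrite character_Dr.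
move: (character t z) (character t w) => a c; ring.
Qed.

Lemma wtransform_loclip (c : R[i]) : 0 <= M -> loclip (fun a => wtransform u (c - a)).
Proof.
move=> M0 a; exists 1, (wmass u * (expR (2 * pi * M * `|complex.Im (c - a)|) *
    (5 * (2 * pi * M) * expR (2 * (2 * pi * M))))); split=> // w w1.
have -> : c - w = (c - a) + - (w - a) by ring.
apply: (le_trans (wtransform_diff _ _)); rewrite normcN.
have n0 := normc_ge0 (w - a); have P0 : 0 <= 2 * pi * M.
  by apply: mulr_ge0 => //; apply: mulr_ge0 => //; exact: pi_ge0.
rewrite -[leRHS]mulrA; apply: ler_wpM2l; first exact: wmass_ge0.
rewrite -[leRHS]mulrA; apply: ler_wpM2l; first exact: expR_ge0.
move: (2 * pi * M) P0 => P P0.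
have -> : 5 * P * expR (2 * P) * normc (w - a) = 5 * (P * normc (w - a)) * expR (2 * P) by ring.
apply: ler_wpM2l; first by apply: mulr_ge0 => //; exact: mulr_ge0.
rewrite ler_expR; apply: ler_wpM2l => //.
by rewrite -[leRHS]mulr1; apply: ler_wpM2l => //; exact: ltW.
Qed.

End one_window.

Lemma wtransform_derive u du M z : 0 < M -> smooth u -> smooth du ->
  (forall t : R, is_derive t 1 u (du t)) -> window u M -> window du M ->
  (0 +i* (2 * pi)) * z * wtransform u z = - wtransform du z.
Proof.
move=> M0 su sdu hd wu wdu; apply/eqP; rewrite -subr_eq0 opprK; apply/eqP.
have cu := csmooth_character z.
rewrite /wtransform -cintegralZ; last exact: wtransform_integrable wu z.
rewrite -cintegralD; last 2 first.
- exact/cintegrableZ/(wtransform_integrable wu z).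
- exact: wtransform_integrable wdu z.
pose f t := (u t)%:C * character t z.
pose df t := (du t)%:C * character t z + (u t)%:C * ((0 +i* (2 * pi)) * z * character t z).
have fd t : cis_derive f t (df t).
  by apply: cis_deriveM; [exact: cis_deriveR|exact: cis_derive_character].
have sdf : csmooth df.
  apply: csmoothD; first by apply: csmoothM => //; exact: csmoothR.
  apply: csmoothM; first exact: csmoothR.
  by apply: csmoothM => //; exact: csmooth_cst.
have [_ u0] := wu; have [_ du0] := wdu.
(* The windows are known to vanish strictly beyond [M], so the boundary terms are taken at [M + 1]
   and its opposite. *)
have M1 : 0 < M + 1 by lra.
have M1M : M < `|M + 1| by rewrite ger0_norm; lra.
have M1N : M < `|- (M + 1)| by rewrite normrN.
have [cr ci] := csmooth_ccontinuous sdf.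
have df0 t : M + 1 < `|t| -> df t = 0.
  move=> ht; have {}ht : M < `|t| by lra.
  by rewrite /df u0// du0// !mul0r addr0.
have fM : f (M + 1) = 0 by rewrite /f u0// mul0r.
have fN : f (- (M + 1)) = 0 by rewrite /f u0// mul0r.
transitivity (cintegral mu df).
  apply: eq_cintegral => t; rewrite /df.
  by move: (0 +i* (2 * pi)) (character t z) ((u t)%:C) ((du t)%:C) => a c d e; ring.
have hr := @Rintegral_derive R (fun t => complex.Re (f t)) (fun t => complex.Re (df t))
  (M + 1) M1 (fun t => (fd t).1) cr (fun t h => congr1 (@complex.Re R) (df0 t h)).
have hi := @Rintegral_derive R (fun t => complex.Im (f t)) (fun t => complex.Im (df t))
  (M + 1) M1 (fun t => (fd t).2) ci (fun t h => congr1 (@complex.Im R) (df0 t h)).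
rewrite fM fN subrr in hr; rewrite fM fN subrr in hi.
by apply: complex_eqP; [exact: hr|exact: hi].
Qed.

End window_transform.

Section step_transform.
Context (R : realType).
Local Notation mu := (@lebesgue_measure R).
Implicit Types (z w : R[i]) (t : R).

Definition dstep : R -> R := (@sstep R)^`()%classic.
Definition ddstep : R -> R := dstep^`()%classic.

Lemma dstep_smooth : smooth dstep /\ forall t, is_derive t 1 (@sstep R) (dstep t).
Proof.
have [df h s] := smooth_derive (@sstep_smooth R).
by rewrite /dstep (derive1_is_derive h).
Qed.

Lemma ddstep_smooth : smooth ddstep /\ forall t, is_derive t 1 dstep (ddstep t).
Proof.
have [df h s] := smooth_derive dstep_smooth.1.
by rewrite /ddstep (derive1_is_derive h).
Qed.

Lemma near_derive0 (f df : R -> R) (c t d : R) : 0 < d -> (forall x : R, is_derive x 1 f (df x)) ->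
  (forall x, `|x - t| < d -> f x = c) -> df t = 0.
Proof.
move=> d0 hf fc; have h1 := @derive_val _ _ _ _ _ _ _ (hf t).
have h2 : is_derive t 1 f 0.
  apply: (near_eq_is_derive _ (is_derive_cst c t 1)).
  apply/nbhs_ballP; exists d => // x; rewrite /ball /= distrC => /fc -> //.
by rewrite -h1; exact: (@derive_val _ _ _ _ _ _ _ h2).
Qed.

Lemma dstep0 t : t < 0 -> dstep t = 0.
Proof.
move=> t0; apply: (@near_derive0 (@sstep R) dstep 0 t (- t)) dstep_smooth.2 _; first lra.
by move=> x; rewrite ltr_norml => /andP[_ h]; apply: sstep0; lra.
Qed.

Lemma dstep1 t : 1 < t -> dstep t = 0.
Proof.
move=> t0; apply: (@near_derive0 (@sstep R) dstep 1 t (t - 1)) dstep_smooth.2 _; first lra.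
by move=> x; rewrite ltr_norml => /andP[h _]; apply: sstep1; lra.
Qed.

Lemma window_dstep : window dstep 1.
Proof.
split; first exact: smooth_continuous dstep_smooth.1.
move=> t; rewrite ltr_normr => /orP[|] h; first exact: dstep1.
by apply: dstep0; lra.
Qed.

Lemma window_ddstep : window ddstep 1.
Proof.
split; first exact: smooth_continuous ddstep_smooth.1.
move=> t; rewrite ltr_normr => /orP[|] h.
  apply: (@near_derive0 dstep ddstep 0 t (t - 1)) ddstep_smooth.2 _; first lra.
  by move=> x; rewrite ltr_norml => /andP[h1 _]; apply: dstep1; lra.
apply: (@near_derive0 dstep ddstep 0 t (- t)) ddstep_smooth.2 _; first lra.
by move=> x; rewrite ltr_norml => /andP[_ h1]; apply: dstep0; lra.
Qed.

(** Transform of a density of total mass 1; the transforms of all cut-offs are expressed through it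
    by [cut_transform]. *)
Definition theta z := wtransform dstep z.

Lemma theta0 : theta 0 = 1.
Proof.
have h : \int[mu]_t dstep t = 1.
  have := Rintegral_derive (ltr0n R 2) dstep_smooth.2 window_dstep.1.
  rewrite sstep1 ?sstep0 ?subr0; [|lra|lra]; apply=> t h.
  by apply: window_dstep.2; lra.
have e t : (dstep t)%:C * character t 0 = (dstep t)%:C.
  by rewrite /character mulr0 cexp0 mulr1.
have -> : theta 0 = cintegral mu (fun t => (dstep t)%:C) .
  by rewrite /theta /wtransform; under eq_fun do rewrite e.
apply: complex_eqP => /=; first exact: h.
by rewrite /Rintegral integral0.
Qed.

Lemma pi2_ge1 : 1 <= 2 * pi :> R.
Proof. by have := pi_ge2 R; lra. Qed.

Lemma theta_bound z (V : R) : `|complex.Im z| <= V ->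
  normc (theta z) <= wmass dstep * expR (2 * pi * V).
Proof.
move=> zV; apply: (le_trans (wtransform_bound window_dstep z)).
apply: ler_wpM2l; first exact: wmass_ge0.
rewrite ler_expR mulr1; apply: ler_wpM2l => //; have := pi2_ge1; lra.
Qed.

Lemma theta_parts z : (0 +i* (2 * pi)) * z * theta z = - wtransform ddstep z.
Proof.
exact: (wtransform_derive z ltr01 dstep_smooth.1 ddstep_smooth.1 ddstep_smooth.2
  window_dstep window_ddstep).
Qed.

Lemma normc_2pi : normc (0 +i* (2 * pi) : R[i]) = 2 * pi.
Proof. by rewrite normc_i ger0_norm//; have := pi2_ge1; lra. Qed.

(** One more integration by parts, in the form of [theta_parts], gives decay like 1/|z| in
    horizontal strips. *)
Lemma theta_decay z (V : R) : `|complex.Im z| <= V ->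
  normc z * normc (theta z) <= wmass ddstep * expR (2 * pi * V).
Proof.
move=> zV; have p1 := pi2_ge1.
apply: (@le_trans _ _ (normc ((0 +i* (2 * pi)) * z * theta z))).
  rewrite !normcM normc_2pi -mulrA ler_peMl// mulr_ge0//; exact: normc_ge0.
rewrite theta_parts normcN; apply: (le_trans (wtransform_bound window_ddstep z)).
apply: ler_wpM2l; first exact: wmass_ge0.
rewrite ler_expR mulr1; apply: ler_wpM2l => //; lra.
Qed.

Lemma theta_slope (V D : R) : 0 <= D -> exists2 C : R, 0 <= C & forall w h,
  `|complex.Im w| <= V -> `|complex.Im (w + h)| <= V -> normc h <= D ->
  normc w * normc (theta (w + h) - theta w) <= C * normc h.
Proof.
move=> D0; have p1 := pi2_ge1.
set E := expR (2 * pi * V); have E0 : 0 <= E := expR_ge0 _.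
exists (wmass ddstep * (E * (5 * expR (2 * (2 * pi * D)))) + wmass dstep * E).
  by apply: addr_ge0; repeat (apply: mulr_ge0 => //; try exact: wmass_ge0); exact: expR_ge0.
move=> w h wV whV hD; have h0 := normc_ge0 h; have w0 := normc_ge0 w.
have e : (0 +i* (2 * pi)) * w * (theta (w + h) - theta w) =
    - (wtransform ddstep (w + h) - wtransform ddstep w) - (0 +i* (2 * pi)) * h * theta (w + h).
  have := theta_parts (w + h); have := theta_parts w.
  move: (theta w) (theta (w + h)) (wtransform ddstep w) (wtransform ddstep (w + h)) => a b c d ha hb.
  have -> : c = - ((0 +i* (2 * pi)) * w * a) by rewrite ha opprK.
  have -> : d = - ((0 +i* (2 * pi)) * (w + h) * b) by rewrite hb opprK.
  by ring.
have le1 : (2 * pi) * (normc w * normc (theta (w + h) - theta w)) <=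
    (2 * pi) * (wmass ddstep * (E * (5 * expR (2 * (2 * pi * D)))) * normc h) +
    (2 * pi) * (wmass dstep * E * normc h).
  have <- : normc ((0 +i* (2 * pi)) * w * (theta (w + h) - theta w)) =
      2 * pi * (normc w * normc (theta (w + h) - theta w)) by rewrite !normcM normc_2pi mulrA.
  rewrite e.
  apply: (le_trans (normcB _ _)); rewrite normcN; apply: lerD.
    apply: (le_trans (wtransform_diff window_ddstep _ _)).
    have -> : 2 * pi * (wmass ddstep * (E * (5 * expR (2 * (2 * pi * D)))) * normc h) =
      wmass ddstep * (E * (5 * (2 * pi * normc h) * expR (2 * (2 * pi * D)))) by ring.
    rewrite mulr1.
    apply: ler_wpM2l; first exact: wmass_ge0.
    apply: ler_pM; [exact: expR_ge0| | |].
    - by apply: mulr_ge0; [apply: mulr_ge0 => //; apply: mulr_ge0 => //; lra|exact: expR_ge0].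
    - by rewrite ler_expR; apply: ler_wpM2l => //; lra.
    - apply: ler_wpM2l; first by apply: mulr_ge0 => //; apply: mulr_ge0 => //; lra.
      by rewrite ler_expR; apply: ler_wpM2l => //; apply: ler_wpM2l => //; lra.
  rewrite !normcM normc_2pi -mulrA; apply: ler_wpM2l; first lra.
  rewrite mulrC; apply: ler_wpM2r => //; exact: theta_bound.
move: le1; rewrite -mulrDr ler_pM2l ?mulrDl//; lra.
Qed.

Lemma theta_near1 z : normc (theta z - 1) <=
  wmass dstep * (5 * (2 * pi * normc z) * expR (2 * (2 * pi * normc z))).
Proof.
have := wtransform_diff window_dstep 0 z.
by rewrite -/(theta _) -/(theta _) add0r theta0 normr0 !mulr0 mulr1 expR0 mul1r.
Qed.

(** For large positive [be] it rises from 0 to 1 on [0, 1/al] and returns to 0 on [be, be + 1]. For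
    large negative [be] it falls to -1 on [be, be + 1] and returns to 0 on [0, 1/al]. One formula
    thus serves both half-lines. *)
Definition cut (al be : R) t : R := sstep (al * t) - sstep (t - be).
Definition dcut (al be : R) t : R := al * dstep (al * t) - dstep (t - be).

Lemma cut_smooth al be : smooth (cut al be).
Proof.
move=> n; have h1 := smoothN_affine al 0 (@sstep_smooth R n).
have h2 := smoothNM (@smoothN_cst R n (-1)) (smoothN_affine 1 (- be) (@sstep_smooth R n)).
have := smoothND h1 h2; congr smoothN; apply/funext => t.
by rewrite /cut addr0 mul1r mulN1r.
Qed.

Lemma dcut_smooth al be : smooth (dcut al be).
Proof.
move=> n; have h1 := smoothNM (@smoothN_cst R n al) (smoothN_affine al 0 (dstep_smooth.1 n)).
have h2 := smoothNM (@smoothN_cst R n (-1)) (smoothN_affine 1 (- be) (dstep_smooth.1 n)).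
have := smoothND h1 h2; congr smoothN; apply/funext => t.
by rewrite /dcut addr0 mul1r mulN1r.
Qed.

Lemma is_derive_cut al be t : is_derive t 1 (cut al be) (dcut al be t).
Proof.
have h1 := @is_derive_comp_affine R (@sstep R) _ al 0 t (dstep_smooth.2 (al * t + 0)).
have h2 := @is_derive_comp_affine R (@sstep R) _ 1 (- be) t (dstep_smooth.2 (1 * t - be)).
have -> : cut al be = (fun x => sstep (al * x + 0)) - (fun x => sstep (1 * x - be)).
  apply/funext => x; transitivity (sstep (al * x + 0) - sstep (1 * x - be)) => //.
  by rewrite addr0 mul1r.
have -> : dcut al be t = al * dstep (al * t + 0) - 1 * dstep (1 * t - be).
  by rewrite /dcut addr0 !mul1r.
exact: is_deriveB h1 h2.
Qed.

Lemma window_cut al be : 1 <= al -> window (cut al be) (1 + `|be|) /\ window (dcut al be) (1 + `|be|).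
Proof.
move=> al1.
have h t : 1 + `|be| < `|t| -> (1 < al * t /\ 1 < t - be) \/ (al * t < 0 /\ t - be < 0).
  have := ler_norm be; have := ler_norm (- be); rewrite normrN => b1 b2.
  rewrite ltr_normr => /orP[|] ht; [left|right]; split; try lra.
    by have : t <= al * t; [rewrite ler_peMl//; lra|lra].
  have : - t <= al * - t by rewrite ler_peMl//; lra.
  by rewrite mulrN; lra.
split; split.
- exact: smooth_continuous (cut_smooth al be).
- move=> t /h[[h1 h2]|[h1 h2]]; rewrite /cut.
    by rewrite !sstep1 ?subrr// ltW.
  by rewrite !sstep0 ?subrr// ltW.
- exact: smooth_continuous (dcut_smooth al be).
- move=> t /h[[h1 h2]|[h1 h2]]; rewrite /dcut.
    by rewrite !dstep1// mulr0 subr0.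
  by rewrite !dstep0// mulr0 subr0.
Qed.

(** Integration by parts passes to [dcut], made of a rescaled and a translated copy of [dstep]:
    rescaling divides the argument by [al], translation produces the character. *)
Lemma cut_transform al be z : 1 <= al -> z != 0 ->
  - (0 +i* (2 * pi)) * wtransform (cut al be) z =
  (theta (al^-1%:C * z) - character be z * theta z) / z.
Proof.
move=> al1 z0; have [wc wd] := window_cut be al1.
have M0 : 0 < 1 + `|be| by have := normr_ge0 be; lra.
have al0 : 0 < al by lra.
have := wtransform_derive z M0 (cut_smooth al be) (dcut_smooth al be)
  (is_derive_cut al be) wc wd.
move=> h; apply: (mulIf z0); rewrite divfK//.
have -> : - (0 +i* (2 * pi)) * wtransform (cut al be) z * z =
    - ((0 +i* (2 * pi)) * z * wtransform (cut al be) z) by ring.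
rewrite h opprK.
pose f t := (dstep t)%:C * character t (al^-1%:C * z).
pose g t := (dstep (t - be))%:C * character t z.
have sf : csmooth f.
  by apply: csmoothM; [apply: csmoothR; exact: dstep_smooth.1|exact: csmooth_character].
have jf : cintegrable mu f by exact: wtransform_integrable window_dstep _.
have wg : window (fun t => dstep (t - be)) (1 + `|be|).
  split.
    by move=> t; apply: continuous_comp; [exact: cvgB cvg_id (cvg_cst _)|exact: window_dstep.1].
  move=> t ht; apply: window_dstep.2.
  by have := lerB_dist t be; lra.
have sg : csmooth g.
  apply: csmoothM; last exact: csmooth_character.
  apply: csmoothR => n; have := smoothN_affine 1 (- be) (dstep_smooth.1 n).
  by under eq_fun do rewrite mul1r.
have jg : cintegrable mu g by exact: wtransform_integrable wg _.
have e1 : theta (al^-1%:C * z) = cintegral mu (fun t => al%:C * f (al * t + 0)).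
  rewrite /theta /wtransform (cintegral_affine 0 al0 (csmooth_ccontinuous sf) jf).
  rewrite cintegralZ//; exact: cintegrable_affine (csmooth_ccontinuous sf) jf.
have jfa := cintegrableZ al%:C (cintegrable_affine 0 al0 (csmooth_ccontinuous sf) jf).
have e2 : character be z * theta z = cintegral mu g.
  rewrite -(cintegral_shift be (csmooth_ccontinuous sg) jg).
  rewrite /theta /wtransform -cintegralZ; last exact: wtransform_integrable window_dstep _.
  apply: eq_cintegral => t; rewrite /g addrK characterD.
  by move: (character t z) (character be z) => a c; ring.
rewrite e1 e2 -cintegralB//; apply: eq_cintegral => t.
rewrite /f /g /dcut addr0 character_scale.
have -> : al * t * al^-1 = t by field; rewrite gt_eqF.
have -> : (al * dstep (al * t) - dstep (t - be))%:C =
  al%:C * (dstep (al * t))%:C - (dstep (t - be))%:C :> R[i].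
  by apply: complex_eqP => /=; ring.
by move: (character t z) => a; ring.
Qed.

End step_transform.

(** * Approximations of 1/z with estimates uniform in the cut-off *)

Section blocks.
Context (R : realType).
Implicit Types (z w : R[i]) (t sg : R).

(** By [cut_transform], this is - 2 pi i times the transform of the cut-off with [al = k.+1] and
    [be = sg * k.+1]. *)
Definition blk sg (k : nat) z : R[i] :=
  (theta (k.+1%:R^-1%:C * z) - character (sg * k.+1%:R) z * theta z) / z.

Lemma scale_le1 (k : nat) : 0 < (k.+1%:R^-1 : R) <= 1.
Proof. by rewrite invr_gt0 ltr0n /= invf_le1 ?ltr0n// ler1n. Qed.

Lemma Im_scale (k : nat) z (V : R) : `|complex.Im z| <= V ->
  `|complex.Im (k.+1%:R^-1%:C * z)| <= V.
Proof.
move=> zV; have /andP[k0 k1] := scale_le1 k; rewrite Im_M /= mul0r addr0 normrM gtr0_norm//.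
by apply: le_trans zV; rewrite ler_piMl.
Qed.

Lemma character_sg_le1 sg (k : nat) z : 0 <= sg * complex.Im z ->
  normc (character (sg * k.+1%:R) z) <= 1.
Proof.
move=> h; rewrite normc_character -[X in _ <= X]expR0 ler_expR oppr_le0.
have -> : 2 * pi * (sg * k.+1%:R) * complex.Im z = 2 * pi * k.+1%:R * (sg * complex.Im z) by ring.
by apply: mulr_ge0 => //; apply: mulr_ge0 => //; have := @pi2_ge1 R; lra.
Qed.

(** The argument of the first [theta] tends to 0, where its value is 1, while the character decays
    because z lies on the side [sg]. *)
Lemma blk_cvg sg z : 1 <= sg * complex.Im z -> ccvg (fun k => blk sg k z) z^-1.
Proof.
move=> h; have p1 := @pi2_ge1 R.
have c1 : ccvg (fun k : nat => theta (k.+1%:R^-1%:C * z)) 1.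
  pose K := wmass (@dstep R) * (5 * (2 * pi * normc z) * expR (2 * (2 * pi * normc z))).
  have n0 := normc_ge0 z.
  have P0 : 0 <= 2 * pi * normc z by apply: mulr_ge0 => //; lra.
  have K0 : 0 <= K.
    apply: mulr_ge0; first exact: wmass_ge0.
    by apply: mulr_ge0; [exact: mulr_ge0|exact: expR_ge0].
  apply/ccvgP => e e0.
  have K1 : 0 < K + 1 by lra.
  have [N hN] := harmonic_bound (divr_gt0 e0 K1).
  exists N => k /hN; rewrite div1r => hk; have /andP[k0 k1] := scale_le1 k.
  apply: (le_lt_trans (theta_near1 _)).
  apply: (@le_lt_trans _ _ (k.+1%:R^-1 * K)); last first.
    apply: (@le_lt_trans _ _ (k.+1%:R^-1 * (K + 1))).
      by apply: ler_wpM2l; [exact: ltW|lra].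
    by rewrite -ltr_pdivlMr.
  rewrite normcM normcR gtr0_norm//; move: (k.+1%:R^-1) k0 k1 => x x0 x1.
  have -> : x * K = wmass (@dstep R) * (5 * (2 * pi * (x * normc z)) *
     expR (2 * (2 * pi * normc z))) by rewrite /K; ring.
  apply: ler_wpM2l; first exact: wmass_ge0.
  apply: ler_wpM2l.
    by apply: mulr_ge0 => //; apply: mulr_ge0; [lra|apply: mulr_ge0 => //; exact: ltW].
  rewrite ler_expR; apply: ler_wpM2l => //; apply: ler_wpM2l; first lra.
  by rewrite ler_piMl.
have c2 : ccvg (fun k : nat => character (sg * k.+1%:R) z) 0.
  apply/ccvgP => e e0; have [N hN] := harmonic_bound e0.
  exists N => k /hN hk; rewrite subr0 normc_character.
  apply: le_lt_trans hk; rewrite expRN div1r lef_pV2 ?posrE ?expR_gt0 ?ltr0n//.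
  apply: le_trans (expR_ge1Dx _).
  have -> : 2 * pi * (sg * k.+1%:R) * complex.Im z = 2 * pi * k.+1%:R * (sg * complex.Im z) by ring.
  have k1 : (1 : R) <= k.+1%:R by rewrite ler1n.
  have : k.+1%:R <= 2 * pi * k.+1%:R :> R by rewrite ler_peMl//; lra.
  have : 2 * pi * k.+1%:R <= 2 * pi * k.+1%:R * (sg * complex.Im z).
    by rewrite ler_peMr// mulr_ge0//; lra.
  lra.
have := ccvgM (ccvgB c1 (ccvgM c2 (ccvg_cst (theta z)))) (ccvg_cst z^-1).
by rewrite mul0r subr0 mul1r.
Qed.

(** Each [blk] separately is only O(1/|w|), which need not be summable over the zeros; the
    difference at a fixed displacement [d] gains one power. Constants independent of [k] make it the
    majorant for the limit. *)
Lemma blk_bound sg (d : R[i]) (V : R) : exists2 C : R, 0 <= C & forall k z w, z = w + d ->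
  `|complex.Im z| <= V -> `|complex.Im w| <= V -> 0 <= sg * complex.Im z ->
  0 <= complex.Im w -> 1 <= normc z -> 1 <= normc w ->
  normc (blk sg k z - blk 1 k w) <= C / normc w ^+ 2.
Proof.
have D0 := normc_ge0 d; set D := normc d in D0 *.
have [C2 C20 h2] := theta_slope V D0.
set E := expR (2 * pi * V); have E0 : 0 <= E := expR_ge0 _.
set c0 := wmass (@dstep R); set c1 := wmass (@ddstep R).
have c00 : 0 <= c0 := wmass_ge0 _; have c10 : 0 <= c1 := wmass_ge0 _.
have [D1 D2] : 0 <= D * (D + 1) /\ 0 <= (D + 1) * (D + 1) by split; apply: mulr_ge0; lra.
exists (c0 * E * (D * (D + 1)) + C2 * D + c1 * E * ((D + 1) * (D + 1)) + c1 * E).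
  by repeat (apply: addr_ge0); apply: mulr_ge0 => //; exact: mulr_ge0.
move=> k z w zw zV wV sz sw z1 w1.
have z0 : z != 0 by rewrite -normc_gt0; lra.
have w0 : w != 0 by rewrite -normc_gt0; lra.
set e := character (sg * k.+1%:R) z; set e' := character (1 * k.+1%:R) w.
have e1 : normc e <= 1 := character_sg_le1 k sz.
have e'1 : normc e' <= 1 by apply: character_sg_le1; rewrite mul1r.
set x : R[i] := k.+1%:R^-1%:C.
have -> : blk sg k z - blk 1 k w = theta (x * z) * (z^-1 - w^-1) +
   (theta (x * z) - theta (x * w)) / w - e * (theta z / z) + e' * (theta w / w).
  rewrite /blk -/x -/e -/e'; move: (theta _) (theta _) (theta _) (theta _) => a b c f.
  by field; rewrite z0 w0.
have nw0 : 0 < normc w by lra.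
have nz0 : 0 < normc z by lra.
have wz : normc w <= (D + 1) * normc z.
  have -> : w = z - d by rewrite zw addrK.
  apply: (le_trans (normcB _ _)); rewrite -/D mulrDl mul1r addrC lerD2r.
  by rewrite ler_peMr.
have iz : (normc z)^-1 <= (D + 1) / normc w.
  rewrite ler_pdivlMr// mulrC ler_pdivrMr//.
have t1 : normc (theta (x * z) * (z^-1 - w^-1)) <= c0 * E * (D * (D + 1)) / normc w ^+ 2.
  have -> : c0 * E * (D * (D + 1)) / normc w ^+ 2 = c0 * E * (D * ((D + 1) / normc w / normc w)).
    by field; lra.
  have -> : z^-1 - w^-1 = - (d / z / w) by rewrite zw; field; rewrite -zw z0 w0.
  have -> : normc (theta (x * z) * - (d / z / w)) =
      normc (theta (x * z)) * (D * ((normc z)^-1 / normc w)).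
    by rewrite normcM normcN !normcM !normcV !mulrA.
  apply: ler_pM.
  - exact: normc_ge0.
  - by apply: mulr_ge0 => //; rewrite mulr_ge0// invr_ge0 ltW.
  - exact: (theta_bound (Im_scale k zV)).
  - apply: ler_wpM2l => //; apply: ler_wpM2r; first by rewrite invr_ge0 ltW.
    exact: iz.
(* [theta_slope] is applied to the points scaled by [x]; the factor [normc x] appears on both sides
   and cancels, so [k] disappears from the bound. *)
have t2 : normc ((theta (x * z) - theta (x * w)) / w) <= C2 * D / normc w ^+ 2.
  have /andP[k0 k1] := scale_le1 k.
  have xe : x * z = x * w + x * d by rewrite zw mulrDr.
  have nx : normc x = k.+1%:R^-1 by rewrite normcR gtr0_norm.
  have := h2 (x * w) (x * d) (Im_scale k wV).
  rewrite -xe !normcM nx -/D; move=> /(_ (Im_scale k zV)) H2.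
  have {}H2 := H2 ltac:(by rewrite ler_piMl).
  have H3 : normc w * normc (theta (x * z) - theta (x * w)) <= C2 * D.
    rewrite -(ler_pM2l k0) mulrA; apply: (le_trans H2); rewrite le_eqVlt; apply/orP; left.
    by apply/eqP; ring.
  rewrite normcV ler_pdivlMr ?exprn_gt0//.
  have -> : normc (theta (x * z) - theta (x * w)) / normc w * normc w ^+ 2 =
    normc w * normc (theta (x * z) - theta (x * w)) by field; lra.
  exact: H3.
have dz u v : normc u <= 1 -> 0 < normc v -> `|complex.Im v| <= V ->
    normc (u * (theta v / v)) <= c1 * E / normc v ^+ 2.
  move=> u1 v0 vV; rewrite !normcM normcV ler_pdivlMr ?exprn_gt0//.
  have -> : normc u * (normc (theta v) / normc v) * normc v ^+ 2 =
    normc u * (normc v * normc (theta v)) by field; lra.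
  apply: le_trans (theta_decay vV); rewrite ler_piMl// mulr_ge0//; exact: normc_ge0.
have t3 := dz e z e1 nz0 zV; have t4 := dz e' w e'1 nw0 wV.
have t3' : normc (e * (theta z / z)) <= c1 * E * ((D + 1) * (D + 1)) / normc w ^+ 2.
  apply: (le_trans t3).
  have -> : c1 * E * ((D + 1) * (D + 1)) / normc w ^+ 2 =
    c1 * E * ((D + 1) / normc w * ((D + 1) / normc w)) by field; lra.
  apply: ler_wpM2l; first exact: mulr_ge0.
  rewrite expr2 invfM; apply: ler_pM => //; rewrite invr_ge0 ltW//.
have sp (a b c f g : R) : (a + b + c + f) / g = a / g + b / g + c / g + f / g.
  by rewrite !mulrDl.
rewrite sp; apply: (le_trans (normcD _ _)); apply: lerD => //.
apply: (le_trans (normcB _ _)); apply: lerD => //.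
by apply: (le_trans (normcD _ _)); apply: lerD.
Qed.

End blocks.

(** * The trace formula *)

Section spectral_sums.
Context (R : realType) (b : R -> R[i]) (g : nat -> R) (u : nat -> bool).
Hypothesis eb : enumerates (spectrum b) g u.

Lemma sum_le_restricted (a : R -> R) (P : set R) B : (forall i, P i -> 0 <= a i) ->
  (\esum_(i in spectrum b `&` P) (a i)%:E <= B%:E)%E ->
  sum_le (fun n => if u n then (if g n \in P then a (g n) else 0) else 0) B.
Proof.
move=> a0 h.
apply: (@sum_le_esum _ _ _ _ eb _ (fun i => if i \in P then a i else 0)).
  by move=> i _; case: ifPn => // /set_mem /a0.
apply: le_trans h; rewrite esum_mkcondr; apply: le_esum => i _.
by case: ifP.
Qed.

Definition weighted (Y : R) n : R :=
  if u n then normc (b (g n)) * expR (- (2 * pi * `|g n| * Y)) else 0.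

Lemma weighted_ge0 Y n : 0 <= weighted Y n.
Proof.
by rewrite /weighted; case: ifP => // _; apply: mulr_ge0; [exact: normc_ge0|exact: expR_ge0].
Qed.

Hypothesis b_local : forall r : R, (\esum_(g in spectrum b `&` [set g | `|g| < r]%R)
           (normc (b g))%:E < +oo)%E.
Hypothesis b_growth : log_bigO_id (fun r : R =>
      (\esum_(g in spectrum b `&` [set g : R | `|g| < r]%R) (normc (b g))%:E)%E).

Lemma ball_mass : exists C : R, 0 <= C /\ forall r : R, 0 <= r ->
  sum_le (fun n => if u n then (if `|g n| < r then normc (b (g n)) else 0) else 0)
    (C * expR (C * r)).
Proof.
have [C [r0 [_ hC]]] := b_growth.
pose N (r : R) := (\esum_(g in spectrum b `&` [set g : R | `|g| < r]%R) (normc (b g))%:E)%E.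
pose r1 := `|r0| + 1.
have Nf : N r1 \is a fin_num.
  rewrite ge0_fin_numE ?b_local//; apply: esum_ge0 => i _; rewrite lee_fin; exact: normc_ge0.
(* The growth hypothesis speaks of large [r] only; for [r] up to [r1] the finite mass of the ball of
   radius [r1] is used instead. *)
pose C' := `|C| + `|fine (N r1)|.
have C'0 : 0 <= C' by apply: addr_ge0.
exists C'; split => // r rr.
have le : (N r <= (C' * expR (C' * r))%:E)%E.
  have [rr1|rr1] := leP r r1.
    apply: (@le_trans _ _ (N r1)).
      rewrite /N esum_mkcondr [leRHS]esum_mkcondr; apply: le_esum => i _.
      case: ifPn => [/set_mem /= ir|_].
        by rewrite ifT//; apply/mem_set => /=; exact: lt_le_trans rr1.
      by case: ifP => // _; rewrite lee_fin; exact: normc_ge0.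
    rewrite -(fineK Nf) lee_fin; apply: (@le_trans _ _ C').
      by rewrite /C'; have := ler_norm (fine (N r1)); have := normr_ge0 C; lra.
    by rewrite ler_peMr// le1_expR// mulr_ge0.
  have r0r : r0 < r by have := ler_norm r0; rewrite /r1 in rr1; lra.
  apply: (le_trans (hC r r0r)); rewrite lee_fin.
  have CC : C <= C' by rewrite /C'; have := ler_norm C; have := normr_ge0 (fine (N r1)); lra.
  apply: (@le_trans _ _ (C' * expR (C * r))).
    by apply: ler_wpM2r => //; exact: expR_ge0.
  by apply: ler_wpM2l => //; rewrite ler_expR; apply: ler_wpM2r.
have := @sum_le_restricted (fun i => normc (b i)) [set x | `|x| < r] _ (fun i _ => normc_ge0 (b i)) le.
apply: sum_leW => n; case: ifP => // _; case: ifP => h; last by case: ifP => // _; exact: normc_ge0.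
by rewrite ifT//; exact/mem_set.
Qed.

(** The frequencies of modulus between j and j + 1 have mass at most C e^{C (j + 1)} and weight at
    most e^{- (C + 1) j}: there remains C e^C times a series dominated by that of 2^{-j}. *)
Lemma weighted_summable : exists Y0 : R, forall Y, Y0 <= Y -> exists B, sum_le (weighted Y) B.
Proof.
have [C [C0 hC]] := ball_mass; exists (C + 1) => Y CY.
have p1 := @pi2_ge1 R.
exists (C * expR C * 2) => N.
pose k n := Num.truncn `|g n|.
pose K := (\max_(n < N) k n).+1.
have E (n : 'I_N) : weighted Y n = \sum_(j < K) (if k n == j then weighted Y n else 0).
  have kK : (k n < K)%N by rewrite ltnS; exact: (@leq_bigmax _ (fun n : 'I_N => k n)).
  rewrite (bigD1 (Ordinal kK))//= eqxx big1 ?addr0// => j.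
  by case: (eqVneq (k n) j) => // kj /eqP; case; exact: val_inj.
under eq_bigr do rewrite E.
rewrite exchange_big /=.
apply: (@le_trans _ _ (\sum_(j < K) C * expR C * (2^-1) ^+ j)).
  apply: ler_sum => j _; have j0 : 0 <= j%:R :> R by [].
  have hj := hC (j%:R + 1) ltac:(lra) N.
  apply: (@le_trans _ _ (expR (- ((C + 1) * j%:R)) * (C * expR (C * (j%:R + 1))))).
    apply: le_trans (ler_wpM2l (expR_ge0 _) hj).
    rewrite mulr_sumr; apply: ler_sum => n _.
    have r0 m : 0 <= (if u m then if `|g m| < j%:R + 1 then normc (b (g m)) else 0 else 0).
      by do 2?case: ifP => // _; exact: normc_ge0.
    case: eqP => kj; last by apply: mulr_ge0; rewrite ?r0//; exact: expR_ge0.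
    have t1 : j%:R <= `|g n| by rewrite -kj truncn_le.
    have t2 : `|g n| < j%:R + 1 by rewrite -kj natr1 truncnS_gt.
    rewrite /weighted t2; case: ifP => _; last by rewrite mulr0.
    rewrite mulrC; apply: ler_wpM2r; first exact: normc_ge0.
    rewrite ler_expR lerN2.
    apply: (@le_trans _ _ ((C + 1) * `|g n|)); first by apply: ler_wpM2l => //; lra.
    rewrite mulrAC; apply: ler_wpM2r => //.
    by apply: (le_trans CY); rewrite ler_peMl//; lra.
  rewrite mulrCA -expRD -mulrA; apply: ler_wpM2l => //.
  have -> : - ((C + 1) * j%:R) + C * (j%:R + 1) = C + - j%:R by ring.
  rewrite expRD; apply: ler_wpM2l; first exact: expR_ge0.
  rewrite expRN -[j%:R]mulr1 expRM_natl exprVn lef_pV2 ?posrE ?exprn_gt0 ?expR_gt0//.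
  by rewrite lerXn2r ?nnegrE ?expR_ge0//; have := expR_ge1Dx (1 : R); lra.
rewrite -mulr_sumr; apply: ler_wpM2l; first by apply: mulr_ge0 => //; exact: expR_ge0.
have -> : \sum_(j < K) 2^-1 ^+ j = 2 - 2 * 2^-1 ^+ K :> R.
  elim: (K) => [|m IH]; first by rewrite big_ord0 expr0; ring.
  by rewrite big_ord_recr /= IH exprS; field.
by rewrite gerBl mulr_ge0// exprn_ge0.
Qed.

End spectral_sums.

Section trace_formula.
Context (R : realType) (H : R) (A : R[i] -> nat) (b : R -> R[i]).
Context (e : nat -> R[i]) (v : nat -> bool) (g : nat -> R) (u : nat -> bool).
Hypothesis A_strip : msupp A `<=` strip H.
Hypothesis A_pure : is_pure_point (fourier_c_measure (multiset_measure A)) b.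
Hypothesis eA : enumerates (msupp A) e v.
Hypothesis eb : enumerates (spectrum b) g u.
Variables (P S : R).
Hypothesis H0 : 0 <= H.
Hypothesis PH : H + 1 <= P.
Local Notation p := (0 +i* P).
Local Notation mult := (mmult A e v).
Local Notation pt := (mpt e v).
Hypothesis S_inv : sum_le (inv_sq p pt mult) S.
Implicit Types (z : R[i]) (sg t : R).

(** Since [sstep] is 0 at 0, the limit of the cut-offs at t = 0 is 0 on the upper side and -1 on the
    lower side: the coefficient b_0 is counted entirely below. *)
Definition jump sg t : R := (if 0 < t then 1 else 0) - (if 0 < sg then 0 else 1).

Definition spectral_term sg z n : R[i] :=
  if u n then b (g n) * ((jump sg (g n))%:C * character (g n) z) else 0.

Definition cutk sg (k : nat) : R -> R := cut k.+1%:R (sg * k.+1%:R).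

(* As k grows the cut-off cutk sg k tends to the indicator of t > 0 if sg = 1, and
   to minus that of t <= 0 if sg = -1; the transform at a of the test function
   tends to 1 / (z - a) - 1 / (p - a). *)
Definition trace_test sg z (k : nat) t : R[i] :=
  - (0 +i* (2 * pi)) * ((cutk sg k t)%:C * character t z - (cutk 1 k t)%:C * character t p).

Lemma window_cutk sg k : `|sg| = 1 -> window (cutk sg k) (k.+2%:R).
Proof.
move=> s1; have [] := window_cut (sg * k.+1%:R) (al := k.+1%:R) _; first by rewrite ler1n.
by rewrite normrM s1 mul1r ger0_norm// addrC natr1.
Qed.

Lemma trace_test_function sg z k : `|sg| = 1 -> test_function (trace_test sg z k).
Proof.
move=> s1; have w1 := window_cutk k s1; have w2 := window_cutk k (normr1 R).
apply: (@test_function_csmooth _ _ k.+2%:R).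
  apply: csmoothM; first exact: csmooth_cst.
  have -> : (fun t => (cutk sg k t)%:C * character t z - (cutk 1 k t)%:C * character t p) =
     (fun t => (cutk sg k t)%:C * character t z + (-1) * ((cutk 1 k t)%:C * character t p)).
    by apply/funext => t; rewrite mulN1r.
  apply: csmoothD; first by apply: csmoothM; [apply: csmoothR; exact: cut_smooth|exact: csmooth_character].
  apply: csmoothM; first exact: csmooth_cst.
  by apply: csmoothM; [apply: csmoothR; exact: cut_smooth|exact: csmooth_character].
move=> t ht; rewrite /trace_test (w1.2 t ht) (w2.2 t ht).
by rewrite !mul0r subrr mulr0.
Qed.

Lemma fourier_trace_test sg z k a : `|sg| = 1 ->
  fourier_c (trace_test sg z k) a = - (0 +i* (2 * pi)) *
    (wtransform (cutk sg k) (z - a) - wtransform (cutk 1 k) (p - a)).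
Proof.
move=> s1; have w1 := window_cutk k s1; have w2 := window_cutk k (normr1 R).
have j1 := wtransform_integrable w1 (z - a); have j2 := wtransform_integrable w2 (p - a).
rewrite /wtransform -cintegralB// -cintegralZ; last exact: cintegrableB.
apply: eq_cintegral => t; rewrite /trace_test !character_Dr.
have -> : character (- t) a = character t (- a).
  rewrite characterN; have := character_neq0 t a.
  have : character t a * character t (- a) = 1.
    by rewrite -character_Dr subrr /character mulr0 cexp0.
  move: (character t a) (character t (- a)) => c d cd c0; apply: (mulfI c0).
  by rewrite mulfV// cd.
move: (character t z) (character t p) (character t (- a)) => c d f; ring.
Qed.

Lemma fourier_trace_test_loclip sg z k : `|sg| = 1 -> loclip (fourier_c (trace_test sg z k)).
Proof.
move=> s1; have w1 := window_cutk k s1; have w2 := window_cutk k (normr1 R).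
have k0 : 0 <= k.+2%:R :> R by [].
move=> a; have [r1 [K1 [r10 h1]]] := wtransform_loclip w1 z k0 a.
have [r2 [K2 [r20 h2]]] := wtransform_loclip w2 p k0 a.
exists (Num.min r1 r2), (normc (- (0 +i* (2 * pi)) : R[i]) * (K1 + K2)).
split; first by rewrite lt_min r10.
move=> w; rewrite lt_min => /andP[/h1 {}h1 /h2 {}h2].
rewrite !fourier_trace_test//.
move: (wtransform _ (z - w)) (wtransform _ (p - w)) (wtransform _ (z - a)) (wtransform _ (p - a)) h1 h2.
move=> x1 x2 x3 x4 h1 h2.
have -> : - (0 +i* (2 * pi)) * (x1 - x2) - - (0 +i* (2 * pi)) * (x3 - x4) =
  - (0 +i* (2 * pi)) * ((x1 - x3) - (x2 - x4)) by ring.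
rewrite normcM -mulrA; apply: ler_wpM2l; first exact: normc_ge0.
by rewrite mulrDl; apply: (le_trans (normcB _ _)); apply: lerD.
Qed.

Lemma fourier_trace_test_blk sg z k a : `|sg| = 1 -> z != a -> p != a ->
  fourier_c (trace_test sg z k) a = blk sg k (z - a) - blk 1 k (p - a).
Proof.
move=> s1 za pa; rewrite fourier_trace_test// mulrBr.
have k1 : 1 <= k.+1%:R :> R by rewrite ler1n.
by rewrite !cut_transform// ?subr_eq0// mul1r.
Qed.

Lemma mpt_Im n : `|complex.Im (pt n)| <= H.
Proof.
rewrite /mpt; case: (boolP (v n)) => vn; last by rewrite normr0.
by have [vD _ _] := eA; exact: A_strip (vD n vn).
Qed.

Definition side sg z := `|sg| = 1 /\ H + 1 <= sg * complex.Im z.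

Lemma side_pt sg z n : side sg z -> 1 <= sg * complex.Im (z - pt n).
Proof.
move=> [s1 sz]; rewrite Im_B mulrBr.
have : sg * complex.Im (pt n) <= H.
  by apply: le_trans (ler_norm _) _; rewrite normrM s1 mul1r mpt_Im.
lra.
Qed.

Lemma side_dist sg z n : side sg z -> 1 <= normc (z - pt n).
Proof.
move=> sz; apply: le_trans (Im_le_normc _); have [s1 _] := sz.
have -> : `|complex.Im (z - pt n)| = `|sg * complex.Im (z - pt n)| by rewrite normrM s1 mul1r.
exact: le_trans (side_pt n sz) (ler_norm _).
Qed.

Lemma side_p : side 1 p.
Proof. by split; [exact: normr1|rewrite mul1r]. Qed.

Lemma mult_e (F : R[i] -> R[i]) n : (mult n)%:R * F (e n) = (mult n)%:R * F (pt n).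
Proof. by rewrite /mmult /mpt; case: (v n) => //; rewrite !mul0r. Qed.

(** [blk_bound] with displacement [z - p] gives the summable majorant [C * inv_sq], uniform in [k];
    it justifies both the integral over the zeros and the passage to the limit. *)
Lemma trace_zero_side sg z : side sg z ->
  (forall k, fourier_c_measure (multiset_measure A) (trace_test sg z k) =
     csum (fun n => (mult n)%:R * (blk sg k (z - pt n) - blk 1 k (p - pt n)))) /\
  ccvg (fun k => csum (fun n => (mult n)%:R * (blk sg k (z - pt n) - blk 1 k (p - pt n))))
    (logder_sum p pt mult z).
Proof.
move=> sz; have [s1 _] := sz.
pose V := `|complex.Im z| + P + H.
have [C C0 hC] := blk_bound sg (z - p) V.
have bd k n : normc ((mult n)%:R * (blk sg k (z - pt n) - blk 1 k (p - pt n))) <=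
    C * inv_sq p pt mult n.
  rewrite normcM normc_nat /inv_sq mulrCA; apply: ler_wpM2l => //.
  have i1 := mpt_Im n; have d1 := side_pt n sz; have d2 := side_pt n side_p.
  have n1 := side_dist n sz; have n2 := side_dist n side_p.
  have P0 := PH; have H0' := H0.
  apply: hC => //.
  - by ring.
  - by rewrite Im_B; apply: (le_trans (ler_normB _ _)); rewrite /V; lra.
  - rewrite Im_B; apply: (le_trans (ler_normB _ _)); rewrite /V /= ger0_norm; last lra.
    by have := normr_ge0 (complex.Im z); lra.
  - lra.
  - by rewrite mul1r in d2; lra.
have sC : sum_le (fun n => C * inv_sq p pt mult n) (C * S).
  by move=> N; rewrite -mulr_sumr; apply: ler_wpM2l => //; exact: S_inv.
split=> [k|]; last first.
  apply: (csum_tannery bd sC) => n; apply: ccvgZ; apply: ccvgB; apply: blk_cvg.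
    exact: side_pt.
  by rewrite -(mul1r (complex.Im _)) mul1r; exact: side_pt side_p.
have E n : (mult n)%:R * fourier_c (trace_test sg z k) (e n) =
    (mult n)%:R * (blk sg k (z - pt n) - blk 1 k (p - pt n)).
  rewrite mult_e fourier_trace_test_blk//.
    by rewrite -subr_eq0 -normc_gt0; have := side_dist n sz; lra.
  by rewrite -subr_eq0 -normc_gt0; have := side_dist n side_p; lra.
rewrite /fourier_c_measure (integral_multiset eA) ?(eq_csum E)//.
  by apply: loclip_measurable; exact: fourier_trace_test_loclip.
by apply: (csummable_dom _ sC) => n; rewrite E; exact: bd.
Qed.

Lemma normr_cutk sg k t : `|cutk sg k t| <= 1.
Proof.
rewrite /cutk /cut; move: (sstep_ge0 (k.+1%:R * t)) (sstep_le1 (k.+1%:R * t)).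
move: (sstep_ge0 (t - sg * k.+1%:R)) (sstep_le1 (t - sg * k.+1%:R)).
by move=> *; rewrite ler_norml; lra.
Qed.

Lemma normr1_cases sg : `|sg| = 1 -> sg = 1 \/ sg = -1.
Proof.
have [s0|s0] := leP 0 sg; first by rewrite ger0_norm//; left.
by rewrite ltr0_norm// => h; right; lra.
Qed.

(** Equality from some index on, rather than mere convergence, lets bounds valid for every [cutk]
    pass at once to the limit, as in [spectral_term_bound]. *)
Lemma cutk_jump sg t : `|sg| = 1 ->
  exists N, forall k, (N <= k)%N -> cutk sg k t = jump sg t.
Proof.
move=> s1.
have [N1 hN1] : exists N, forall k, (N <= k)%N -> 0 < t -> 1 <= k.+1%:R * t.
  have [t0|t0] := ltP 0 t; last by exists 0%N.
  have [N hN] := harmonic_bound t0; exists N => k /hN.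
  by rewrite ltr_pdivrMr ?ltr0n// => /ltW h _; rewrite mulrC.
exists (maxn N1 (Num.truncn `|t|).+2) => k; rewrite geq_max => /andP[/hN1 k1 k2].
have k3 : `|t| + 1 <= k.+1%:R.
  apply: (@le_trans _ _ (Num.truncn `|t|).+2%:R); last by rewrite ler_nat ltnW.
  by rewrite -natr1 lerD2r; exact/ltW/truncnS_gt.
have t1 := ler_norm t; have t2 := ler_norm (- t); rewrite normrN in t2.
rewrite /cutk /cut /jump.
have -> : sstep (k.+1%:R * t) = if 0 < t then 1 else 0.
  case: ltP => t0; first by apply: sstep1; exact: k1.
  by apply: sstep0; rewrite pmulr_rle0.
congr (_ - _); case: (normr1_cases s1) => ->.
  by rewrite ltr01 mul1r sstep0//; lra.
by rewrite ltr0N1 mulN1r opprK sstep1//; lra.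
Qed.

(** Where [sg * t >= 0] the character decays. On the other side the upper cut-off vanishes, but the
    lower one spills over to 0 < t < 1; there the character and the inverse of the weight are each
    at most e^{2 pi |Im z|}, whence the factor [4 * pi]. *)
Lemma cutk_character_bound sg (Y : R) z k t : `|sg| = 1 -> 0 <= Y -> Y <= sg * complex.Im z ->
  normc ((cutk sg k t)%:C * character t z) <=
    expR (4 * pi * `|complex.Im z|) * expR (- (2 * pi * `|t| * Y)).
Proof.
move=> s1 Y0 Yz; have p1 := @pi2_ge1 R; have z0 := normr_ge0 (complex.Im z).
have Yn : Y <= `|complex.Im z|.
  by apply: (le_trans Yz); apply: le_trans (ler_norm _) _; rewrite normrM s1 mul1r.
rewrite normcM normcR normc_character -expRD.
have [st|st] := leP 0 (sg * t).
  rewrite -[leRHS]mul1r; apply: ler_pM => //; try exact: expR_ge0; first exact: normr_cutk.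
  rewrite ler_expR.
  have -> : 2 * pi * t * complex.Im z = 2 * pi * ((sg * t) * (sg * complex.Im z)).
    have s2 : sg * sg = 1 by case: (normr1_cases s1) => ->; ring.
    by rewrite -[LHS]mul1r -s2; ring.
  have -> : `|t| = sg * t by rewrite -(ger0_norm st) normrM s1 mul1r.
  have h1 : sg * t * Y <= (sg * t) * (sg * complex.Im z) by exact: ler_wpM2l.
  have h2 : 2 * pi * (sg * t * Y) <= 2 * pi * (sg * t * (sg * complex.Im z)) by apply: ler_wpM2l => //; lra.
  have h3 : 0 <= 2 * pi * `|complex.Im z| by apply: mulr_ge0 => //; lra.
  by rewrite -(mulrA (2 * pi)); lra.
case: (normr1_cases s1) => sE; rewrite sE in st Yz *.
  have -> : cutk 1 k t = 0.
    rewrite /cutk /cut !sstep0 ?subrr// ?mul1r.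
      by rewrite mul1r in st; have := ler0n R k.+1; lra.
    by rewrite mul1r in st; rewrite pmulr_rle0// ltW.
  by rewrite normr0 mul0r expR_ge0.
have t0 : 0 < t by lra.
have [t1|t1] := leP 1 t.
  have -> : cutk (-1) k t = 0.
    rewrite /cutk /cut !sstep1 ?subrr//.
      by rewrite mulN1r opprK; have := ler0n R k.+1; lra.
    by apply: (le_trans t1); rewrite ler_peMl ?ler1n// ltW.
  by rewrite normr0 mul0r expR_ge0.
rewrite -[leRHS]mul1r; apply: ler_pM => //; try exact: expR_ge0; first exact: normr_cutk.
rewrite ler_expR (gtr0_norm t0).
have h1 : - (t * complex.Im z) <= `|complex.Im z|.
  apply: le_trans (ler_norm _) _; rewrite normrN normrM (gtr0_norm t0) ler_piMl// ltW//.
have h2 : t * Y <= `|complex.Im z|.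
  by apply: le_trans Yn; rewrite ler_piMl// ltW.
have h3 : 2 * pi * - (t * complex.Im z) <= 2 * pi * `|complex.Im z| by apply: ler_wpM2l => //; lra.
have h4 : 2 * pi * (t * Y) <= 2 * pi * `|complex.Im z| by apply: ler_wpM2l => //; lra.
by rewrite -!(mulrA (2 * pi)); lra.
Qed.

Lemma spectral_term_bound sg (Y : R) z n : `|sg| = 1 -> 0 <= Y -> Y <= sg * complex.Im z ->
  normc (spectral_term sg z n) <= expR (4 * pi * `|complex.Im z|) * weighted b g u Y n.
Proof.
move=> s1 Y0 Yz; rewrite /spectral_term /weighted; case: ifP => _; last by rewrite normc0 mulr0.
have [N hN] := cutk_jump (g n) s1; rewrite -(hN N (leqnn _)) normcM [leRHS]mulrCA.
by apply: ler_wpM2l; [exact: normc_ge0|exact: cutk_character_bound].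
Qed.

Lemma trace_spectral_side sg (Y B : R) z : `|sg| = 1 -> 0 <= Y -> Y <= sg * complex.Im z ->
  Y <= P -> sum_le (weighted b g u Y) B ->
  ccvg (fun k => fourier_c_measure (multiset_measure A) (trace_test sg z k))
   (- (0 +i* (2 * pi)) * (csum (spectral_term sg z) - csum (spectral_term 1 p))).
Proof.
move=> s1 Y0 Yz YP wB; have [_ _ hT] := A_pure.
have Yp : Y <= 1 * complex.Im p by rewrite mul1r.
pose K z' := expR (4 * pi * `|complex.Im z'|).
have K0 z' : 0 <= K z' := expR_ge0 _.
have sK z' : sum_le (fun n => K z' * weighted b g u Y n) (K z' * B).
  by move=> N; rewrite -mulr_sumr; apply: ler_wpM2l.
have s11 := normr1 R.
have sum1 := csummable_dom (fun n => spectral_term_bound n s1 Y0 Yz) (sK z).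
have sum2 := csummable_dom (fun n => spectral_term_bound n s11 Y0 Yp) (sK p).
rewrite -csumB// -csumZ; last exact: csummableB.
pose f k n : R[i] := if u n then b (g n) * trace_test sg z k (g n) else 0.
pose c := 2 * pi : R.
have fb k n : normc (f k n) <= c * ((K z + K p) * weighted b g u Y n).
  rewrite /f /weighted; case: ifP => _; last by rewrite normc0 !mulr0.
  have b1 := cutk_character_bound k (g n) s1 Y0 Yz.
  have b2 := cutk_character_bound k (g n) s11 Y0 Yp.
  rewrite /trace_test !normcM normcN normc_2pi -/c mulrCA; apply: ler_wpM2l.
    by have := @pi2_ge1 R; rewrite /c; lra.
  rewrite [leRHS]mulrCA; apply: ler_wpM2l; first exact: normc_ge0.
  by rewrite mulrDl; apply: (le_trans (normcB _ _)); apply: lerD.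
have sf : sum_le (fun n => c * ((K z + K p) * weighted b g u Y n)) (c * ((K z + K p) * B)).
  move=> N; rewrite -!mulr_sumr; apply: ler_wpM2l; first by have := @pi2_ge1 R; rewrite /c; lra.
  by apply: ler_wpM2l => //; exact: addr_ge0.
apply: (@eq_ccvg _ (fun k => csum (f k))).
  move=> k; apply: (has_csum_unique (D := spectrum b) (G := fun x => b x * trace_test sg z k x)).
    apply: has_csum_enumerates => //.
    exact: csummable_dom (fb k) sf.
  exact/hT/trace_test_function.
apply: (csum_tannery fb sf) => n.
have [N1 h1] := cutk_jump (g n) s1; have [N2 h2] := cutk_jump (g n) s11.
apply: ccvg_near (ccvg_cst _).
exists (maxn N1 N2) => // k /=; rewrite geq_max => /andP[/h1 k1 /h2 k2].
rewrite /f /spectral_term; case: (u n); last by rewrite subrr mulr0.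
rewrite /trace_test k1 k2.
by move: (character _ z) (character _ p) => x y; ring.
Qed.

(** One limit computed twice, over the zeros and over the spectrum. The copy at [p] uses the upper
    cut-off for either sign of [sg], so both half-planes share the same constant. *)
Theorem trace_formula sg (Y B : R) z : `|sg| = 1 -> H + 1 <= Y -> Y <= P ->
  Y <= sg * complex.Im z -> sum_le (weighted b g u Y) B ->
  logder_sum p pt mult z =
  - (0 +i* (2 * pi)) * (csum (spectral_term sg z) - csum (spectral_term 1 p)).
Proof.
move=> s1 HY YP Yz wB; have H0' := H0.
have sz : side sg z by split => //; exact: le_trans Yz.
have [h1 h2] := trace_zero_side sz.
apply: (ccvg_unique h2); apply: (eq_ccvg h1).
by apply: trace_spectral_side wB => //; lra.
Qed.

End trace_formula.

(** * The product on horizontal lines *)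

Section jets_on_lines.
Context (R : realType).

Lemma jet_character_line (c : R[i]) (a y : R) :
  jet [set z : R[i] | complex.Im z = y] (fun z => c * character a z)
    (fun z => c * ((0 +i* (2 * pi * a)) * character a z))
    (normc c * wt y a * (1 + 5 * (2 * pi * `|a|) * expR (2 * (2 * pi * `|a|)) +
       4 * (2 * pi * `|a|) ^+ 2 * expR (2 * pi * `|a|))).
Proof.
set X := 2 * pi * `|a|; have p1 := @pi2_ge1 R.
have X0 : 0 <= X by apply: mulr_ge0 => //; lra.
set W := normc c * wt y a; have c0 := normc_ge0 c.
have W0 : 0 <= W by apply: mulr_ge0 => //; exact: expR_ge0.
have e2 : 1 <= expR (2 * X) by rewrite le1_expR// mulr_ge0.
have E1 := expR_ge0 X; have E2 := expR_ge0 (2 * X).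
have ne : normc (0 +i* (2 * pi * a) : R[i]) = X.
  by rewrite normc_i !normrM (@ger0_norm _ 2)// (ger0_norm (pi_ge0 R)).
have P1 : 0 <= 5 * X * expR (2 * X) by apply: mulr_ge0 => //; apply: mulr_ge0.
have P2 : 0 <= 4 * X ^+ 2 * expR X by apply: mulr_ge0 => //; apply: mulr_ge0 => //; exact: sqr_ge0.
have nch z : complex.Im z = y -> normc (character a z) = wt y a.
  by move=> zy; rewrite normc_character zy.
exists W, (W * (5 * X * expR (2 * X))), (W * (4 * X ^+ 2 * expR X)); split.
- split => //; try exact: mulr_ge0.
  by rewrite !mulrDr mulr1.
- by move=> w wy; rewrite normcM (nch w wy).
- move=> w wy; rewrite normcM normcM (nch w wy) ne (mulrC X) mulrA -/W; apply: ler_wpM2l => //.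
  have : X * 1 <= X * expR (2 * X) by exact: ler_wpM2l.
  have : 0 <= X * expR (2 * X) by exact: mulr_ge0.
  by lra.

move=> z w zy wy zw; set d := z - w.
have zE : character a z = character a w * character a d.
  by rewrite -character_Dr /d addrC subrK.
have nd0 := normc_ge0 d.
have nh : normc ((0 +i* (2 * pi * a)) * d) = X * normc d by rewrite normcM ne.
have nh1 : X * normc d <= X by rewrite -[leRHS]mulr1; apply: ler_wpM2l.
split.
  have -> : c * character a z - c * character a w = c * character a w * (character a d - 1).
    by rewrite zE; ring.
  rewrite normcM normcM (nch w wy) -/W -[leRHS]mulrA; apply: ler_wpM2l => //.
  apply: (le_trans (cexp_sub1_le _)); rewrite nh.
  have -> : 5 * X * expR (2 * X) * normc d = 5 * (X * normc d) * expR (2 * X) by ring.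
  apply: ler_wpM2l; first by apply: mulr_ge0 => //; exact: mulr_ge0.
  by rewrite ler_expR; apply: ler_wpM2l.
have -> : c * character a z - c * character a w - c * ((0 +i* (2 * pi * a)) * character a w) * d =
    c * character a w * (cexp ((0 +i* (2 * pi * a)) * d) - 1 - (0 +i* (2 * pi * a)) * d).
  rewrite zE -[cexp _]/(character a d).
  by move: (character a w) (character a d) (0 +i* (2 * pi * a)) => r s t; ring.
rewrite normcM normcM (nch w wy) -/W -[leRHS]mulrA; apply: ler_wpM2l => //.
apply: (le_trans (cexp_rem2_le _)); rewrite nh.
have -> : 4 * X ^+ 2 * expR X * normc d ^+ 2 = 4 * (X * normc d) ^+ 2 * expR X by ring.
apply: ler_wpM2l; first by apply: mulr_ge0 => //; exact: sqr_ge0.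
by rewrite ler_expR.
Qed.

(** The origin of [Y + 2]: two extra units of height give a factor e^{- 4 pi |a|}, which absorbs the
    exponentials lost in the Taylor estimates and leaves a factor linear in |a|. *)
Lemma line_weight_le (a Y sg : R) : 0 < sg * a -> `|sg| = 1 ->
  wt (sg * (Y + 2)) a * (1 + 5 * (2 * pi * `|a|) * expR (2 * (2 * pi * `|a|)) +
       4 * (2 * pi * `|a|) ^+ 2 * expR (2 * pi * `|a|)) <=
  expR (- (2 * pi * `|a| * Y)) * (1 + 9 * (2 * pi * `|a|)).
Proof.
move=> sa s1; have aE : `|a| = sg * a by rewrite -(gtr0_norm sa) normrM s1 mul1r.
set X := 2 * pi * `|a|; have p1 := @pi2_ge1 R.
have X0 : 0 <= X by apply: mulr_ge0 => //; lra.
have -> : wt (sg * (Y + 2)) a = expR (- (X * Y)) * expR (- (2 * X)).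
  by rewrite /wt -expRD /X aE; congr expR; ring.
rewrite -mulrA; apply: ler_wpM2l; first exact: expR_ge0.
rewrite expRN mulrC ler_pdivrMr ?expR_gt0//.
have -> : 2 * X = X + X by ring.
rewrite expRD.
have e1 : 1 <= expR X by exact: le1_expR.
have e2 : X <= expR X by exact: le_mul_expR.
have e3 : 1 * 1 <= expR X * expR X by apply: ler_pM.
have e4 : X * X * expR X <= X * expR X * expR X.
  by apply: ler_wpM2r; [exact: expR_ge0|exact: ler_wpM2l].
rewrite expr2; nra.
Qed.

End jets_on_lines.

Section entire_function.
Context (R : realType) (H : R) (A : R[i] -> nat) (b : R -> R[i]).
Context (e : nat -> R[i]) (v : nat -> bool) (g : nat -> R) (u : nat -> bool).
Hypothesis A_strip : msupp A `<=` strip H.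
Hypothesis A_pure : is_pure_point (fourier_c_measure (multiset_measure A)) b.
Hypothesis eA : enumerates (msupp A) e v.
Hypothesis eb : enumerates (spectrum b) g u.
Variables (Y S B B1 : R).
Hypothesis H0 : 0 <= H.
Hypothesis HY : H + 1 <= Y.
Local Notation P := (Y + 2).
Local Notation p := (0 +i* P).
Local Notation mult := (mmult A e v).
Local Notation pt := (mpt e v).
Hypothesis S_inv : sum_le (inv_sq p pt mult) S.
Hypothesis wB : sum_le (weighted b g u Y) B.
Definition ratio n : R :=
  if u n && (g n != 0) then normc (b (g n) / (g n)%:C) * expR (- (2 * pi * `|g n| * Y)) else 0.
Hypothesis rB : sum_le ratio B1.
Implicit Types (z : R[i]) (sg t : R).
Local Notation cball r := [set z : R[i] | normc z <= r].
Local Notation c2pi := (0 +i* (2 * pi) : R[i]).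
Local Notation st := (spectral_term b g u).

Let pt1 : forall n, 1 <= normc (p - pt n).
Proof. by move=> n; apply: (mpt_dist H0 A_strip eA); have := HY; lra. Qed.

(** Makes b_0 a sum with at most one nonzero term, whether or not 0 occurs in the enumerated
    spectrum. *)
Definition zero_term n : R[i] := if u n && (g n == 0) then b (g n) else 0.

Definition mean_density : R[i] := csum zero_term.

Lemma zero_term_le n : normc (zero_term n) <= weighted b g u Y n.
Proof.
rewrite /zero_term /weighted; case: (u n); rewrite ?andTb ?andFb; last by rewrite normc0.
case: eqP => [->|_].
  by rewrite normr0 mulr0 mul0r oppr0 expR0 mulr1.
by rewrite normc0 mulr_ge0 ?expR_ge0// normc_ge0.
Qed.

Lemma csummable_zero_term : csummable zero_term.
Proof. exact: csummable_dom zero_term_le wB. Qed.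

(** Sharper than [spectral_term_bound]: the limiting cut-off vanishes on the wrong side of 0, so no
    factor depends on [z]. This uniformity lets the height tend to infinity in
    [mean_density_real]. *)
Lemma spectral_term_le sg z n : `|sg| = 1 -> Y <= sg * complex.Im z ->
  normc (st sg z n) <= weighted b g u Y n.
Proof.
move=> s1 Yz; rewrite /spectral_term /weighted; case: ifP => _; last by rewrite normc0.
rewrite normcM; apply: ler_wpM2l; first exact: normc_ge0.
rewrite normcM normcR.
have [st|st] := leP 0 (sg * g n); last first.
  have -> : jump sg (g n) = 0.
    case: (normr1_cases s1) => sE; rewrite sE in st; rewrite /jump sE.
      by rewrite ltr01 subr0 ltNge; case: leP => //; rewrite mul1r in st; move=> ?; lra.
    by rewrite ltr0N1 ifT ?subrr//; lra.
  by rewrite normr0 mul0r expR_ge0.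
have j1 : `|jump sg (g n)| <= 1.
  by rewrite /jump; case: ltP => _; case: ltP => _; rewrite ?subr0 ?subrr ?sub0r ?normrN ?normr1 ?normr0.
rewrite -[leRHS]mul1r; apply: ler_pM => //; first exact: normc_ge0.
rewrite normc_character ler_expR lerN2.
have p1 := @pi2_ge1 R.
have s2 : sg * sg = 1 by case: (normr1_cases s1) => ->; ring.
have -> : 2 * pi * g n * complex.Im z = 2 * pi * ((sg * g n) * (sg * complex.Im z)).
  by rewrite -[LHS]mul1r -s2; ring.
have -> : `|g n| = sg * g n by rewrite -(ger0_norm st) normrM s1 mul1r.
by rewrite -mulrA; apply: ler_wpM2l; [lra|exact: ler_wpM2l].
Qed.

Lemma csummable_spectral sg z : `|sg| = 1 -> Y <= sg * complex.Im z -> csummable (st sg z).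
Proof. by move=> s1 Yz; apply: csummable_dom wB => n; exact: spectral_term_le. Qed.

(** Below the strip the cut-off keeps g = 0, whose constant term has no antiderivative of the form
    [lterm]; adding this term removes it. *)
Definition shift_term sg n : R[i] := if 0 < sg then 0 else zero_term n.
Definition shift sg : R[i] := if 0 < sg then 0 else mean_density.

Definition lterm sg n z : R[i] :=
  if u n && (0 < sg * g n) then sg%:C * (b (g n) / (g n)%:C) * character (g n) z else 0.
Definition lser sg z : R[i] := csum (fun n => lterm sg n z).

Lemma lterm_derive sg n z : `|sg| = 1 ->
  (if u n && (0 < sg * g n) then
     sg%:C * (b (g n) / (g n)%:C) * ((0 +i* (2 * pi * g n)) * character (g n) z) else 0) =
  c2pi * (st sg z n + shift_term sg n).
Proof.
move=> s1; rewrite /spectral_term /shift_term /zero_term.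
case: (u n) => /=; last by rewrite if_same addr0 mulr0.
have ge : 0 +i* (2 * pi * g n) = c2pi * (g n)%:C :> R[i].
  by apply: complex_eqP; rewrite ?Re_M ?Im_M /=; ring.
case: (normr1_cases s1) => ->; rewrite /jump ?mul1r ?mulN1r ?ltr01 ?ltr0N1 ?oppr_gt0.
  rewrite subr0 addr0; case: ltP => g0; last by rewrite mul0r mulr0 mulr0.
  have gn : (g n)%:C != 0 :> R[i] by rewrite -normc_gt0 normcR normr_gt0 gt_eqF.
  rewrite ge; move: (character _ _) => ch; rewrite -[1%:C]/(1 : R[i]).
  by field.
case: (ltgtP (g n) 0) => g0.
- have gn : (g n)%:C != 0 :> R[i] by rewrite -normc_gt0 normcR normr_gt0 lt_eqF.
  rewrite ge; move: (character _ _) => ch; rewrite sub0r addr0.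
  have -> : (-1)%:C = -1 :> R[i] by apply: complex_eqP => /=; rewrite ?oppr0.
  by field.
- by rewrite subrr mul0r mulr0 addr0 mulr0.
- rewrite g0 character0 sub0r mulr1.
  have -> : (-1)%:C = -1 :> R[i] by apply: complex_eqP => /=; rewrite ?oppr0.
  by rewrite mulrN1 addNr mulr0.
Qed.

Lemma lser_jet sg : `|sg| = 1 -> exists M,
  jet [set z | complex.Im z = sg * P] (lser sg)
    (fun z => c2pi * (csum (st sg z) + shift sg)) M.
Proof.
move=> s1; have p1 := @pi2_ge1 R.
pose D := [set z : R[i] | complex.Im z = sg * P].
have DY z : D z -> Y <= sg * complex.Im z.
  have s2 : sg * sg = 1 by case: (normr1_cases s1) => ->; ring.
  by move=> ->; rewrite mulrA s2 mul1r; lra.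
(* In the linear factor of [line_weight_le], the constant part costs [ratio]; the part proportional
   to the frequency cancels the division by [g n] and costs [weighted]. *)
pose M n := ratio n + 9 * (2 * pi) * weighted b g u Y n.
have jn n : jet D (lterm sg n) (fun z => if u n && (0 < sg * g n) then
     sg%:C * (b (g n) / (g n)%:C) * ((0 +i* (2 * pi * g n)) * character (g n) z) else 0) (M n).
  have M0 : 0 <= M n.
    apply: addr_ge0; last by apply: mulr_ge0; [lra|exact: weighted_ge0].
    by rewrite /ratio; case: ifP => // _; apply: mulr_ge0; [exact: normc_ge0|exact: expR_ge0].
  rewrite /lterm; case: (boolP (u n && _)) => [/andP[un sn]|_]; last first.
    by apply: jetW (jet_cst D 0); rewrite normc0.
  apply: jetW (jet_character_line _ _ _); rewrite -mulrA.
  apply: (le_trans (ler_wpM2l (normc_ge0 _) (line_weight_le Y sn s1))).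
  have gn : g n != 0 by apply: contraTneq sn => ->; rewrite mulr0 ltxx.
  have gp : 0 < `|g n| by rewrite normr_gt0.
  rewrite /M /ratio /weighted un gn /= normcM normcR s1 mul1r.
  rewrite normcM normcV normcR le_eqVlt; apply/orP; left; apply/eqP.
  by field; rewrite gt_eqF.
have sM : sum_le M (B1 + 9 * (2 * pi) * B).
  move=> N; rewrite big_split /= -mulr_sumr; apply: lerD; first exact: rB.
  by apply: ler_wpM2l; [lra|exact: wB].
exists (B1 + 9 * (2 * pi) * B); have := jet_csum jn sM.
apply: eq_jet => z /set_mem Dz //.
rewrite (eq_csum (f' := fun n => c2pi * (st sg z n + shift_term sg n))); last first.
  by move=> n; exact: lterm_derive.
have s0 : csummable (shift_term sg).
  rewrite /shift_term; case: (boolP (0 < sg)) => _; last exact: csummable_zero_term.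
  by apply: (@csummable_finite _ _ 0%N).
have s3 := csummable_spectral s1 (DY z Dz).
rewrite csumZ; last exact: csummableD.
rewrite csumD//; congr (_ * (_ + _)); rewrite /shift /shift_term.
by case: (boolP (0 < sg)) => _ //; exact: csum0.
Qed.

(** Cancels the constant contributed by [p] in [trace_formula], so that the logarithmic derivative
    of [qfun] is exactly - 2 pi i times the spectral series on both sides. *)
Definition expo : R[i] := - (c2pi * csum (st 1 p)).
Definition qfun z : R[i] := cprod p pt mult z * cexp (expo * z).
Definition qfun' z : R[i] :=
  cprod' p pt mult z * cexp (expo * z) + cprod p pt mult z * (expo * cexp (expo * z)).

Lemma qfun_order2 : order2 qfun qfun'.
Proof.
apply: order2M; last exact: order2_cexp.
have [C C0 hC] := cprod_jet S pt1.
pose q := normc p; have q0 : 0 <= q := normc_ge0 p.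
exists 1, (C * (1 + q) ^+ 2); split => //; first by apply: mulr_ge0 => //; exact: sqr_ge0.
move=> r r1; have r0 : 0 <= r by lra.
have rq : 1 <= r + q by lra.
apply: jetW (jet_subset _ (hC mult (r + q) S_inv rq)).
  rewrite mul1r ler_expR -mulrA; apply: ler_wpM2l => //.
  rewrite -exprMn lerXn2r ?nnegrE ?mulr_ge0 ?addr_ge0//.
  by rewrite mulrDl mul1r lerD2l ler_peMr.
by move=> z zr; apply: (le_trans (normcB _ _)); rewrite lerD.
Qed.

Lemma qfun'_side sg z : `|sg| = 1 -> Y <= sg * complex.Im z ->
  qfun' z = - (c2pi * csum (st sg z)) * qfun z.
Proof.
move=> s1 Yz; have YP : Y <= P by lra.
have PH : H + 1 <= P by have := HY; lra.
have sz : side H sg z by split => //; have := HY; lra.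
have hd n : mult n != 0%N -> 1 <= normc (z - pt n).
  by move=> _; exact: (side_dist A_strip eA H0 n sz).
rewrite /qfun' /qfun (cprod'_logder pt1 S_inv ltr01 hd).
rewrite (trace_formula A_strip A_pure eA eb H0 PH S_inv s1 HY YP Yz wB) /expo.
set x1 := cexp _; set x2 := cprod _ _ _ _; move: x1 x2 (csum (st sg z)) (csum (st 1 p)) => x1 x2 x3 x4; ring.
Qed.

(** No logarithm of [qfun] is taken: the product [F] of [qfun] with the inverses of the expected
    factors has derivative 0 along the line, by [qfun'_side] and [lser_jet]. *)
Lemma qfun_line sg (be : R) : `|sg| = 1 -> shift sg = be%:C ->
  exists C : R[i], forall x,
  qfun (x +i* (sg * P)) = C * character be (x +i* (sg * P)) * cexp (- lser sg (x +i* (sg * P))).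
Proof.
move=> s1 sE; pose D := [set z : R[i] | complex.Im z = sg * P].
have DY z : D z -> Y <= sg * complex.Im z.
  have s2 : sg * sg = 1 by case: (normr1_cases s1) => ->; ring.
  by move=> ->; rewrite mulrA s2 mul1r; lra.
pose F z := qfun z * (cexp (lser sg z) * character (- be) z).
pose a0 : R[i] := 0 +i* (sg * P).
suff FE x : F (x +i* (sg * P)) = F a0.
  exists (F a0) => x; rewrite -(FE x) /F characterN cexpN.
  set z := x +i* _; have := character_neq0 be z; have := cexp_neq0 (lser sg z).
  by move: (qfun z) (character be z) (cexp _) => c1 c2 c3 n1 n2; field; rewrite n1 n2.
have [C [c [C0 c0 jQ]]] := qfun_order2.
have [C' [c' [C'0 c'0 jX]]] := order2_character (- be).
have [M jL] := lser_jet s1.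
set z := x +i* (sg * P); pose r := 1 + normc a0 + `|x|.
have r1 : 1 <= r by have := normc_ge0 a0; have := normr_ge0 x; rewrite /r; lra.
(* The bounds for [qfun] and the character are available on balls, that for [lser] on the line; the
   segment from [a0] to [z] lies in both. *)
pose D' := [set w | D w /\ cball r w].
have jL' : jet D' _ _ _ := jet_subset (fun w (h : D' w) => h.1) jL.
have jQ' : jet D' _ _ _ := jet_subset (fun w (h : D' w) => h.2) (jQ r r1).
have jX' : jet D' _ _ _ := jet_subset (fun w (h : D' w) => h.2) (jX r r1).
have expR_mono (x1 x2 : R) : x1 <= x2 -> expR x1 <= expR x2 by rewrite ler_expR.
have jE := jet_cexp jL' (expR_ge0 M)
  (fun w Dw => le_trans (normc_cexp_le _) (expR_mono _ _ (jet_bound jL' Dw))).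
have jF := jetM jQ' (jetM jE jX').
apply: (jet_const jF).
  move=> w [Dw _]; rewrite (qfun'_side s1 (DY w Dw)) sE.
  have -> : 0 +i* (2 * pi * - be) = - (c2pi * be%:C) :> R[i].
    by apply: complex_eqP; rewrite ?Re_N ?Im_N ?Re_M ?Im_M /=; ring.
  by move: (qfun w) (csum _) (cexp _) (character _ _) => c1 c2 c3 c4; ring.
move=> t /andP[t0 t1].
have tE : a0 + t%:C * (z - a0) = (t * x) +i* (sg * P).
  by apply: complex_eqP; rewrite ?Re_D ?Im_D ?Re_M ?Im_M ?Re_B ?Im_B /=; ring.
rewrite tE; split => //.
have -> : (t * x) +i* (sg * P) = (t * x)%:C + a0.
  by apply: complex_eqP; rewrite ?Re_D ?Im_D /=; ring.
rewrite /mkset; apply: (le_trans (normcD _ _)); rewrite normcR normrM (ger0_norm t0) /r.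
have : t * `|x| <= `|x| by rewrite ler_piMl.
lra.
Qed.

End entire_function.

(** * Reality of the mean density *)

Section inverse_difference.
Context (R : realType).

Lemma Re_inv (z : R[i]) :
  complex.Re z^-1 = complex.Re z / (complex.Re z ^+ 2 + complex.Im z ^+ 2).
Proof. by case: z. Qed.

(** For real [a] the two real parts coincide. In general the squared distances from [a] to the two
    points differ by [- 4 * y * Im a], which yields the factor [H]; [2 * H <= y] keeps both squared
    distances above the denominator of the bound. *)
Lemma Re_inv_difference (a : R[i]) (y H : R) : `|complex.Im a| <= H -> 2 * H <= y -> 0 < y ->
  `|complex.Re (((0 +i* y) - a)^-1 - ((0 +i* (- y)) - a)^-1)| <=
    4 * H / (complex.Re a ^+ 2 + y ^+ 2 / 4).
Proof.
case: a => al be beH Hy y0; rewrite -[complex.Re (al +i* be)]/al.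
have {}beH : - H <= be <= H by rewrite -ler_norml.
have H0 : 0 <= H by lra.
set q := al ^+ 2 + y ^+ 2 / 4.
have q0 : 0 < q.
  have := sqr_ge0 al; have : 0 < y ^+ 2 by rewrite exprn_gt0.
  rewrite /q; lra.
rewrite Re_B !Re_inv !Re_B !Im_B /= sub0r sqrrN.
set D1 := al ^+ 2 + (y - be) ^+ 2; set D2 := al ^+ 2 + (- y - be) ^+ 2.
have d1 : q <= D1 by rewrite /q /D1; have : 0 <= (y - be) ^+ 2 - y ^+ 2 / 4; [rewrite !expr2; nra|lra].
have d2 : q <= D2 by rewrite /q /D2; have : 0 <= (- y - be) ^+ 2 - y ^+ 2 / 4; [rewrite !expr2; nra|lra].
have D10 : 0 < D1 by lra.
have D20 : 0 < D2 by lra.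
have -> : - al / D1 - - al / D2 = - 4 * (al * y) * be / (D1 * D2).
  have e : D1 - D2 = - 4 * y * be by rewrite /D1 /D2; ring.
  have -> : - 4 * (al * y) * be = al * (D1 - D2) by rewrite e; ring.
  by field; rewrite !gt_eqF.
rewrite normrM normfV (gtr0_norm (mulr_gt0 D10 D20)) ler_pdivrMr ?mulr_gt0//.
have aq : `|al * y| <= q.
  rewrite /q ler_norml; have := sqr_ge0 (al - y / 2); have := sqr_ge0 (al + y / 2).
  by rewrite !expr2; lra.
have bH : `|be| <= H by rewrite ler_norml.
have -> : `|- 4 * (al * y) * be| = 4 * (`|al * y| * `|be|).
  by rewrite !normrM normrN (@ger0_norm _ 4)//; ring.
rewrite -!mulrA ler_pM2l//.
apply: (@le_trans _ _ (q * H)); first by apply: ler_pM.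
rewrite (mulrC q); apply: ler_wpM2l => //.
rewrite -ler_pdivrMl ?invr_gt0// invrK; apply: ler_pM => //; lra.
Qed.

End inverse_difference.

Section mean_density.
Context (R : realType) (H : R) (A : R[i] -> nat) (b : R -> R[i]).
Context (e : nat -> R[i]) (v : nat -> bool) (g : nat -> R) (u : nat -> bool).
Hypothesis A_strip : msupp A `<=` strip H.
Hypothesis A_pure : is_pure_point (fourier_c_measure (multiset_measure A)) b.
Hypothesis eA : enumerates (msupp A) e v.
Hypothesis eb : enumerates (spectrum b) g u.
Variables (Y S B : R).
Hypothesis H0 : 0 <= H.
Hypothesis HY : H + 1 <= Y.
Local Notation P := (Y + 2).
Local Notation p := (0 +i* P).
Local Notation mult := (mmult A e v).
Local Notation pt := (mpt e v).
Hypothesis S_inv : sum_le (inv_sq p pt mult) S.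
Hypothesis wB : sum_le (weighted b g u Y) B.
Local Notation c2pi := (0 +i* (2 * pi) : R[i]).
Local Notation st := (spectral_term b g u).

Let y (k : nat) : R := P + H + k%:R.

(** By [lterm_derive], 2 pi i times the deviation from the limit is the derivative of an [lterm]: it
    is 0 unless [0 < sg * g n], and then decays exponentially with the height. *)
Lemma spectral_term_cvg (sg : R) n : `|sg| = 1 ->
  ccvg (fun k => st sg (0 +i* (sg * y k)) n) (- shift_term b g u sg n).
Proof.
move=> s1; have p1 := @pi2_ge1 R; have Y1 : 1 <= Y by have := H0; have := HY; lra.
have le k : normc (st sg (0 +i* (sg * y k)) n - - shift_term b g u sg n) <=
    normc (c2pi * (st sg (0 +i* (sg * y k)) n + shift_term b g u sg n)).
  rewrite opprK normcM normc_2pi ler_peMl//; exact: normc_ge0.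
apply/ccvgP => eps e0.
have [c|c] := boolP (u n && (0 < sg * g n)); last first.
  exists 0%N => k _; apply: (le_lt_trans (le k)).
  by rewrite -lterm_derive// (negbTE c) normc0.
have /andP[_ sn] := c; set a := 2 * pi * (sg * g n).
have a0 : 0 < a by apply: mulr_gt0 => //; lra.
pose K := normc (sg%:C * (b (g n) / (g n)%:C)) * normc (0 +i* (2 * pi * g n) : R[i]).
have K0 : 0 <= K by apply: mulr_ge0; exact: normc_ge0.
have K1 : 0 < K / a + 1 by have := divr_ge0 K0 (ltW a0); lra.
have [N hN] := harmonic_bound (divr_gt0 e0 K1).
exists N => k /hN; rewrite ltr_pdivlMr// => hk.
apply: le_lt_trans hk; apply: (le_trans (le k)); rewrite -lterm_derive// c.
have nE (w1 w2 w3 : R[i]) : normc (w1 * (w2 * w3)) = normc w1 * normc w2 * normc w3.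
  by rewrite normcM normcM mulrA.
rewrite nE -/K normc_character.
have -> : 2 * pi * g n * complex.Im (0 +i* (sg * y k)) = a * y k by rewrite /= /a; ring.
have yk : k.+1%:R <= y k by rewrite /y -natr1; have := H0; lra.
have k0 : 0 < k.+1%:R :> R by rewrite ltr0n.
have ak0 : 0 < a * k.+1%:R := mulr_gt0 a0 k0.
have ek : expR (- (a * y k)) <= (a * k.+1%:R)^-1.
  rewrite expRN lef_pV2 ?posrE ?expR_gt0//.
  apply: (@le_trans _ _ (a * y k)); first by apply: ler_wpM2l => //; exact: ltW.
  by apply: le_trans (expR_ge1Dx _); lra.
apply: (le_trans (ler_wpM2l K0 ek)).
rewrite div1r invfM mulrA [leRHS]mulrC; apply: ler_wpM2r; first by rewrite invr_ge0 ltW.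
lra.
Qed.

(** The difference of the logarithmic derivatives at i y and - i y tends to - 2 pi i b_0 by the
    spectral formula, while its real part tends to 0 by the sum over the zeros. Hence 2 pi Im b_0 =
    0. *)
Lemma mean_density_real : complex.Im (mean_density b g u) = 0.
Proof.
have p1 := @pi2_ge1 R; have Y1 : 1 <= Y by have := H0; have := HY; lra.
have y0 k : P <= y k by rewrite /y; have := H0; have := ler0n R k; lra.
have pt1 n : 1 <= normc (p - pt n).
  by apply: (mpt_dist H0 A_strip eA); have := HY; lra.
have PH : H + 1 <= P by have := HY; lra.
have YP : Y <= P by lra.
have n1 : `|-1| = 1 :> R by rewrite normrN normr1.
have n2 : `|1| = 1 :> R by rewrite normr1.
pose z sg k : R[i] := 0 +i* (sg * y k).
have zY sg k : `|sg| = 1 -> Y <= sg * complex.Im (z sg k).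
  move=> s1; have s2 : sg * sg = 1 by case: (normr1_cases s1) => ->; ring.
  by rewrite /= mulrA s2 mul1r; have := y0 k; lra.
have zs sg k : `|sg| = 1 -> side H sg (z sg k).
  by move=> s1; split => //; have := zY sg k s1; have := HY; lra.
pose G := logder_sum p pt mult.
have GE sg k : `|sg| = 1 -> G (z sg k) = - c2pi * (csum (st sg (z sg k)) - csum (st 1 p)).
  by move=> s1; exact: (trace_formula A_strip A_pure eA eb H0 PH S_inv s1 HY YP (zY sg k s1) wB).
have Sc sg : `|sg| = 1 -> ccvg (fun k => csum (st sg (z sg k))) (csum (fun n => - shift_term b g u sg n)).
  move=> s1; apply: (csum_tannery (fun k n => spectral_term_le b g u n s1 (zY sg k s1)) wB) => n.
  exact: spectral_term_cvg.
have lim1 : ccvg (fun k => G (z 1 k) - G (z (-1) k)) (- (c2pi * mean_density b g u)).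
  have h := ccvgZ (- c2pi) (ccvgB (Sc _ n2) (Sc _ n1)).
  have e1 : csum (fun n => - shift_term b g u 1 n) = 0.
    by rewrite -[RHS]csum0; apply: eq_csum => n; rewrite /shift_term ltr01 oppr0.
  have e2 : csum (fun n => - shift_term b g u (-1) n) = - mean_density b g u.
    rewrite /mean_density -(csumN (csummable_zero_term wB)); apply: eq_csum => n; by rewrite /shift_term ltr0N1.
  rewrite e1 e2 sub0r opprK mulNr in h; apply: eq_ccvg h => k.
  by rewrite !GE//; move: (csum _) (csum _) (csum _) => x1 x2 x3; ring.
pose t k n : R[i] := (z 1 k - pt n)^-1 - (z (-1) k - pt n)^-1.
have lim2 : ccvg (fun k => csum (fun n => ((mult n)%:R * complex.Re (t k n))%:C)) 0.
  (* The first bound, summable over the zeros, is the majorant; the second sends each single term to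
     0. *)
  have dom k n : normc (((mult n)%:R * complex.Re (t k n))%:C) <=
      Num.min (64 * H * inv_sq p pt mult n) ((mult n)%:R * (16 * H) / k.+1%:R).
    have i1 := mpt_Im A_strip eA H0 n.
    have yk : 0 < y k by have := y0 k; lra.
    have := Re_inv_difference (y := y k) i1 _ yk.
    have -> : (0 +i* y k - pt n)^-1 - (0 +i* (- y k) - pt n)^-1 = t k n.
      by rewrite /t /z mul1r mulN1r.
    have Hy : 2 * H <= y k by rewrite /y; have := HY; have := ler0n R k; lra.
    move=> /(_ Hy) hb.
    set q := complex.Re (pt n) ^+ 2 + y k ^+ 2 / 4 in hb.
    have y2 : 0 < y k ^+ 2 by rewrite exprn_gt0.
    have a2 : 0 <= complex.Re (pt n) ^+ 2 := sqr_ge0 _.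
    have q0 : 0 < q by rewrite /q; lra.
    rewrite normcR normrM ger0_norm// le_min; apply/andP; split.
      rewrite /inv_sq mulrCA; apply: ler_wpM2l => //; apply: (le_trans hb).
      have d0 : 0 < normc (p - pt n) ^+ 2 by rewrite exprn_gt0// (lt_le_trans ltr01)// pt1.
      have dq : normc (p - pt n) ^+ 2 <= 16 * q.
        rewrite normc_sqr Re_B Im_B /= sub0r sqrrN /q.
        have i2 : - H <= complex.Im (pt n) <= H by rewrite -ler_norml.
        have : (P - complex.Im (pt n)) ^+ 2 <= 4 * y k ^+ 2.
          have -> : 4 * y k ^+ 2 = (2 * y k) ^+ 2 by ring.
          by rewrite lerXn2r ?nnegrE//; have := y0 k; have := H0; have := HY; lra.
        lra.
      rewrite ler_pdivrMr// [leRHS]mulrAC ler_pdivlMr//; apply: (@le_trans _ _ (4 * H * (16 * q))).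
        by apply: ler_wpM2l => //; have := H0; lra.
      by rewrite le_eqVlt; apply/orP; left; apply/eqP; ring.
    rewrite -mulrA; apply: ler_wpM2l => //; apply: (le_trans hb).
    have kk : k.+1%:R <= y k by rewrite /y -natr1; have := H0; lra.
    have k1 : 1 <= k.+1%:R :> R by rewrite ler1n.
    have kq : k.+1%:R <= 4 * q.
      have : k.+1%:R * 1 <= y k * y k by apply: ler_pM => //; lra.
      by rewrite -expr2 /q; lra.
    rewrite ler_pdivrMr// mulrAC ler_pdivlMr ?ltr0n//.
    apply: (@le_trans _ _ (4 * H * (4 * q))); first by apply: ler_wpM2l => //; have := H0; lra.
    by rewrite le_eqVlt; apply/orP; left; apply/eqP; ring.
  rewrite -[X in ccvg _ X]csum0.
  apply: (@csum_tannery _ _ _ (fun n => 64 * H * inv_sq p pt mult n) (64 * H * S)).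
  - by move=> k n; have := dom k n; rewrite le_min => /andP[].
  - by move=> N; rewrite -mulr_sumr; apply: ler_wpM2l; [have := H0; lra|exact: S_inv].
  move=> n; apply/ccvgP => eps e0.
  pose K := (mult n)%:R * (16 * H).
  have K0 : 0 <= K by apply: mulr_ge0 => //; have := H0; lra.
  have K1 : 0 < K + 1 by lra.
  have [N hN] := harmonic_bound (divr_gt0 e0 K1).
  exists N => k /hN; rewrite ltr_pdivlMr// => hk; rewrite subr0; apply: le_lt_trans hk.
  have := dom k n; rewrite le_min => /andP[_ h]; apply: (le_trans h).
  by rewrite -/K mulrC div1r; apply: ler_wpM2l; [rewrite invr_ge0|lra].
have ReG k : complex.Re (G (z 1 k) - G (z (-1) k)) =
    complex.Re (csum (fun n => ((mult n)%:R * complex.Re (t k n))%:C)).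
  have d1 n : mult n != 0%N -> 1 <= normc (z 1 k - pt n).
    by move=> _; exact: (side_dist A_strip eA H0 n (zs 1 k n2)).
  have d2 n : mult n != 0%N -> 1 <= normc (z (-1) k - pt n).
    by move=> _; exact: (side_dist A_strip eA H0 n (zs (-1) k n1)).
  have s1 := csummable_logder pt1 S_inv ltr01 d1.
  have s2 := csummable_logder pt1 S_inv ltr01 d2.
  rewrite /G /logder_sum -csumB//.
  set f := fun n => _; have fE n : f n = (mult n)%:R * t k n by rewrite /f /t; ring.
  rewrite (eq_csum fE); rewrite /csum /cintegral [LHS]/=; congr fine.
  apply: eq_integral => n _; congr EFin => /=.
  have -> : (mult n)%:R = ((mult n)%:R : R)%:C :> R[i] by rewrite rmorph_nat.
  by rewrite Re_M /= mul0r subr0.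
have h1 := ccvg_Re lim1; have h2 := ccvg_Re lim2.
rewrite (_ : (fun n => _) = fun k => complex.Re
  (csum (fun n => ((mult n)%:R * complex.Re (t k n))%:C))) in h1; last by apply/funext => k; exact: ReG.
have : complex.Re (- (c2pi * mean_density b g u)) = complex.Re (0 : R[i]).
  exact: (cvg_unique _ h1 h2).
rewrite Re_N Re_M /= mul0r sub0r opprK => /eqP; rewrite mulf_eq0 => /orP[/eqP|/eqP//].
lra.
Qed.

End mean_density.

(** * Frequencies and zeros *)

Section generated_monoid.
Context (R : realType).
Implicit Types (G : set R) (a : R).

Definition monoid_of G : set R :=
  [set a | exists2 s : seq R, (forall x, x \in s -> G x) & a = \sum_(x <- s) x].

Lemma monoid_of0 G : monoid_of G 0.
Proof. by exists [::]; rewrite ?big_nil. Qed.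

Lemma monoid_ofD G a c : monoid_of G a -> monoid_of G c -> monoid_of G (a + c).
Proof.
move=> [s sG ->] [s' s'G ->]; exists (s ++ s'); last by rewrite big_cat.
by move=> x; rewrite mem_cat => /orP[/sG|/s'G].
Qed.

Lemma monoid_of_mem G a : G a -> monoid_of G a.
Proof. by move=> Ga; exists [:: a]; [move=> x; rewrite inE => /eqP ->|rewrite big_seq1]. Qed.

Lemma monoid_of_ge0 G (sg : R) a : (forall x, G x -> 0 <= sg * x) -> monoid_of G a -> 0 <= sg * a.
Proof.
move=> hG [s sG ->]; rewrite mulr_sumr big_seq; apply: sumr_ge0 => x /sG; exact: hG.
Qed.

Fixpoint sums_le (F : set R) (n : nat) : set R :=
  if n is n'.+1 then [set 0] `|` [set x + y | x in F & y in sums_le F n'] else [set 0].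

Lemma sums_le_finite F n : finite_set F -> finite_set (sums_le F n).
Proof.
move=> fF; elim: n => [|n ih] /=; first exact: finite_set1.
by rewrite finite_setU; split; [exact: finite_set1|exact: finite_image2].
Qed.

Lemma sums_leP F n (s : seq R) : (size s <= n)%N -> (forall x, x \in s -> F x) ->
  sums_le F n (\sum_(x <- s) x).
Proof.
elim: n s => [|n ih] [|x s] //= hs sF; rewrite ?big_nil//; first by left.
right; rewrite big_cons; exists x; first by apply: sF; rewrite mem_head.
exists (\sum_(x <- s) x) => //; apply: ih => // z zs; apply: sF.
by rewrite inE zs orbT.
Qed.

Lemma finite_pos_bound (F : set R) : finite_set F -> (forall x, F x -> 0 < x) ->
  exists2 d : R, 0 < d & forall x, F x -> d <= x.
Proof.
move=> /finite_setP[n]; elim: n F => [|n ih] F.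
  by rewrite II0 card_eq0 => /eqP -> _; exists 1.
move=> /eq_cardSP[x Fx /ih h] F0.
have [d d0 hd] := h (fun y hy => F0 y hy.1).
exists (Num.min d x); first by rewrite lt_min d0 F0.
move=> y Fy; rewrite ge_min; have [->|yx] := eqVneq y x; first by rewrite lexx orbT.
by rewrite hd//; split => // /eqP; exact/negP.
Qed.

Lemma size_mul_le_sum (s : seq R) (d : R) : (forall x, x \in s -> d <= x) ->
  (size s)%:R * d <= \sum_(x <- s) x.
Proof.
elim: s => [|x s ih] h; first by rewrite mul0r big_nil.
rewrite big_cons /= -natr1 mulrDl mul1r addrC lerD//.
  by apply: h; rewrite mem_head.
by apply: ih => y ys; apply: h; rewrite inE ys orbT.
Qed.

(** A sum of positive generators that is at most [M] involves only generators at most [M]; these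
    have a positive lower bound [d], so there are at most [M / d] summands. *)
Lemma monoid_of_finite G (M : R) : (forall x, G x -> 0 < x) ->
  finite_set (G `&` [set x | x <= M]) -> finite_set (monoid_of G `&` [set x | x <= M]).
Proof.
move=> G0 fF; set F := _ `&` _ in fF.
have [d d0 hd] := finite_pos_bound fF (fun x hx => G0 x hx.1).
pose N := (Num.truncn (M / d)).+1.
apply: (sub_finite_set _ (sums_le_finite N fF)) => a [[s sG ->] sM].
have sF x : x \in s -> F x.
  move=> xs; split; first exact: sG.
  apply: le_trans sM; rewrite (big_rem x)//= lerDl big_seq; apply: sumr_ge0 => z zs.
  by apply/ltW/G0/sG; exact: mem_rem zs.
apply: (@sums_leP F N s) => //.
have h : (size s)%:R * d <= M.
  by apply: le_trans sM; apply: size_mul_le_sum => x /sF /hd.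
rewrite /N -(ler_nat R); apply: ltW; rewrite -ler_pdivlMr// in h.
by apply: (le_lt_trans h); exact: truncnS_gt.
Qed.

End generated_monoid.

Section zero_set.
Context (R : realType).

Lemma derivableM_complex (f h : R[i] -> R[i]) (z : R[i]) : derivable f z 1 -> derivable h z 1 ->
  derivable (fun z => f z * h z) z 1.
Proof. by move=> df dh; exact: (@derivableM _ _ f h z 1 df dh). Qed.

Lemma zero_orderM (f h : R[i] -> R[i]) (a : R[i]) m : zero_order f a m ->
  (\forall z \near a, derivable h z 1) -> h a != 0 ->
  zero_order (fun z => f z * h z) a m.
Proof.
move=> [k [dk ka fE]] dh ha; have pf : ProperFilter (nbhs (a : R[i])) by exact: nbhs_pfilter.
exists (fun z => k z * h z); split.
- by apply: filterS2 dk dh => z; exact: derivableM_complex.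
- by rewrite mulf_neq0.
- by apply: filterS fE => z ->; rewrite mulrA.
Qed.

End zero_set.

Section dirichlet_on_lines.
Context (R : realType) (H : R) (A : R[i] -> nat) (b : R -> R[i]).
Context (e : nat -> R[i]) (v : nat -> bool) (g : nat -> R) (u : nat -> bool).
Hypothesis A_strip : msupp A `<=` strip H.
Hypothesis A_pure : is_pure_point (fourier_c_measure (multiset_measure A)) b.
Hypothesis eA : enumerates (msupp A) e v.
Hypothesis eb : enumerates (spectrum b) g u.
Variables (Y S B B1 : R).
Hypothesis H0 : 0 <= H.
Hypothesis HY : H + 1 <= Y.
Local Notation P := (Y + 2).
Local Notation p := (0 +i* P).
Local Notation mult := (mmult A e v).
Local Notation pt := (mpt e v).
Hypothesis S_inv : sum_le (inv_sq p pt mult) S.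
Hypothesis wB : sum_le (weighted b g u Y) B.
Hypothesis rB : sum_le (ratio b g u Y) B1.
Implicit Types (z : R[i]) (sg t : R).
Local Notation cball r := [set z : R[i] | normc z <= r].
Local Notation c2pi := (0 +i* (2 * pi) : R[i]).
Local Notation st := (spectral_term b g u).

Definition positive_side sg : set R := [set a | spectrum b a /\ 0 < sg * a].

(** The end point of the frequencies as seen from the side [sg]: 0 from above, b_0 from below. *)
Definition edge sg : R := if 0 < sg then 0 else complex.Re (mean_density b g u).

Local Notation q := (qfun A b e v g u Y).

(** This is where the reality of b_0 enters: the factor split off on the lower line must be a
    character with real frequency. *)
Lemma shift_edge sg : shift b g u sg = (edge sg)%:C.
Proof.
rewrite /shift /edge; case: ifP => // _; apply: complex_eqP => //.
exact: (mean_density_real A_strip A_pure eA eb H0 HY S_inv wB).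
Qed.

Lemma dser_lser sg : `|sg| = 1 -> exists B', dser (monoid_of (positive_side sg)) (sg * P) B'
  (fun x => - lser b g u sg (x +i* (sg * P))).
Proof.
move=> s1; have p1 := @pi2_ge1 R; have [uD _ _] := eb.
pose c n : R[i] := if u n && (0 < sg * g n) then - (sg%:C * (b (g n) / (g n)%:C)) else 0.
pose om n : R := if u n && (0 < sg * g n) then g n else 0.
have cs : sum_le (fun n => normc (c n) * wt (sg * P) (om n)) B1.
  apply: sum_leW rB => n; rewrite /c /om /ratio; case: (boolP (u n && (0 < _))) => [/andP[un sn]|_]; last first.
    rewrite normc0 mul0r; case: ifP => // _.
    by apply: mulr_ge0; [exact: normc_ge0|exact: expR_ge0].
  have gn : g n != 0 by apply: contraTneq sn => ->; rewrite mulr0 ltxx.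
  rewrite un gn normcN normcM normcR s1 mul1r; apply: ler_wpM2l; first exact: normc_ge0.
  rewrite /wt ler_expR lerN2.
  have -> : `|g n| = sg * g n by rewrite -(gtr0_norm sn) normrM s1 mul1r.
  have -> : 2 * pi * g n * (sg * P) = 2 * pi * (sg * g n) * P by ring.
  apply: ler_wpM2l; last lra.
  by apply: mulr_ge0; [lra|exact: ltW].
have cl n z : c n * character (om n) z = - lterm b g u sg n z.
  rewrite /lterm /c /om; case: (boolP (u n && (0 < _))) => _; last by rewrite oppr0 mul0r.
  by rewrite mulNr.
exists B1, c, om; split => //.
  move=> n; rewrite /om; case: ifP => [/andP[/uD un sn]|_]; last exact: monoid_of0.
  by apply: monoid_of_mem; split.
move=> x; rewrite (eq_csum (fun n => cl n (x +i* (sg * P)))) csumN//.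
apply: (csummable_dom _ cs) => n.
by rewrite -(normc_character_line (sg * P) (om n) x) -normcM cl normcN.
Qed.

(** Exponentiating [lser] stays in the monoid generated by one half of the spectrum, and the
    character of [qfun_line] translates all frequencies by [edge sg]. *)
Lemma line_dirichlet sg : `|sg| = 1 -> exists (c : nat -> R[i]) (om : nat -> R) (B' : R),
  [/\ forall n, monoid_of (positive_side sg) (om n - edge sg),
      sum_le (fun n => normc (c n) * wt (sg * P) (om n)) B' &
      forall x, q (x +i* (sg * P)) = csum (fun n => c n * character (om n) (x +i* (sg * P)))].
Proof.
move=> s1; have [B' dl] := dser_lser s1.
have [c [om [hL hc hE]]] := dser_cexp (monoid_of0 _) (@monoid_ofD _ _) dl.
have [C hC] := qfun_line A_strip A_pure eA eb H0 HY S_inv wB rB s1 (shift_edge sg).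
exists (fun n => C * c n), (fun n => edge sg + om n), (normc C * wt (sg * P) (edge sg) * expR B').
split.
- by move=> n; rewrite addrC addKr.
- move=> N; apply: le_trans (ler_wpM2l _ (hc N)); last first.
    by apply: mulr_ge0; [exact: normc_ge0|exact: expR_ge0].
  rewrite mulr_sumr; apply: ler_sum => n _; rewrite normcM wtD.
  by rewrite le_eqVlt; apply/orP; left; apply/eqP; ring.
- move=> x; rewrite hC hE -csumZ.
    apply: eq_csum => n; rewrite characterD.
    by move: (character _ _) (character _ _) => x1 x2; ring.
  by apply: (csummable_dom _ hc) => n; rewrite normcM normc_character_line.
Qed.

Lemma qfun_zero_set : has_zero_set q A.
Proof.
move=> a; have pt1 n : 1 <= normc (p - pt n).
  by apply: (mpt_dist H0 A_strip eA); have := HY; lra.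
have [vD vi De] := eA.
have dE : \forall z \near a, derivable (fun z => cexp (expo b g u Y * z)) z 1.
  have [C [c [_ _ h]]] := order2_cexp (expo b g u Y).
  have r1 : 1 <= normc a + 1 by rewrite lerDr normc_ge0.
  apply: (@near_normc _ a (1 / 2)); first lra.
  move=> z za; apply: (jet_derivable (h _ r1) (r := 1 / 2)); first lra.
  move=> w wz; have -> : w = (w - z) + (z - a) + a by ring.
  apply: (le_trans (normcD _ _)); rewrite [leRHS]addrC lerD2r.
  by apply: (le_trans (normcD _ _)); lra.
apply: zero_orderM dE (cexp_neq0 _).
have [Aa|Aa] := eqVneq (A a) 0%N.
  rewrite Aa; apply: (zero_order_cprod0 pt1 S_inv) => n mn.
  have vn := mmult_neq0 mn; apply: contraNneq mn => ae.
  by rewrite /mmult vn; move: ae; rewrite /mpt vn => <-; rewrite Aa.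
have [m vm em] := De a Aa.
have ptm : pt m = a by rewrite /mpt vm.
have mm : mult m = A a by rewrite /mmult vm em.
have := @zero_order_cprod _ p pt S pt1 mult m S_inv.
rewrite ptm mm; apply=> n mn nm.
have vn := mmult_neq0 mn; rewrite /mpt vn -em; apply: contraNneq nm => emn.
by apply/eqP/esym/vi.
Qed.

End dirichlet_on_lines.

Theorem theorem2 (R : realType) (H : R) (A : R[i] -> nat) (b : R -> R[i])
    (H_ge0 : 0 <= H)
    (A_strip : msupp A `<=` strip H)
    (A_ap : almost_periodic_multiset A)
    (A_pure : is_pure_point (fourier_c_measure (multiset_measure A)) b)
    (b_growth : log_bigO_id (fun r : R =>
      (\esum_(g in spectrum b `&` [set g : R | `|g| < r]%R)
        (normc (b g))%:E)%E))
    (b_near0 :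
      (\esum_(g in spectrum b `&` [set g : R | 0 < `|g| < 1]%R)
        (normc (b g / g%:C))%:E < +oo)%E) :
  exists (Q : R[i] -> R[i]) (Omega : set R) (q : R -> R[i]),
    [/\ is_dirichlet_series Q Omega q,
        has_zero_set Q A &
        locally_finite (spectrum b) -> is_exponential_polynomial Q].
Proof.
have [lfA _] := A_ap; have [cb lb _] := A_pure.
have [e [v eA]] := countable_enumerates (0 : R[i]) (locally_finite_countable lfA).
have [g [u eb]] := countable_enumerates (0 : R) cb.
have [uD _ _] := eb.
have [Y0 hY0] := weighted_summable eb lb b_growth.
pose Y := Num.max Y0 (H + 1).
have HY : H + 1 <= Y by rewrite le_max lexx orbT.
have [B wB] : exists B, sum_le (weighted b g u Y) B by apply: hY0; rewrite le_max lexx.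
have p1 := @pi2_ge1 R.
(* Frequencies of modulus below 1 are covered by the hypothesis on [b g / g]; for the others the
   division only decreases the term of [weighted]. *)
have [B1 rB] : exists B1, sum_le (ratio b g u Y) B1.
  set E := (X in (X < _)%E) in b_near0.
  have Ef : E \is a fin_num.
    by rewrite ge0_fin_numE//; apply: esum_ge0 => i _; rewrite lee_fin; exact: normc_ge0.
  have hE : (E <= (fine E)%:E)%E by rewrite fineK.
  have near := sum_le_restricted eb (fun i _ => normc_ge0 (b i / i%:C)) hE.
  exists (fine E + B) => N.
  apply: le_trans (lerD (near N) (wB N)); rewrite -big_split; apply: ler_sum => n _.
  have w0 := weighted_ge0 b g u Y n.
  rewrite /ratio; case: (boolP (u n && _)) => [/andP[un gn]|_]; last first.
    by apply: addr_ge0 => //; do 2?case: ifP => // _; exact: normc_ge0.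
  have g0 : 0 < `|g n| by rewrite normr_gt0.
  have x1 : expR (- (2 * pi * `|g n| * Y)) <= 1.
    rewrite -[leRHS]expR0 ler_expR oppr_le0; apply: mulr_ge0; last lra.
    by apply: mulr_ge0 => //; lra.
  rewrite un; case: (boolP (g n \in _)) => [_|g1].
    rewrite -[leLHS]addr0; apply: lerD => //.
    by rewrite ler_piMr//; exact: normc_ge0.
  have {}g1 : 1 <= `|g n|.
    by rewrite leNgt; apply: contra g1 => g1; apply/mem_set => /=; rewrite g0.
  rewrite -[leLHS]add0r; apply: lerD => //; rewrite /weighted un; apply: ler_wpM2r; first exact: expR_ge0.
  by rewrite normcM normcV normcR ler_piMr ?normc_ge0// invf_le1.
have HP : H + 1 <= Y + 2 by lra.
have [S Sinv] := inv_sq_summable H_ge0 A_strip A_ap eA HP.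
pose Q := qfun A b e v g u Y.
have n1 : `|-1| = 1 :> R by rewrite normrN normr1.
have ld sg (s1 : `|sg| = 1) := line_dirichlet A_strip A_pure eA eb H_ge0 HY Sinv wB rB s1.
have [c1 [om1 [B1' [L1 S1 E1]]]] := ld 1 (normr1 R).
have [c2 [om2 [B2' [L2 S2 E2]]]] := ld (-1) n1.
have oQ : order2 Q _ := qfun_order2 b g u A_strip eA H_ge0 HY Sinv.
(* [mean_seq] refers to no line, so its limit, computed from either expansion, gives the same total
   coefficient. *)
have coefE w : coef c1 om1 w = coef c2 om2 w.
  have m1 := mean_seq_cvg w oQ S1 E1; have m2 := mean_seq_cvg w oQ S2 E2.
  exact: (mulIf (kern_mass_neq0 R) (ccvg_unique m1 m2)).
pose b0 := complex.Re (mean_density b g u).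
(* A frequency with nonzero coefficient occurs in both expansions: the upper one places it in the
   monoid of the positive spectrum, the lower one gives [w - b0 <= 0]. *)
have range w : coef_supp c1 om1 w ->
    [/\ monoid_of (positive_side b 1) w, 0 <= w & w <= b0].
  move=> sw; have [n /eqP on] := coef_supp_range sw.
  have sw2 : coef_supp c2 om2 w by rewrite /coef_supp /= -coefE.
  have [m /eqP om] := coef_supp_range sw2.
  have h1 := L1 n; have h2 := L2 m.
  rewrite /edge ltr01 on subr0 in h1; rewrite /edge ltr0N1 om in h2.
  have k1 := @monoid_of_ge0 R _ 1 _ (fun x (hx : positive_side b 1 x) => ltW hx.2) h1.
  have k2 := @monoid_of_ge0 R _ (-1) _ (fun x (hx : positive_side b (-1) x) => ltW hx.2) h2.
  by split => //; rewrite /b0; lra.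
have dQ : is_dirichlet_series Q (coef_supp c1 om1) (coef c1 om1).
  apply: (regrouped_dirichlet S1 oQ E1 (M := b0)) => w /range[_ w0 wb].
  by rewrite ger0_norm.
exists Q, (coef_supp c1 om1), (coef c1 om1); split => //.
  exact: (qfun_zero_set b g u A_strip eA H_ge0 HY Sinv).
move=> lfb; apply: (finite_dirichlet_exponential_polynomial dQ).
apply: (sub_finite_set (B := monoid_of (positive_side b 1) `&` [set x | x <= b0])).
  by move=> w /range[h _ wb]; split.
apply: monoid_of_finite; first by move=> x [_]; rewrite mul1r.
(* The generators that are at most [b0] lie in the compact segment [0, b0]. *)
apply: (sub_finite_set _ (lfb `[0, b0]%classic (@segment_compact _ _ _))).
by move=> x [[sx]]; rewrite mul1r => x0 xb; split => //=; rewrite in_itv /= ltW.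
Qed.
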